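(* Let $\mathfrak{g}_k$ be $\mathfrak{sp}_{2k}$ (symplectic case) or $\mathfrak{o}_{2k+1}$ (orthogonal case), $k\ge1$, let $\lambda$ be the highest weight of a finite-dimensional irreducible $\mathfrak{g}_k$-module $V_\lambda$ and $\mu$ the highest weight of a finite-dimensional irreducible $\mathfrak{g}_{k-1}$-module occurring in the restriction of $V_\lambda$. For $z=(z_1,\dots,z_k)\in\mathbb{C}^k$ consider the following $\mathrm{Y}^{\mp}(2)$-module $M(z)$: in the symplectic case $M(z)=\bigotimes_{j=1}^kL(\alpha_j+z_j,\beta_j+z_j)$; in the orthogonal case $M(z)=U(z)\oplus U'(z)$, where $U(z)$, $U'(z)$ are obtained from the modules $U,U'$ below by replacing every factor $L(a_j,b_j)$ by $L(a_j+z_j,b_j+z_j)$ and keeping the one-dimensional factor $W(\delta)$. Identify the underlying space of $M(z)$ with a fixed space via $L(a+z_j,b+z_j)\cong V_{a-b}$ as $\mathfrak{sl}_2$-modules. Then there is a continuous path $z(t)$, $t\in[0,\infty)$, with $z(0)=0$ (so that $M(z(0))$ is the multiplicity space $\mathrm{Hom}_{\mathfrak{g}_{k-1}}(V_\mu,V_\lambda)$ with its natural $\mathrm{Y}^{\mp}(2)$-action), such that the image of $\mathcal{B}^{\mp}$ in $\mathrm{End}(M(z(t)))$ has simple spectrum for all $t>0$, and the corresponding eigenbasis (followed continuously in $t$) tends, as $t\to+\infty$, to the basis formed by tensor products of $h$-weight vectors of the $\mathfrak{sl}_2$-modules $V_{a_j-b_j}$ (in each summand $U,U'$ in the orthogonal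 case).
   Context: $\mathrm{Y}(2)$ is the Yangian with generators $t^{(r)}_{ij}$, $i,j\in\{-1,1\}$, $r\ge1$, relations $[t^{(r+1)}_{ij},t^{(s)}_{kl}]-[t^{(r)}_{ij},t^{(s+1)}_{kl}]=t^{(r)}_{kj}t^{(s)}_{il}-t^{(s)}_{kj}t^{(r)}_{il}$, $t^{(0)}_{ij}=\delta_{ij}$, series $t_{ij}(u)=\sum_r t^{(r)}_{ij}u^{-r}$ and coproduct $\Delta(t_{ij}(u))=\sum_{c\in\{\pm1\}}t_{ic}(u)\otimes t_{cj}(u)$. Put $s_{ij}(u)=\sum_{a\in\{\pm1\}}\theta_{aj}t_{ia}(u)t_{-j,-a}(-u)=\delta_{ij}+\sum_{M\ge1}s_{ij}^{(M)}u^{-M}$ with $\theta_{aj}=\mathrm{sgn}(a)\mathrm{sgn}(j)$ (symplectic case, algebra $\mathrm{Y}^-(2)$) or $\theta_{aj}=1$ (orthogonal case, algebra $\mathrm{Y}^+(2)$); $\mathrm{Y}^{\mp}(2)$ is generated by the $s^{(M)}_{ij}$, and $\Delta(\mathrm{Y}^{\mp}(2))\subset\mathrm{Y}(2)\otimes\mathrm{Y}^{\mp}(2)$. $\mathcal{B}^{\mp}\subset\mathrm{Y}^{\mp}(2)$ is the subalgebra generated by the center of $\mathrm{Y}^{\mp}(2)$ and the $s^{(2m+1)}_{11}$, $m\ge0$. For $a-b\in\mathbb{Z}_{\ge0}$, $L(a,b)$ is the irreducible $\mathfrak{gl}_2$-module of highest weight $(a,b)$, made a $\mathrm{Y}(2)$-module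 by $t_{ij}(u)\mapsto\delta_{ij}+E_{ij}u^{-1}$; tensor products are $\mathrm{Y}(2)$-modules via $\Delta$ and are restricted to $\mathrm{Y}^{\mp}(2)$; $\mathfrak{sl}_2\subset\mathfrak{gl}_2$ is spanned by $e=E_{1,-1}$, $f=E_{-1,1}$, $h=E_{11}-E_{-1,-1}$, and $V_m$ is its irreducible module of dimension $m+1$. For $\delta\in\mathbb{C}$, $W(\delta)=\mathbb{C}w$ is the $\mathrm{Y}^+(2)$-module with $s_{11}(u)w=\frac{u+\delta}{u+1/2}w$, $s_{-1,-1}(u)w=\frac{u-\delta+1}{u+1/2}w$, $s_{\pm1,\mp1}(u)w=0$. Weights: highest weights are written as $\lambda=(\lambda_1,\dots,\lambda_k)$ with $0\ge\lambda_1\ge\dots\ge\lambda_k$, integers in the symplectic case and all integers or all half-integers in the orthogonal case; $\mu=(\mu_1,\dots,\mu_{k-1})$ similarly, and put $\mu_k=-\infty$. Symplectic case: $\alpha_1=-1/2$, $\alpha_j=\min(\lambda_{j-1},\mu_{j-1})-j+1/2$ ($2\le j\le k$), $\beta_j=\max(\lambda_j,\mu_j)-j+1/2$. Orthogonal case: $\alpha_j=\min(\lambda_{j-1},\mu_{j-1})-j+1$ ($2\le j\le k$), $\beta_j=\max(\lambda_j,\mu_j)-j+1$; if the $\lambda_i$ are integers, $U=L(0,\beta_1)\otimes\bigotimes_{j\ge2}L(\alpha_j,\beta_j)\otimes W(1/2)$ and $U'=L(-1,\beta_1)\otimes\bigotimes_{j\ge2}L(\alpha_j,\beta_j)\otimes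 W(1/2)$ ($U'=0$ if $\beta_1=0$); if they are half-integers, $U=L(-1/2,\beta_1)\otimes\bigotimes_{j\ge2}L(\alpha_j,\beta_j)\otimes W(0)$ and $U'=L(-1/2,\beta_1)\otimes\bigotimes_{j\ge2}L(\alpha_j,\beta_j)\otimes W(1)$. (By Molev's theorem these modules at $z=0$ are the multiplicity spaces $\mathrm{Hom}_{\mathfrak{g}_{k-1}}(V_\mu,V_\lambda)$ with the action of $\mathrm{Y}^{\mp}(2)$ through the homomorphism $\varphi_k:\mathrm{Y}^{\mp}(2)\to U(\mathfrak{g}_k)^{\mathfrak{g}_{k-1}}$ of Molev–Olshanski.) *)

(* Defs.v *)
From HB Require Import structures.
From mathcomp Require Import all_boot all_order all_algebra.
From mathcomp Require Import complex mxtens.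
From mathcomp Require Import all_classical all_reals topology normedtype.
Set Implicit Arguments. Unset Strict Implicit. Unset Printing Implicit Defensive.
Import Order.TTheory GRing.Theory Num.Theory numFieldNormedType.Exports.
Local Open Scope ring_scope.

(* The complex numbers C = R[i] as a numFieldType (hence with its topology). *)
Definition CC (R : realType) : numFieldType := R[i].

(* Indices in {-1, 1} are encoded by bool: true = 1, false = -1;
   negation of an index is ~~ . *)

Section Yangian.
Variable F : fieldType.

(* Terms of the free unital associative F-algebra on the generators t_ij^(r). *)
Inductive yterm : Type :=
  | YT of bool & bool & nat      (* t_{ij}^{(r)}, used for r >= 1 *)
  | YC of F
  | YAdd of yterm & yterm
  | YMul of yterm & yterm.

Definition tg (i j : bool) (r : nat) : yterm :=
  if r is 0 then YC (if i == j then 1 else 0) else YT i j r.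

Definition ysum (s : seq yterm) : yterm := foldr YAdd (YC 0) s.
Definition yneg (x : yterm) : yterm := YMul (YC (-1)) x.
Definition ycomm (x y : yterm) : yterm := YAdd (YMul x y) (yneg (YMul y x)).

(* Equality in Y(2): the smallest congruence containing the algebra axioms
   and the defining relations of Y(2). *)
Inductive yeq : yterm -> yterm -> Prop :=
  | yeq_refl x : yeq x x
  | yeq_sym x y : yeq x y -> yeq y x
  | yeq_trans x y z : yeq x y -> yeq y z -> yeq x z
  | yeq_add x x' y y' : yeq x x' -> yeq y y' -> yeq (YAdd x y) (YAdd x' y')
  | yeq_mul x x' y y' : yeq x x' -> yeq y y' -> yeq (YMul x y) (YMul x' y')
  | yeq_addA x y z : yeq (YAdd x (YAdd y z)) (YAdd (YAdd x y) z)
  | yeq_addC x y : yeq (YAdd x y) (YAdd y x)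
  | yeq_add0 x : yeq (YAdd (YC 0) x) x
  | yeq_addN x : yeq (YAdd x (yneg x)) (YC 0)
  | yeq_mulA x y z : yeq (YMul x (YMul y z)) (YMul (YMul x y) z)
  | yeq_mul1l x : yeq (YMul (YC 1) x) x
  | yeq_mul1r x : yeq (YMul x (YC 1)) x
  | yeq_mulDl x y z : yeq (YMul (YAdd x y) z) (YAdd (YMul x z) (YMul y z))
  | yeq_mulDr x y z : yeq (YMul x (YAdd y z)) (YAdd (YMul x y) (YMul x z))
  | yeq_CD c d : yeq (YAdd (YC c) (YC d)) (YC (c + d))
  | yeq_CM c d : yeq (YMul (YC c) (YC d)) (YC (c * d))
  | yeq_Ccomm c x : yeq (YMul (YC c) x) (YMul x (YC c))
  | yeq_rel i j k l r s :
      yeq (YAdd (ycomm (tg i j r.+1) (tg k l s)) (yneg (ycomm (tg i j r) (tg k l s.+1))))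
          (YAdd (YMul (tg k j r) (tg i l s)) (yneg (YMul (tg k j s) (tg i l r)))).

(* ---------- The twisted Yangians Y^-(2) (orth = false), Y^+(2) (orth = true) ---------- *)
(* theta_{aj} = sgn(a) sgn(j) (symplectic) or 1 (orthogonal) *)
Definition theta (orth : bool) (a j : bool) : F :=
  if orth then 1 else if a == j then 1 else -1.

(* s_{ij}^{(M)} = coefficient of u^{-M} in sum_a theta_{aj} t_{ia}(u) t_{-j,-a}(-u) *)
Definition s_y (orth : bool) (i j : bool) (M : nat) : yterm :=
  ysum [seq YMul (YC (theta orth a j * (-1) ^+ (M - p)))
                 (YMul (tg i a p) (tg (~~ j) (~~ a) (M - p)))
       | a <- [:: true; false], p <- iota 0 M.+1].

(* Terms of the subalgebra Y^-+(2) generated by the s_{ij}^{(M)}. *)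
Inductive sterm : Type :=
  | SG of bool & bool & nat
  | SC of F
  | SAdd of sterm & sterm
  | SMul of sterm & sterm.

Fixpoint sexp (orth : bool) (x : sterm) : yterm :=
  match x with
  | SG i j M => s_y orth i j M
  | SC c => YC c
  | SAdd x y => YAdd (sexp orth x) (sexp orth y)
  | SMul x y => YMul (sexp orth x) (sexp orth y)
  end.

Definition central (orth : bool) (x : sterm) : Prop :=
  forall y : sterm, yeq (YMul (sexp orth x) (sexp orth y)) (YMul (sexp orth y) (sexp orth x)).

Inductive inB (orth : bool) : sterm -> Prop :=
  | inB_central x : central orth x -> inB orth x
  | inB_gen m : inB orth (SG true true (2 * m + 1))
  | inB_C c : inB orth (SC c)
  | inB_add x y : inB orth x -> inB orth y -> inB orth (SAdd x y)
  | inB_mul x y : inB orth x -> inB orth y -> inB orth (SMul x y).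

(* L(a, b) with a - b = m, realized on V_m = F^(m+1) with weight basis
   u_0,...,u_m: E_11 u_p = (a-p) u_p, E_{-1,-1} u_p = (b+p) u_p,
   e = E_{1,-1}: u_p -> p(m-p+1) u_{p-1},  f = E_{-1,1}: u_p -> u_{p+1}.
   Matrices act on column vectors: entry (q, p) = coefficient of u_q in X u_p. *)
Definition Emx (m : nat) (a b : F) (i j : bool) : 'M[F]_(m.+1) :=
  \matrix_(q, p)
    match i, j with
    | true, true => if q == p then a - (p : nat)%:R else 0
    | false, false => if q == p then b + (p : nat)%:R else 0
    | true, false => if (q : nat).+1 == p then ((p : nat) * (m.+1 - p))%:R else 0
    | false, true => if (q : nat) == (p : nat).+1 then 1 else 0
    end.

(* coefficient of u^{-r} in t_{ij}(u) acting on L(a,b): delta_ij + E_ij u^{-1} *)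
Definition tcoef1 (m : nat) (a b : F) (i j : bool) (r : nat) : 'M[F]_(m.+1) :=
  if r is 0 then (if i == j then 1%:M else 0)
  else if r == 1 then Emx m a b i j else 0.

Fixpoint dimL (ms : seq nat) : nat :=
  if ms is m :: ms' then (m.+1 * dimL ms')%N else 1%N.

(* t_{ij}^{(r)} acting on L(a_1,b_1) (x) ... (x) L(a_n,b_n) through the coproduct;
   ms = [m_1; ...; m_n], ab n' = (a_{n'+1}, b_{n'+1}). *)
Fixpoint tcoef (ms : seq nat) : (nat -> F * F) -> bool -> bool -> nat -> 'M[F]_(dimL ms) :=
  match ms return (nat -> F * F) -> bool -> bool -> nat -> 'M[F]_(dimL ms) with
  | [::] => fun ab i j r => if (i == j) && (r == 0)%N then 1%:M else 0
  | m :: ms' => fun ab i j r =>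
      \sum_(c : bool) \sum_(p < r.+1)
        tensmx (tcoef1 m (ab 0%N).1 (ab 0%N).2 i c p)
               (tcoef ms' (fun n => ab n.+1) c j (r - p))
  end.

(* coefficient of u^{-n} of s_{ab}(u) on W(delta) (w = Some delta),
   or on the trivial module (w = None: s_{ab}(u) = delta_ab). *)
Definition Wcoef (w : option F) (a b : bool) (n : nat) : F :=
  if a != b then 0 else
  if n is 0 then 1 else
  match w with
  | None => 0
  | Some d => if a then (d - 1/2) * (-1/2) ^+ n.-1 else (1/2 - d) * (-1/2) ^+ n.-1
  end.

(* s_{ij}^{(M)} acting on L(a_1,b_1) (x) ... (x) L(a_n,b_n) (x) W via
   Delta(s_ij(u)) = sum_{a,b} theta_{bj} t_{ia}(u) t_{-j,-b}(-u) (x) s_{ab}(u)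
   (the one-dimensional factor W is identified with the ground field). *)
Definition scoef (orth : bool) (ms : seq nat) (ab : nat -> F * F) (w : option F)
    (i j : bool) (M : nat) : 'M[F]_(dimL ms) :=
  \sum_(a : bool) \sum_(b : bool) \sum_(p < M.+1) \sum_(q < (M - p).+1)
    (theta orth b j * (-1) ^+ q * Wcoef w a b (M - p - q)) *:
      (tcoef ms ab i a p *m tcoef ms ab (~~ j) (~~ b) q).

Fixpoint sumdim (Ss : seq (seq nat)) : nat :=
  if Ss is ms :: Ss' then (dimL ms + sumdim Ss')%N else 0%N.

Fixpoint smx (orth : bool) (Ss : seq (seq nat)) :
    (nat -> (nat -> F * F) * option F) -> bool -> bool -> nat -> 'M[F]_(sumdim Ss) :=
  match Ss return (nat -> (nat -> F * F) * option F) -> bool -> bool -> nat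
                  -> 'M[F]_(sumdim Ss) with
  | [::] => fun _ _ _ _ => 0
  | ms :: Ss' => fun P i j M =>
      block_mx (scoef orth ms (P 0%N).1 (P 0%N).2 i j M) 0 0
               (smx orth Ss' (fun n => P n.+1) i j M)
  end.

Fixpoint interp (orth : bool) (Ss : seq (seq nat)) (P : nat -> (nat -> F * F) * option F)
    (x : sterm) : 'M[F]_(sumdim Ss) :=
  match x with
  | SG i j M => smx orth Ss P i j M
  | SC c => c%:M
  | SAdd x y => interp orth Ss P x + interp orth Ss P y
  | SMul x y => interp orth Ss P x *m interp orth Ss P y
  end.

Definition imB (orth : bool) (Ss : seq (seq nat)) (P : nat -> (nat -> F * F) * option F)
    (A : 'M[F]_(sumdim Ss)) : Prop :=
  exists x, inB orth x /\ A = interp orth Ss P x.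

Definition simple_spectrum_basis (N : nat) (A : 'M[F]_N -> Prop) (w : 'I_N -> 'cV[F]_N) : Prop :=
  [/\ (\matrix_(p, i) w i p 0) \in unitmx,
      (forall i X, A X -> exists c, X *m w i = c *: w i) &
      (forall i j, i != j -> exists X, A X /\
          exists c d, [/\ c != d, X *m w i = c *: w i & X *m w j = d *: w j])].

(* Weights: lambda_j = l j - h/2, mu_j = mu j - h/2 (h = true: half-integers),
   for j = 1..k (resp. 1..k-1). *)
Definition wt (h : bool) (x : int) : F := x%:~R - (h : nat)%:R / 2.

(* min(lambda_{j-1}, mu_{j-1}) (shifted by h/2), for j >= 2 *)
Definition mnw (l mu : nat -> int) (j : nat) : int := Num.min (l j.-1) (mu j.-1).
(* max(lambda_j, mu_j), with mu_k = -infinity *)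
Definition mxw (k : nat) (l mu : nat -> int) (j : nat) : int :=
  if j == k then l k else Num.max (l j) (mu j).

Definition alpha (orth h : bool) (l mu : nat -> int) (j : nat) : F :=
  if orth then wt h (mnw l mu j) - j%:R + 1
  else if j == 1%N then - (1/2) else wt h (mnw l mu j) - j%:R + 1/2.
Definition beta (orth h : bool) (k : nat) (l mu : nat -> int) (j : nat) : F :=
  if orth then wt h (mxw k l mu j) - j%:R + 1
  else wt h (mxw k l mu j) - j%:R + 1/2.
(* alpha_j - beta_j as a natural number *)
Definition mdim (k : nat) (l mu : nat -> int) (j : nat) : nat :=
  if j == 1%N then absz (mxw k l mu 1) else absz (mnw l mu j - mxw k l mu j).

Definition shapes (orth h : bool) (k : nat) (l mu : nat -> int) : seq (seq nat) :=
  if ~~ orth then [:: [seq mdim k l mu j | j <- iota 1 k]]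
  else
    let rest := [seq mdim k l mu j | j <- iota 2 k.-1] in
    let U := mdim k l mu 1 :: rest in
    let U' := (if h then mdim k l mu 1 else (mdim k l mu 1).-1) :: rest in
    if h || (mxw k l mu 1 < 0) then [:: U; U'] else [:: U].

(* parameters (a_j + z_j, b_j + z_j) of the factors of the s-th summand,
   and its one-dimensional factor W(delta); z n = z_{n+1} *)
Definition params (orth h : bool) (k : nat) (l mu : nat -> int) (z : nat -> F) :
    nat -> (nat -> F * F) * option F :=
  fun s =>
  if ~~ orth then
    ((fun n => (alpha orth h l mu n.+1 + z n, beta orth h k l mu n.+1 + z n)), None)
  else
    ((fun n => if n == 0%N then
                 ((if h then - (1/2) else if s == 0%N then 0 else -1) + z 0%N,
                  beta orth h k l mu 1 + z 0%N)
               else (alpha orth h l mu n.+1 + z n, beta orth h k l mu n.+1 + z n)),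
     Some (if h then (if s == 0%N then 0 else 1) else 1/2)).

End Yangian.

Definition zext (F : fieldType) (k : nat) (z : 'I_k -> F) (n : nat) : F :=
  if insub n is Some i then z i else 0.

(* Main.v *)
Require Import Defs.
From HB Require Import structures.
From mathcomp Require Import all_boot all_order all_algebra.
From mathcomp Require Import complex mxtens perm ring zify.
From mathcomp Require Import all_classical all_reals topology normedtype.
Import Order.TTheory GRing.Theory Num.Theory numFieldNormedType.Exports.
Local Open Scope ring_scope.

(** Let [z] tend to infinity along a line, [z_j = c_j / e] with [e -> 0].  Up to a
scalar factor, the odd part of a rescaling of [s_11(u)] at [u = 1 / e] is a polynomial
family [X(e)] of elements of the image of [B], and [X(0)] is diagonal in the basis of
tensor products of weight vectors: it acts by [sum_j q_j h_j] with
[q_j = 1 / (1 - c_j ^ 2)], plus a constant depending on the one-dimensional factor.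
For generic [q] the spectrum of [X(0)] is simple, hence so is the spectrum of [X(e)] outside
a finite set of nonzero [e], which is avoided by a suitable ray [e = w / t].  The
image of [B] is commutative (the [s_11^(M)] with [M] odd commute by the reflection
equation), so the eigenvectors of [X(e)] are those of the whole image of [B]; they are
continuous in [t] because the eigenvalues are, and have the required limit at [e = 0]. *)

Set Implicit Arguments. Unset Strict Implicit. Unset Printing Implicit Defensive.

(** * RTT relations *)

(** A factor whose parameters are shifted by [c / e] has [t(1 / e) = (1 + c) + e E], with scalar
    order 0. In [s_11(1 / e)] the relevant product is [((1 + c) + e E_11) ((1 - c) - e E_{-1,-1})];
    subtracting its value at [u = -1 / e] and dividing by [2 e (1 - c^2)] leaves [h / (1 - c^2)],
    the origin of [q_j]. Every nonzero [q_j] is reached, as [c_j] may be a complex square root of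
    [1 - 1 / q_j]. Two obstacles shape the proof. Centrality is a statement about elements of Y(2),
    while W(d) is not given as the restriction of a Y(2)-module, so the image of the center is
    controlled only after an embedding. And simplicity and continuity are asked for every [t > 0],
    not just for large [t]: eigenvalues are followed along the whole ray, and eigenvectors need one
    global normalisation. It comes from applying the product of the [X(e) - r_j] over the other
    eigenvalues to the vector with all coordinates 1; hence the ray also avoids the finitely many
    [e] at which this vector is not cyclic. *)

Section RTT.
Variable A : pzRingType.
Implicit Types (t : bool -> bool -> nat -> A) (phi psi : nat -> nat -> A).

Definition lie (x y : A) : A := x * y - y * x.

Record RTT t : Prop := {
  RTT0 : forall i j, t i j 0 = (i == j)%:R;
  RTTS : forall i j k l r s,
    lie (t i j r.+1) (t k l s) - lie (t i j r) (t k l s.+1)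
    = t k j r * t i l s - t k j s * t i l r }.

Definition conv2 phi psi (r s : nat) : A :=
  \sum_(p < r.+1) \sum_(q < s.+1) phi p q * psi (r - p)%N (s - q)%N.

(** On coefficients of [u^-r v^-s] this is multiplication by [u - v], and [conv2] is the product of
    double series. *)
Definition dif phi (r s : nat) : A := phi r.+1 s - phi r s.+1.

Lemma eq_conv2 phi phi' psi psi' r s :
  (forall p q, phi p q = phi' p q) -> (forall p q, psi p q = psi' p q) ->
  conv2 phi psi r s = conv2 phi' psi' r s.
Proof. by move=> e e'; apply: eq_bigr => p _; apply: eq_bigr => q _; rewrite e e'. Qed.

Lemma conv2_swap phi psi r s :
  conv2 phi psi s r = conv2 (fun p q => phi q p) (fun p q => psi q p) r s.
Proof. by rewrite /conv2 exchange_big. Qed.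

Lemma conv2Bl phi phi' psi r s :
  conv2 (fun p q => phi p q - phi' p q) psi r s = conv2 phi psi r s - conv2 phi' psi r s.
Proof.
rewrite /conv2 -sumrB; apply: eq_bigr => p _; rewrite -sumrB.
by apply: eq_bigr => q _; rewrite mulrBl.
Qed.

Lemma conv2Br phi psi psi' r s :
  conv2 phi (fun p q => psi p q - psi' p q) r s = conv2 phi psi r s - conv2 phi psi' r s.
Proof.
rewrite /conv2 -sumrB; apply: eq_bigr => p _; rewrite -sumrB.
by apply: eq_bigr => q _; rewrite mulrBr.
Qed.

(* The boundary hypotheses make multiplication by [u - v] act on a single factor. *)
Lemma dif_conv2l phi psi r s :
  (forall q, phi 0%N q = 0) -> (forall p, phi p 0%N = 0) ->
  dif (conv2 phi psi) r s = conv2 (dif phi) psi r s.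
Proof.
move=> h1 h2; rewrite /dif conv2Bl /conv2 big_ord_recl big1 => [|q _]; last by rewrite h1 mul0r.
rewrite add0r; congr (_ - _).
apply: eq_bigr => p _; rewrite big_ord_recl h2 mul0r add0r.
by apply: eq_bigr => q _.
Qed.

Lemma dif_conv2r phi psi r s :
  (forall q, psi 0%N q = 0) -> (forall p, psi p 0%N = 0) ->
  dif (conv2 phi psi) r s = conv2 phi (dif psi) r s.
Proof.
move=> h1 h2; rewrite /dif conv2Br /conv2 big_ord_recr /= [X in _ + X - _]big1 => [|q _]; last first.
  by rewrite subnn h1 mulr0.
rewrite addr0; congr (_ - _).
  by apply: eq_bigr => p _; apply: eq_bigr => q _; rewrite subSn ?(leq_ord p).
apply: eq_bigr => p _; rewrite big_ord_recr /= subnn h2 mulr0 addr0.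
by apply: eq_bigr => q _; rewrite (@subSn q s) ?(leq_ord q).
Qed.

Definition tprod (a b : bool -> bool -> nat -> A) (i j : bool) (r : nat) : A :=
  \sum_(c : bool) \sum_(p < r.+1) a i c p * b c j (r - p)%N.

Lemma tprodM (a b : bool -> bool -> nat -> A) i j k l r s :
  (forall i j r k l s, a i j r * b k l s = b k l s * a i j r) ->
  tprod a b i j r * tprod a b k l s =
  \sum_(c : bool) \sum_(d : bool)
    conv2 (fun p q => a i c p * a k d q) (fun p q => b c j p * b d l q) r s.
Proof.
move=> hab; rewrite /tprod mulr_suml; apply: eq_bigr => c _.
rewrite mulr_sumr; apply: eq_bigr => d _; rewrite mulr_suml.
apply: eq_bigr => p _; rewrite mulr_sumr; apply: eq_bigr => q _.
by rewrite !mulrA; congr (_ * _); rewrite -!mulrA hab.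
Qed.

(** The commutator splits into [[a, a] b b] and [a a [b, b]]. Multiplication by [u - v] turns each
    half into a difference, by the relations for [a] or for [b]; the mixed term [G2] occurs in both
    and cancels after summation over the inner indices. *)
Lemma RTT_tprod a b :
  RTT a -> RTT b -> (forall i j r k l s, a i j r * b k l s = b k l s * a i j r) ->
  RTT (tprod a b).
Proof.
move=> [a0 aS] [b0 bS] hab; split=> [i j|i j k l r s].
  rewrite /tprod (bigD1 i) //= [X in _ + X]big1 => [|c ci]; last first.
    by rewrite big_ord1 a0 eq_sym (negbTE ci) mul0r.
  by rewrite big_ord1 a0 b0 eqxx mul1r addr0.
have la0 i' j' k' l' p : lie (a i' j' p) (a k' l' 0%N) = 0.
  by rewrite /lie a0; case: eqP => _; rewrite ?mulr1 ?mul1r ?mulr0 ?mul0r subrr.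
have l0a i' j' k' l' p : lie (a i' j' 0%N) (a k' l' p) = 0.
  by rewrite /lie a0; case: eqP => _; rewrite ?mulr1 ?mul1r ?mulr0 ?mul0r subrr.
have lb0 i' j' k' l' p : lie (b i' j' p) (b k' l' 0%N) = 0.
  by rewrite /lie b0; case: eqP => _; rewrite ?mulr1 ?mul1r ?mulr0 ?mul0r subrr.
have l0b i' j' k' l' p : lie (b i' j' 0%N) (b k' l' p) = 0.
  by rewrite /lie b0; case: eqP => _; rewrite ?mulr1 ?mul1r ?mulr0 ?mul0r subrr.
pose F1 c d := conv2 (fun p q => lie (a i c p) (a k d q)) (fun p q => b c j p * b d l q).
pose F2 c d := conv2 (fun p q => a k d q * a i c p) (fun p q => lie (b c j p) (b d l q)).
have lieE r' s' : lie (tprod a b i j r') (tprod a b k l s')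
    = \sum_(c : bool) \sum_(d : bool) (F1 c d r' s' + F2 c d r' s').
  rewrite /lie !tprodM // [X in _ - X]exchange_big -sumrB; apply: eq_bigr => c _.
  rewrite -sumrB; apply: eq_bigr => d _; rewrite [X in _ - X]conv2_swap.
  by rewrite /F1 /F2 conv2Bl conv2Br addrA subrK.
rewrite !lieE -sumrB.
under eq_bigr do rewrite -sumrB.
pose G1 c d := conv2 (fun p q => a k c p * a i d q) (fun p q => b c j p * b d l q) r s.
pose G2 c d := conv2 (fun p q => a k c q * a i d p) (fun p q => b c j p * b d l q) r s.
pose G3 c d := conv2 (fun p q => a k c q * a i d p) (fun p q => b c j q * b d l p) r s.
transitivity (\sum_(c : bool) \sum_(d : bool) ((G1 c d - G2 c d) + (G2 d c - G3 d c))).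
  apply: eq_bigr => c _; apply: eq_bigr => d _.
  rewrite opprD addrACA; congr (_ + _).
    rewrite -[_ - _]/(dif (F1 c d) r s) dif_conv2l // /G1 /G2 -conv2Bl.
    by apply: eq_conv2 => // p q; rewrite /dif aS.
  rewrite -[_ - _]/(dif (F2 c d) r s) dif_conv2r // /G1 /G2 -conv2Br.
  by apply: eq_conv2 => // p q; rewrite /dif bS.
rewrite !tprodM //.
have -> : \sum_(c : bool) \sum_(d : bool)
    conv2 (fun p q => a k c p * a i d q) (fun p q => b c j p * b d l q) s r
    = \sum_(c : bool) \sum_(d : bool) G3 c d.
  by apply: eq_bigr => c _; apply: eq_bigr => d _; rewrite conv2_swap.
rewrite -[X in _ = X - _]/(\sum_(c : bool) \sum_(d : bool) G1 c d).
have H f : \sum_(c : bool) \sum_(d : bool) f d c = \sum_(c : bool) \sum_(d : bool) f c d :> A.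
  exact: exchange_big.
under eq_bigr do rewrite big_split /= !sumrB.
by rewrite big_split /= !sumrB (H G2) (H G3) addrA subrK.
Qed.

Definition gl2rel (E : bool -> bool -> A) := forall i j k l,
  lie (E i j) (E k l) = (k == j)%:R * E i l - (i == l)%:R * E k j.

(** The evaluation [t(u) = 1 + E / (u - c)] with a spectral shift: [c = 0] for the modules L(a, b),
    [c = 1/2] for the model of W(d). *)
Definition evalT (E : bool -> bool -> A) (c : A) (i j : bool) (r : nat) : A :=
  if r is r'.+1 then c ^+ r' * E i j else (i == j)%:R.

Lemma RTT_eval E c : gl2rel E -> (forall x, c * x = x * c) -> RTT (evalT E c).
Proof.
move=> hE hc; split=> // i j k l r s.
have cX n x : c ^+ n * x = x * c ^+ n by apply: commr_sym; apply: commrX; rewrite /GRing.comm hc.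
have mE n n' x y : c ^+ n * x * (c ^+ n' * y) = c ^+ (n + n') * (x * y).
  by rewrite exprD -mulrA (mulrA x) -(cX n') !mulrA.
have lE n n' x y : lie (c ^+ n * x) (c ^+ n' * y) = c ^+ (n + n') * lie x y.
  by rewrite /lie !mE addnC mulrBr.
have l0 (b : bool) x : lie b%:R x = 0.
  by case: b; rewrite /lie ?mulr1 ?mul1r ?mulr0 ?mul0r subrr.
have l1 (b : bool) x : lie x b%:R = 0.
  by case: b; rewrite /lie ?mulr1 ?mul1r ?mulr0 ?mul0r subrr.
have bC (b : bool) x : b%:R * x = x * b%:R.
  by case: b; rewrite ?mulr1 ?mul1r ?mulr0 ?mul0r.
case: r s => [|r] [|s]; rewrite /= ?l0 ?l1 ?subr0 ?sub0r ?subrr //.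
- by rewrite lE hE add0n mulrBr !bC !mulrA.
- by rewrite lE hE addn0 mulrBr !bC !mulrA opprB.
- by rewrite !lE !mE addSn addnS subrr addnC subrr.
Qed.

End RTT.

(** * Modules over Y(2) given by matrices, and the modules L(a, b) *)

Section Rep.
Variable F : fieldType.

Section Ev.
Variables (n : nat) (t : bool -> bool -> nat -> 'M[F]_n).

Fixpoint yev (x : yterm F) : 'M[F]_n :=
  match x with
  | YT i j r => t i j r
  | YC c => c%:M
  | YAdd x y => yev x + yev y
  | YMul x y => yev x *m yev y
  end.

Hypothesis ht : RTT t.

Lemma yev_tg i j r : yev (tg F i j r) = t i j r.
Proof. by case: r => [|r] //=; rewrite (RTT0 ht); case: (i == j); rewrite ?raddf0. Qed.

(** A matrix solution of the RTT relations is a Y(2)-module. This is how centrality, a statement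
    about [yeq], becomes a statement about matrices. *)
Lemma yev_sound x y : yeq x y -> yev x = yev y.
Proof.
elim=> {x y} //=.
- by move=> x y z _ -> _ ->.
- by move=> x x' y y' _ -> _ ->.
- by move=> x x' y y' _ -> _ ->.
- by move=> x y z; rewrite addrA.
- by move=> x y; rewrite addrC.
- by move=> x; rewrite raddf0 add0r.
- by move=> x; rewrite mul_scalar_mx scaleN1r subrr raddf0.
- by move=> x y z; rewrite mulmxA.
- by move=> x; rewrite mul1mx.
- by move=> x; rewrite mulmx1.
- by move=> x y z; rewrite mulmxDl.
- by move=> x y z; rewrite mulmxDr.
- by move=> c d; rewrite raddfD.
- by move=> c d; rewrite scalar_mxM.
- by move=> c x; rewrite scalar_mxC.
- move=> i j k l r s; rewrite !mul_scalar_mx !scaleN1r !yev_tg.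
  exact: (RTTS ht i j k l r s).
Qed.

Definition smat orth i j M : 'M[F]_n :=
  \sum_(a : bool) \sum_(p < M.+1)
    (theta F orth a j * (-1) ^+ (M - p)) *: (t i a p *m t (~~ j) (~~ a) (M - p)).

Lemma yev_sum (s : seq (yterm F)) : yev (ysum s) = \sum_(x <- s) yev x.
Proof. by elim: s => [|x s IH] /=; rewrite ?big_nil ?big_cons ?IH ?raddf0. Qed.

Lemma yev_s orth i j M : yev (s_y F orth i j M) = smat orth i j M.
Proof.
rewrite /s_y yev_sum big_allpairs_dep big_cons big_seq1 /smat big_bool.
have E (f : nat -> yterm F) : \sum_(p <- iota 0 M.+1) yev (f p) = \sum_(p < M.+1) yev (f p).
  by rewrite -(big_mkord xpredT (fun p => yev (f p))) /index_iota subn0.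
by rewrite !E; congr (_ + _); apply: eq_bigr => p _; rewrite /= !yev_tg mul_scalar_mx.
Qed.

End Ev.

Section Evaluation.
Variable m : nat.

Definition Ewt (a b : F) (i j : bool) (p : nat) : F :=
  match i, j with
  | true, true => a - p%:R
  | false, false => b + p%:R
  | true, false => (p * (m.+1 - p))%:R
  | false, true => 1
  end.
Definition Eshift (i j : bool) (p : nat) : nat :=
  match i, j with true, false => p.-1 | false, true => p.+1 | _, _ => p end.

Lemma EmxE a b i j q p : Emx m a b i j q p = (if q == Eshift i j p :> nat then Ewt a b i j p else 0).
Proof.
rewrite mxE /Ewt /Eshift; case: i; case: j => //=.
case: p => [[|p] hp] /=; first by rewrite mul0n if_same.
by rewrite eqSS.
Qed.

(** Weighted shifts compose to weighted shifts even when the intermediate index leaves the range.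
    Only [f] on the lowest vector does that, and then either the final index is out of range as well
    or the weight of [e] at [m.+1] vanishes. *)
Lemma Emx_mul a b i j k l q p : (Emx m a b i j *m Emx m a b k l) q p =
  if q == Eshift i j (Eshift k l p) :> nat then Ewt a b i j (Eshift k l p) * Ewt a b k l p else 0.
Proof.
rewrite mxE; case: (ltnP (Eshift k l p) m.+1) => h.
  rewrite (bigD1 (Ordinal h)) //= big1 ?addr0 => [|r hr].
    by rewrite !EmxE eqxx /=; case: eqP; rewrite ?mul0r.
  rewrite !EmxE [X in _ * X]ifF ?mulr0 //.
  by apply: contraNF hr => /eqP e; apply/eqP/val_inj.
rewrite big1 => [|r _]; last first.
  rewrite !EmxE [X in _ * X]ifF ?mulr0 //.
  by apply/eqP => e; move: h; rewrite -e leqNgt ltn_ord.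
have lt (x : nat) : (x <= p)%N -> ~~ (m < x)%N by rewrite -leqNgt => /leq_trans; apply; rewrite leq_ord.
have [hk hl hp] : [/\ k = false, l = true & val p = m].
  case: k l h => [] [] /= h; try by case/negP: (lt _ (leqnn p)).
    by case/negP: (lt _ (leq_pred p)).
  by split=> //; apply/eqP; rewrite eqn_leq leq_ord.
rewrite hk hl /= hp; case: ifP => // /eqP hq; case: i j hq => [] [] /= hq.
- by have := ltn_ord q; rewrite hq ltnn.
- by rewrite subnn muln0 mul0r.
- by have := ltn_ord q; rewrite hq !ltnS ltnNge leqnSn.
- by have := ltn_ord q; rewrite hq ltnn.
Qed.

Lemma gl2_Emx a b : a - b = m%:R -> @gl2rel 'M[F]_m.+1 (Emx m a b).
Proof.
move=> /(canRL (subrK _)) -> i j k l; apply/matrixP => q p.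
rewrite /lie.
have bE (c : bool) (X : 'M[F]_m.+1) : (c%:R * X) q p = c%:R * X q p.
  by case: c; rewrite ?mul1r // !mul0r mxE.
rewrite [RHS]mxE [X in _ = _ + X]mxE !bE [LHS]mxE [X in _ + X = _]mxE !Emx_mul !EmxE /Ewt /Eshift.
have hs r : (r <= m.+1)%N -> ((r * (m.+1 - r))%:R = r%:R * (m.+1%:R - r%:R) :> F).
  by move=> h; rewrite natrM natrB.
clear bE; case: p => [p hp]; case: i; case: j; case: k; case: l => /=;
  rewrite ?mul0r ?mul1r ?subr0 ?sub0r; (try case: p hp => [|p] hp /=);
  do ?(case: eqP => ? //); rewrite ?hs //; rewrite ?(ltnW (ltnW hp)) ?(ltnW hp) //; try ring.
Qed.

End Evaluation.
End Rep.

Lemma RTT_morph (A B : pzRingType) (f : A -> B) t :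
  {morph f : x y / x - y} -> {morph f : x y / x * y} -> f 1 = 1 -> RTT t ->
  RTT (fun i j r => f (t i j r)).
Proof.
move=> fB fM f1 [t0 tS].
have f0 : f 0 = 0 by rewrite -(subrr 0) fB subrr.
have fl x y : lie (f x) (f y) = f (lie x y) by rewrite /lie fB !fM.
split=> [i j|i j k l r s]; first by rewrite t0; case: eqP.
by rewrite !fl -!fM -!fB tS.
Qed.

(** * Tensor products of the modules L(a, b) *)

Section TensorRTT.
Variable F : fieldType.

Lemma tensmx11 m n : tensmx (1%:M : 'M[F]_m) (1%:M : 'M[F]_n) = 1%:M.
Proof.
apply/matrixP => i j; case: (mxtens_indexP i) => i0 i1; case: (mxtens_indexP j) => j0 j1.
rewrite tensmxE !mxE -natrM mulnb; congr ((nat_of_bool _)%:R).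
apply/idP/idP => [/andP[/eqP-> /eqP->] //|/eqP/(can_inj (@mxtens_indexK m n)) [-> ->]].
by rewrite !eqxx.
Qed.

Lemma tensmxBl m n (x y : 'M[F]_m) (z : 'M[F]_n) : tensmx (x - y) z = tensmx x z - tensmx y z.
Proof. by apply/matrixP => i j; rewrite !mxE mulrBl. Qed.
Lemma tensmxBr m n (x y : 'M[F]_m) (z : 'M[F]_n) : tensmx z (x - y) = tensmx z x - tensmx z y.
Proof. by apply/matrixP => i j; rewrite !mxE mulrBr. Qed.

Lemma RTT_tensmx m n (a : bool -> bool -> nat -> 'M[F]_m) (b : bool -> bool -> nat -> 'M[F]_n) :
  RTT a -> RTT b ->
  RTT (fun i j r => \sum_(c : bool) \sum_(p < r.+1) tensmx (a i c p) (b c j (r - p)%N)).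
Proof.
move=> ha hb.
have ha' : RTT (fun i j r => tensmx (a i j r) (1%:M : 'M_n)).
  apply: (RTT_morph (f := fun x => tensmx x (1%:M : 'M_n))) => //.
  - by move=> x y; rewrite tensmxBl.
  - by move=> x y; rewrite -[x * y]/(x *m y) -[X in _ = X]/(_ *m _) tensmx_mul mulmx1.
  - exact: tensmx11.
have hb' : RTT (fun i j r => tensmx (1%:M : 'M_m) (b i j r)).
  apply: (RTT_morph (f := fun x => tensmx (1%:M : 'M_m) x)) => //.
  - by move=> x y; rewrite tensmxBr.
  - by move=> x y; rewrite -[x * y]/(x *m y) -[X in _ = X]/(_ *m _) tensmx_mul mulmx1.
  - exact: tensmx11.
have := RTT_tprod ha' hb'; rewrite /tprod.
have e (x : 'M[F]_m) (y : 'M[F]_n) :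
    tensmx x (1%:M : 'M_n) * tensmx (1%:M : 'M_m) y = tensmx x y.
  by rewrite -[LHS]/(_ *m _) tensmx_mul mul1mx mulmx1.
case=> [i j r k l s|h0 hS].
  by rewrite e -[RHS]/(_ *m _) tensmx_mul mul1mx mulmx1.
split=> [i j|i j k l r s].
  by rewrite -h0; apply: eq_bigr => c _; apply: eq_bigr => p _; rewrite e.
have E i' j' r' : \sum_(c : bool) \sum_(p < r'.+1)
     tensmx (a i' c p) (1%:M : 'M_n) * tensmx (1%:M : 'M_m) (b c j' (r' - p)%N)
   = \sum_(c : bool) \sum_(p < r'.+1) tensmx (a i' c p) (b c j' (r' - p)%N).
  by apply: eq_bigr => c _; apply: eq_bigr => p _; rewrite e.
by move: (hS i j k l r s); rewrite !E.
Qed.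

Lemma boolr_mx n (c : bool) : (c%:R : 'M[F]_n) = if c then 1%:M else 0.
Proof. by case: c. Qed.

Lemma RTT_ext (A : pzRingType) (t t' : bool -> bool -> nat -> A) :
  (forall i j r, t i j r = t' i j r) -> RTT t -> RTT t'.
Proof. by move=> e [t0 tS]; split=> [i j|i j k l r s]; rewrite -!e. Qed.

Lemma RTT_tcoef1 m (a b : F) : a - b = m%:R -> RTT (tcoef1 m a b).
Proof.
move=> h; have := RTT_eval (c := 0) (gl2_Emx h).
move=> /(_ (fun x => etrans (mul0r x) (esym (mulr0 x)))); apply: RTT_ext => i j [|[|r]] /=.
- exact: boolr_mx.
- by rewrite expr0 mul1r.
- by rewrite exprS !mul0r.
Qed.

Definition dominant (ms : seq nat) (ab : nat -> F * F) :=
  forall n, (n < size ms)%N -> (ab n).1 - (ab n).2 = (nth 0%N ms n)%:R.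

Lemma RTT_tcoef ms ab : dominant ms ab -> RTT (tcoef ms ab).
Proof.
elim: ms ab => [|m ms IH] ab hd.
  split=> [i j|i j k l r s] /=; first by rewrite andbT boolr_mx.
  have z (b : bool) : (if b then 1%:M else 0 : 'M[F]_1) = b%:R%:M.
    by case: b; rewrite ?raddf0.
  rewrite !z /lie -![_ * _]/(_ *m _) -!scalar_mxM -!raddfB /=; congr (_%:M).
  have z2 (x y x' y' : F) : (x * y - y * x) - (x' * y' - y' * x') = 0 by ring.
  by rewrite z2; case: r s => [|r] [|s]; rewrite ?andbF ?andbT ?mulr0 ?mul0r ?subrr.
apply: RTT_tensmx; first by apply: RTT_tcoef1; apply: (hd 0%N).
by apply: IH => n hn; apply: (hd n.+1).
Qed.

End TensorRTT.

(** * Central elements of Y^+(2) on tensor modules with a factor W(d) *)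

Section Triangles.
Variable V : nmodType.

Lemma triangle_shift (f : nat -> nat -> V) M :
  \sum_(p < M.+1) \sum_(i < p.+1) f p i
  = \sum_(i < M.+1) \sum_(k < (M - i).+1) f (i + k)%N i.
Proof.
elim: M => [|M IH]; first by rewrite !big_ord1.
rewrite big_ord_recr /= IH [RHS]big_ord_recr /= subnn big_ord1 addn0.
rewrite [X in _ + X]big_ord_recr /= addrA; congr (_ + _).
rewrite -big_split; apply: eq_bigr => i _ /=.
have hi : (i <= M)%N by rewrite -ltnS.
by rewrite subSn // [RHS]big_ord_recr /= -subSn // subnKC // leqW.
Qed.

Lemma triangle_swap (h : nat -> nat -> V) N :
  \sum_(p < N.+1) \sum_(q < (N - p).+1) h p q = \sum_(q < N.+1) \sum_(p < (N - q).+1) h p q.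
Proof.
have E (g : nat -> nat -> V) :
    \sum_(p < N.+1) \sum_(q < (N - p).+1) g p q = \sum_(p < N.+1) \sum_(i < p.+1) g i (p - i)%N.
  rewrite (triangle_shift (fun p i => g i (p - i)%N)).
  by apply: eq_bigr => p _; apply: eq_bigr => q _; rewrite addKn.
rewrite !(E, E (fun q p => h p q)); apply: eq_bigr => p _.
rewrite (reindex_inj rev_ord_inj) /=; apply: eq_bigr => i _.
by rewrite subSS subKn // -ltnS.
Qed.

(** Both sides run over all quadruples of total [M]. On the left the first index is grouped with the
    third, as the coproduct of Y(2) does; on the right the first two are taken out, as in
    [scoef]. *)
Lemma conv4 (g : nat -> nat -> nat -> nat -> V) M :
  \sum_(p < M.+1) \sum_(i < p.+1) \sum_(q < (M - p).+1) g i q (p - i)%N (M - p - q)%N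
  = \sum_(i < M.+1) \sum_(q < (M - i).+1) \sum_(k < (M - i - q).+1) g i q k (M - i - q - k)%N.
Proof.
rewrite (triangle_shift (fun p i => \sum_(q < (M - p).+1) g i q (p - i)%N (M - p - q)%N)).
apply: eq_bigr => i _; rewrite -(triangle_swap (fun k q => g i q k (M - i - q - k)%N)).
by apply: eq_bigr => k _; rewrite subnDA; apply: eq_bigr => q _; rewrite addKn [X in g _ _ _ X]subnAC.
Qed.
End Triangles.

Section Centre.
Variable F : fieldType.

Lemma scoef_None orth ms (ab : nat -> F * F) i j M :
  scoef orth ms ab None i j M = smat (tcoef ms ab) orth i j M.
Proof.
rewrite /scoef /smat; apply: eq_bigr => a _.
rewrite (bigD1 a) //= [X in _ + X]big1 ?addr0 => [|b ba]; last first.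
  apply: big1 => p _; apply: big1 => q _.
  by rewrite /Wcoef eq_sym ba mulr0 scale0r.
apply: eq_bigr => p _; rewrite big_ord_recr /= big1 ?add0r => [|q _].
  by rewrite /Wcoef eqxx /= subnn mulr1.
rewrite /Wcoef eqxx /=; have : (0 < M - p - q)%N by rewrite subn_gt0.
by case: (M - p - q)%N => // n _; rewrite mulr0 scale0r.
Qed.

Lemma tensmx_suml m n p q (I : finType) (f : I -> 'M[F]_(m, n)) (y : 'M[F]_(p, q)) :
  tensmx (\sum_i f i) y = \sum_i tensmx (f i) y.
Proof.
apply/matrixP => i j; rewrite mxE !summxE mulr_suml.
by apply: eq_bigr => k _; rewrite mxE.
Qed.

Lemma tensmx_sumr m n p q (I : finType) (f : I -> 'M[F]_(m, n)) (y : 'M[F]_(p, q)) :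
  tensmx y (\sum_i f i) = \sum_i tensmx y (f i).
Proof.
apply/matrixP => i j; rewrite mxE !summxE mulr_sumr.
by apply: eq_bigr => k _; rewrite mxE.
Qed.

Lemma tensmxZl m n p q c (x : 'M[F]_(m, n)) (y : 'M[F]_(p, q)) :
  tensmx (c *: x) y = c *: tensmx x y.
Proof. by apply/matrixP => i j; rewrite !mxE mulrA. Qed.

Lemma tensmxZr m n p q c (x : 'M[F]_(m, n)) (y : 'M[F]_(p, q)) :
  tensmx x (c *: y) = c *: tensmx x y.
Proof. by apply/matrixP => i j; rewrite !mxE mulrCA. Qed.

Section Wmodule.
Variable kappa : nat.
Hypothesis F2 : (2%:R : F) != 0.

Let u0 : 'cV[F]_kappa.+1 := delta_mx ord0 ord0.
Let E := Emx kappa (kappa%:R : F) 0.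

(* Being central is a property of elements of Y(2), so W(d) has to be found inside a
   Y(2)-module.  For d = kappa + 1/2 it is the line of the highest weight vector [u0] of
   L(kappa, 0) with a shifted spectral parameter; the other values of d follow since the matrices are polynomial in d. *)
Definition Wrep : bool -> bool -> nat -> 'M[F]_kappa.+1 := evalT E ((1 / 2)%:M).

Lemma RTT_Wrep : RTT Wrep.
Proof.
apply: RTT_eval; first by apply: gl2_Emx; rewrite subr0.
by move=> x; apply/esym/scalar_mxC.
Qed.

Let mul_u0 (X : 'M[F]_kappa.+1) q z : (X *m u0) q z = X q ord0.
Proof.
rewrite mxE (bigD1 ord0) //= big1 => [|r hr]; last by rewrite [u0 _ _]mxE (negbTE hr) mulr0.
by rewrite [u0 _ _]mxE (ord1 z) !eqxx mulr1 addr0.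
Qed.

(** The choice of L(kappa, 0), with second weight 0, enters here: on the highest weight vector the
    quadratic term of s(u) collapses to a linear one. *)
Let sumEE c b : (\sum_(a : bool) E c a *m E (~~ b) (~~ a)) *m u0 = E c b *m u0.
Proof.
apply/matrixP => q z; rewrite !mul_u0 summxE big_bool /= !Emx_mul !EmxE /Ewt /Eshift.
by case: c; case: b => /=; case: ifP => _; do ?rewrite /= ?mul0n ?mul1n ?subn1 ?subr0 ?(mulr0, mul0r, mulr1, mul1r, addr0, add0r) ?if_same.
Qed.

Let diffE c b : E c b *m u0 - E (~~ b) (~~ c) *m u0
  = (if c != b then 0 else if c then kappa%:R else - kappa%:R) *: u0.
Proof.
apply/matrixP => q z; rewrite [LHS]mxE [X in _ + X]mxE !mul_u0 !EmxE [RHS]mxE [u0 _ _]mxE (ord1 z) eqxx andbT /Ewt /Eshift.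
by case: c; case: b => /=; rewrite ?mul0r ?subrr // -val_eqE /=; case: eqP => _; rewrite /= ?mulr1 ?mulr0 ?subr0 ?add0r ?subrr ?sub0r // subr0 ?sub0r.
Qed.

(** With [t(u) = 1 + E / (u - 1/2)] and [sumEE], the series [s_cb(u)] acts on [u0] as the identity
    or zero plus [E_cb / (u - 1/2) - E_{-b,-c} / (u + 1/2) - E_cb / (u^2 - 1/4)]. The shift 1/2
    makes the pole at 1/2 cancel, which leaves [(E_cb - E_{-b,-c}) / (u + 1/2)]. *)
Lemma Wrep_u0 c b n : smat Wrep true c b n *m u0 = Wcoef (Some (kappa%:R + 1 / 2)) c b n *: u0.
Proof.
case: n => [|n].
  rewrite /smat /Wcoef; under eq_bigr do rewrite big_ord1 /=.
  by rewrite big_bool; case: c; case: b; rewrite /= ?mul0mx ?mulmx0 ?scaler0 ?addr0 ?add0r ?mulr1 ?mulmx1 ?scale1r ?mul1mx ?scale0r ?mul0mx.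
have -> : Wcoef (Some (kappa%:R + 1 / 2)) c b n.+1 =
    (if c != b then 0 else if c then kappa%:R else - kappa%:R) * ((1 / 2) ^+ n * (-1) ^+ n) :> F.
  have e2 : (-1 / 2 : F) ^+ n = (1 / 2) ^+ n * (-1) ^+ n by rewrite -exprMn mulrN1 mulNr.
  by rewrite /Wcoef -e2; case: c; case: b => /=; rewrite ?mul0r //; congr (_ * _); ring.
have h2 : (1 / 2 : F) * 2 = 1 by rewrite mul1r mulVf.
have WS i j r : Wrep i j r.+1 = (1 / 2) ^+ r *: E i j.
  rewrite -mul_scalar_mx /Wrep /evalT; congr (_ * _).
  by elim: r => [|r IH]; rewrite ?expr0 // exprS IH [in RHS]exprS [RHS]scalar_mxM.
have W0 i j : Wrep i j 0 = if i == j then 1%:M else 0 by rewrite -boolr_mx.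
move: (1 / 2 : F) h2 Wrep WS W0 => hf h2 W WS W0.
have -> : smat W true c b n.+1 =
   hf ^+ n *: (E c b + (-1) ^+ n.+1 *: E (~~ b) (~~ c)
     + (2 * \sum_(i < n) (-1) ^+ (n - i)) *: \sum_(a : bool) E c a *m E (~~ b) (~~ a)).
  have Ea a : \sum_(p < n.+2) (theta F true a b * (-1) ^+ (n.+1 - p)) *:
       (W c a p *m W (~~ b) (~~ a) (n.+1 - p)%N) =
     hf ^+ n *: ((if a == b then E c a else 0)
       + (if c == a then (-1) ^+ n.+1 *: E (~~ b) (~~ a) else 0)
       + (2 * \sum_(i < n) (-1) ^+ (n - i)) *: (E c a *m E (~~ b) (~~ a))).
    rewrite big_ord_recl big_ord_recr /=.
    set S := (X in _ + (X + _) = _).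
    have -> : S = (hf ^+ n * (2 * \sum_(i < n) (-1) ^+ (n - i))) *: (E c a *m E (~~ b) (~~ a)).
      rewrite mulrA mulr_sumr scaler_suml /S; apply: eq_bigr => i _.
      rewrite /bump leq0n add1n subSS mul1r.
      have e : (n - i)%N = (n - i.+1).+1 by rewrite subnSK.
      have en : n = (i + (n - i.+1).+1)%N by rewrite -e subnKC // ltnW.
      have eh : hf ^+ n * 2 = hf ^+ i * hf ^+ (n - i.+1).
        by rewrite {1}en exprD exprS mulrCA -mulrA mulrC -mulrA (mulrC 2) h2 mulr1.
      by rewrite eh {2}e !WS -scalemxAl -scalemxAr !scalerA; congr (_ *: _); ring.
    rewrite /bump leq0n add1n subnn subn0 !W0 !WS !mul1r expr0 scale1r.
    rewrite [in RHS]scalerDr [in RHS]scalerDr [LHS]addrC -addrA [LHS]addrC scalerA.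
    congr (_ + _ + _).
    - by rewrite (inj_eq negb_inj) eq_sym; case: (a == b); rewrite ?mulmx1 // mulmx0 scaler0.
    - by case: (c == a); rewrite ?mul1mx ?mul0mx ?scaler0 // scalerA mulrC -scalerA.
  rewrite /smat; under eq_bigr do rewrite Ea.
  rewrite -scaler_sumr !big_split /= -scaler_sumr; congr (_ *: (_ + _ + _)).
    by clear Ea; rewrite big_bool; case: b; rewrite /= ?addr0 ?add0r.
  by clear Ea; rewrite big_bool; case: c; rewrite /= ?addr0 ?add0r.
have alt : 2 * (\sum_(i < n) (-1) ^+ (n - i)) = (-1) ^+ n - 1 :> F.
  elim: (n) => [|k IH]; first by rewrite big_ord0 mulr0 expr0 subrr.
  rewrite big_ord_recl subn0 mulrDr; under eq_bigr do rewrite lift0 subSS.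
  rewrite IH exprS; ring.
rewrite alt -scalemxAl mulmxDl mulmxDl -!scalemxAl sumEE scalerBl scale1r.
have -> : E c b *m u0 + (-1) ^+ n.+1 *: (E (~~ b) (~~ c) *m u0)
   + ((-1) ^+ n *: (E c b *m u0) - E c b *m u0) = (-1) ^+ n *: (E c b *m u0 - E (~~ b) (~~ c) *m u0).
  by rewrite exprS mulN1r scaleNr scalerBr addrC -addrA addKr.
by rewrite diffE !scalerA mulrA mulrC.
Qed.

Section Transfer.
Variables (ms : seq nat) (ab : nat -> F * F).
Hypothesis hd : dominant ms ab.

Definition Trep (i j : bool) (r : nat) : 'M[F]_(dimL ms * kappa.+1) :=
  \sum_(c : bool) \sum_(p < r.+1) tensmx (tcoef ms ab i c p) (Wrep c j (r - p)%N).

Lemma RTT_Trep : RTT Trep.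
Proof. apply: RTT_tensmx; [exact: RTT_tcoef|exact: RTT_Wrep]. Qed.

(** The second tensor factor of the coproduct of [s_ij] lies in Y^+(2), which preserves the line of
    [u0]. The columns of the form y (x) [u0] thus span a copy of the tensor module with the factor
    W(kappa + 1/2). *)
Lemma smat_Trep i j M k (Y : 'M[F]_(dimL ms, k)) :
  smat Trep true i j M *m tensmx Y u0
  = tensmx (scoef true ms ab (Some (kappa%:R + 1 / 2)) i j M *m Y) u0.
Proof.
pose G a c b p1 q1 p2 q2 : 'M[F]_(dimL ms * kappa.+1, k * 1) := ((-1) ^+ (q1 + q2)) *:
  tensmx (tcoef ms ab i c p1 *m tcoef ms ab (~~ j) (~~ b) q1 *m Y)
         (Wrep c a p2 *m Wrep (~~ b) (~~ a) q2 *m u0).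
transitivity (\sum_(a : bool) \sum_(c : bool) \sum_(b : bool)
    \sum_(p < M.+1) \sum_(p1 < p.+1) \sum_(q1 < (M - p).+1)
      G a c b p1 q1 (p - p1)%N (M - p - q1)%N).
  rewrite /smat mulmx_suml; apply: eq_bigr => a _.
  under [RHS]eq_bigr do rewrite exchange_big /=.
  rewrite [RHS]exchange_big /= mulmx_suml; apply: eq_bigr => p _.
  rewrite -scalemxAl /Trep mulmx_suml mulmx_suml scaler_sumr; apply: eq_bigr => c _.
  rewrite mulmx_suml mulmx_suml scaler_sumr [RHS]exchange_big; apply: eq_bigr => p1 _.
  rewrite mulmx_sumr mulmx_suml scaler_sumr (reindex_inj negb_inj) /=; apply: eq_bigr => b _.
  rewrite mulmx_sumr mulmx_suml scaler_sumr; apply: eq_bigr => q1 _.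
  by rewrite !tensmx_mul /G mul1r subnKC // -ltnS.
rewrite exchange_big /scoef mulmx_suml tensmx_suml; apply: eq_bigr => c _.
rewrite exchange_big /= mulmx_suml tensmx_suml; apply: eq_bigr => b _.
under eq_bigr do rewrite conv4.
rewrite exchange_big mulmx_suml tensmx_suml; apply: eq_bigr => p1 _.
rewrite exchange_big mulmx_suml tensmx_suml; apply: eq_bigr => q1 _.
rewrite -[in RHS]scalemxAl tensmxZl (mul1r ((-1) ^+ _)) -scalerA -tensmxZr -Wrep_u0 -tensmxZr.
rewrite /smat mulmx_suml scaler_sumr tensmx_sumr; apply: eq_bigr => a _.
rewrite mulmx_suml scaler_sumr tensmx_sumr; apply: eq_bigr => k' _.
by rewrite mul1r -scalemxAl !tensmxZr scalerA -exprD.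
Qed.

End Transfer.
End Wmodule.
End Centre.

Lemma poly_eq0_inj (F : idomainType) (p : {poly F}) (f : nat -> F) :
  injective f -> (forall k, p.[f k] = 0) -> p = 0.
Proof.
move=> fI hf; apply/eqP; apply: contraT => p0.
have := @max_poly_roots F p (map f (iota 0 (size p))) p0.
rewrite map_inj_uniq // iota_uniq size_map size_iota ltnn; apply=> //.
by apply/allP => x /mapP [k _ ->]; apply/rootP.
Qed.

Section Interp1.
Variables (F : numFieldType).

Fixpoint interp1 orth ms (ab : nat -> F * F) w (x : sterm F) : 'M[F]_(dimL ms) :=
  match x with
  | SG i j M => scoef orth ms ab w i j M
  | SC c => c%:M
  | SAdd x y => interp1 orth ms ab w x + interp1 orth ms ab w y
  | SMul x y => interp1 orth ms ab w x *m interp1 orth ms ab w y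
  end.

Variables (ms : seq nat) (ab : nat -> F * F).
Hypothesis hd : dominant ms ab.

Lemma yev_interp1_None orth x :
  yev (tcoef ms ab) (sexp orth x) = interp1 orth ms ab None x.
Proof.
elim: x => [i j M|c|x IHx y IHy|x IHx y IHy]; rewrite //= ?IHx ?IHy //.
by rewrite -[LHS]/(yev _ (s_y F orth i j M)) yev_s ?scoef_None //; apply: RTT_tcoef.
Qed.

Lemma central_comm_None orth x y : central orth x ->
  interp1 orth ms ab None x *m interp1 orth ms ab None y
  = interp1 orth ms ab None y *m interp1 orth ms ab None x.
Proof.
move=> /(_ y) /(yev_sound (RTT_tcoef hd)) /=.
by rewrite !yev_interp1_None.
Qed.

Lemma yev_interp1_W kappa x k (Y : 'M_(dimL ms, k)) :
  yev (Trep kappa ms ab) (sexp true x) *m tensmx Y (delta_mx ord0 ord0 : 'cV_kappa.+1)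
  = tensmx (interp1 true ms ab (Some (kappa%:R + 1 / 2)) x *m Y) (delta_mx ord0 ord0 : 'cV_kappa.+1).
Proof.
elim: x k Y => [i j M|c|x IHx y IHy|x IHx y IHy] k Y.
- by rewrite -[yev _ _]/(yev _ (s_y F true i j M)) yev_s ?smat_Trep ?pnatr_eq0 //; apply: RTT_Trep.
- by rewrite /= !mul_scalar_mx tensmxZl.
- by rewrite /= !mulmxDl IHx IHy; apply/matrixP => i j; rewrite !mxE mulrDl.
- by rewrite /= -!mulmxA IHy IHx.
Qed.

Lemma central_comm_nat kappa x y : central true x ->
  let I := interp1 true ms ab (Some (kappa%:R + 1 / 2)) in I x *m I y = I y *m I x.
Proof.
move=> /(_ y) /(yev_sound (RTT_Trep kappa hd)) /= e.
pose v : 'cV[F]_kappa.+1 := delta_mx ord0 ord0.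
have inj k (Y Y' : 'M[F]_(dimL ms, k)) : tensmx Y v = tensmx Y' v -> Y = Y'.
  move=> /matrixP h; apply/matrixP => i j.
  have := h (mxtens_index (i, ord0)) (mxtens_index (j, ord0)).
  by rewrite !tensmxE /v mxE !eqxx !mulr1.
apply: inj; rewrite -[X in tensmx X _ = _]mulmx1 -[X in _ = tensmx X _]mulmx1.
by rewrite -!mulmxA -!yev_interp1_W !mulmxA e.
Qed.

(** Only the coefficients [Wcoef] involve [d], and each is affine in it. *)
Lemma interp1_poly orth x : exists P : 'M[{poly F}]_(dimL ms),
  forall d, interp1 orth ms ab (Some d) x = map_mx (horner_eval d) P.
Proof.
elim: x => [i j M|c|x [P hP] y [Q hQ]|x [P hP] y [Q hQ]] /=.
- pose W (a b : bool) n : {poly F} := if a != b then 0 else if n is n'.+1 then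
     (if a then ('X - (1 / 2)%:P) else ((1 / 2)%:P - 'X)) * ((-1 / 2) ^+ n')%:P else 1.
  have WE d a b n : Wcoef (Some d) a b n = (W a b n).[d].
    rewrite /Wcoef /W; case: (a != b); first by rewrite horner0.
    by case: n => [|n]; [rewrite hornerC|case: a; rewrite /= hornerM !hornerE].
  exists (\sum_(a : bool) \sum_(b : bool) \sum_(p < M.+1) \sum_(q < (M - p).+1)
    ((theta F orth b j * (-1) ^+ q)%:P * W a b (M - p - q)%N) *:
     map_mx polyC (tcoef ms ab i a p *m tcoef ms ab (~~ j) (~~ b) q)) => d.
  rewrite raddf_sum; apply: eq_bigr => a _; rewrite raddf_sum; apply: eq_bigr => b _.
  rewrite raddf_sum; apply: eq_bigr => p _; rewrite raddf_sum; apply: eq_bigr => q _.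
  apply/matrixP => k l.
  move: (tcoef ms ab i a p *m _) => X.
  by rewrite !mxE /= /horner_eval !hornerM !hornerC -WE.
- by exists (c%:P)%:M => d; apply/matrixP => i j; rewrite !mxE /horner_eval hornerMn hornerC.
- by exists (P + Q) => d; rewrite hP hQ raddfD.
- by exists (P *m Q) => d; rewrite hP hQ map_mxM.
Qed.

Lemma central_comm_W d x y : central true x ->
  let I := interp1 true ms ab (Some d) in I x *m I y = I y *m I x.
Proof.
move=> hx /=; have [P hP] := interp1_poly true x; have [Q hQ] := interp1_poly true y.
rewrite hP hQ -!map_mxM; congr (map_mx _ _); apply/eqP; rewrite -subr_eq0; apply/eqP.
apply/matrixP => i j; rewrite [RHS]mxE.
apply: (@poly_eq0_inj _ _ (fun k => k%:R + 1 / 2)) => [k l /addIr /eqP|k].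
  by rewrite eqr_nat => /eqP.
have /matrixP /(_ i j) := central_comm_nat k y hx.
rewrite /= hP hQ -!map_mxM [LHS]mxE [RHS]mxE /= /horner_eval => e.
by rewrite mxE [X in _ + X]mxE hornerD hornerN e subrr.
Qed.

End Interp1.

(** * The reflection equation *)

Section FunMx.
Variables (I : finType) (A : pzRingType).
(** Matrices over a noncommutative ring as functions on an arbitrary finite index type; with pairs
    of booleans as indices, the operators on a twofold tensor product need no renumbering. *)
Definition fmul (f g : I -> I -> A) : I -> I -> A := fun x y => \sum_z f x z * g z y.

Lemma fmulA f g h : fmul f (fmul g h) = fmul (fmul f g) h.
Proof.
apply: funext => x; apply: funext => y; rewrite /fmul.
under eq_bigr do rewrite mulr_sumr; rewrite exchange_big; apply: eq_bigr => z _.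
by rewrite mulr_suml; apply: eq_bigr => w _; rewrite mulrA.
Qed.
End FunMx.

Lemma subr_swap (V : zmodType) (a b c d : V) : a - c = b - d -> a - b = c - d.
Proof. by move=> /(canRL (subrK _)) ->; rewrite addrAC [b - d - b]addrAC subrr add0r addrC. Qed.

Lemma sum_bb (V : nmodType) (f : bool * bool -> V) : \sum_z f z
  = f (true, true) + f (true, false) + (f (false, true) + f (false, false)).
Proof.
transitivity (\sum_(z : bool * bool) f (z.1, z.2)); first by apply: eq_bigr => -[].
by rewrite -(pair_bigA _ (fun a b => f (a, b))) /= !big_bool.
Qed.

Section Reflection.
Variables (F : fieldType) (A : algType F).
Local Notation I := (bool * bool)%type.
Local Notation "f ** g" := (fmul f g) (at level 40, left associativity).
Implicit Types (f g : bool -> bool -> A) (T : F -> bool -> bool -> A).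

Definition leg1 f (x y : I) : A := if x.2 == y.2 then f x.1 y.1 else 0.
Definition leg2 f (x y : I) : A := if x.1 == y.1 then f x.2 y.2 else 0.
Definition scm (J : finType) (c : J -> J -> F) (x y : J) : A := (c x y)%:A.

(* [Rmx w] is [w - P] with [P] the flip; [Rtmx] is its partial transpose. *)
Definition Rmx (w : F) (x y : I) : F :=
  (if x == y then w else 0) - (if (x.1 == y.2) && (x.2 == y.1) then 1 else 0).
Definition Rtmx orth (w : F) (x y : I) : F :=
  (if x == y then w else 0)
  - (if (x.2 == ~~ x.1) && (y.2 == ~~ y.1) then theta F orth x.1 y.1 else 0).

Lemma leg12 f g x y : (leg1 f ** leg2 g) x y = f x.1 y.1 * g x.2 y.2.
Proof.
rewrite /fmul (bigD1 (y.1, x.2)) //= big1 ?addr0 => [|[a b] h].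
  by rewrite /leg1 /leg2 !eqxx.
rewrite /leg1 /leg2 /=; case: eqP => [e|]; last by rewrite mul0r.
case: eqP => [e'|]; last by rewrite mulr0.
by move: h; rewrite e e' eqxx.
Qed.

Lemma leg21 f g x y : (leg2 g ** leg1 f) x y = g x.2 y.2 * f x.1 y.1.
Proof.
rewrite /fmul (bigD1 (x.1, y.2)) //= big1 ?addr0 => [|[a b] h].
  by rewrite /leg1 /leg2 !eqxx.
rewrite /leg1 /leg2 /=; case: eqP => [e|]; last by rewrite mul0r.
case: eqP => [e'|]; last by rewrite mulr0.
by move: h; rewrite e e' eqxx.
Qed.

Lemma leg1M f g : leg1 f ** leg1 g = leg1 (fmul f g).
Proof.
apply: funext => -[x1 x2]; apply: funext => -[y1 y2].
rewrite /fmul /leg1 /= sum_bb /= big_bool.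
by case: x2; case: y2; rewrite /= ?mul0r ?mulr0 ?addr0 ?add0r.
Qed.

Lemma leg2M f g : leg2 f ** leg2 g = leg2 (fmul f g).
Proof.
apply: funext => -[x1 x2]; apply: funext => -[y1 y2].
rewrite /fmul /leg2 /= sum_bb /= big_bool.
by case: x1; case: y1; rewrite /= ?mul0r ?mulr0 ?addr0 ?add0r.
Qed.

Lemma scmM (J : finType) (c d : J -> J -> F) : scm c ** scm d = scm (fmul c d).
Proof.
apply: funext => x; apply: funext => y.
by rewrite /fmul /scm scaler_suml; apply: eq_bigr => z _; rewrite -scalerAl mul1r scalerA.
Qed.

Definition sleg1 (k : bool -> bool -> F) (x y : I) : F := if x.2 == y.2 then k x.1 y.1 else 0.
Definition sleg2 (k : bool -> bool -> F) (x y : I) : F := if x.1 == y.1 then k x.2 y.2 else 0.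

Lemma leg1_scm k : leg1 (scm k) = scm (sleg1 k).
Proof. by apply: funext => x; apply: funext => y; rewrite /leg1 /scm /sleg1; case: eqP; rewrite ?scale0r. Qed.
Lemma leg2_scm k : leg2 (scm k) = scm (sleg2 k).
Proof. by apply: funext => x; apply: funext => y; rewrite /leg2 /scm /sleg2; case: eqP; rewrite ?scale0r. Qed.

Lemma leg1_scmC k g : leg1 (scm k) ** leg2 g = leg2 g ** leg1 (scm k).
Proof.
apply: funext => x; apply: funext => y; rewrite leg12 leg21 /scm.
by rewrite -scalerAl mul1r -scalerAr mulr1.
Qed.
Lemma leg2_scmC k g : leg1 g ** leg2 (scm k) = leg2 (scm k) ** leg1 g.
Proof.
apply: funext => x; apply: funext => y; rewrite leg12 leg21 /scm.
by rewrite -scalerAl mul1r -scalerAr mulr1.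
Qed.

(** The RTT relation for values of the series at points. The point 0 is left out because the series
    will be polynomials in [u^-1]. *)
Definition RTTs T := forall u v i j k l, u != 0 -> v != 0 ->
  (u - v) *: lie (T u i j) (T v k l) = T u k j * T v i l - T v k j * T u i l.

(** Exchanging [u] and [v] changes the sign of both [u - v] and the right-hand side of the
    relation. *)
Lemma RTTs_sym T u v i j k l : RTTs T -> u != 0 -> v != 0 ->
  lie (T u i j) (T v k l) = lie (T v i j) (T u k l).
Proof.
move=> h u0 v0; have [->//|uv] := eqVneq u v.
apply: (scalerI (a := u - v)); rewrite ?subr_eq0 // h //.
by rewrite -[in RHS]opprB scaleNr h // opprB.
Qed.

(** The twisted transpose [T^t(-u)], for which [S(u) = T(u) T^t(-u)]. *)
Definition ttr orth T (u : F) (i j : bool) : A := theta F orth i j *: T (- u) (~~ j) (~~ i).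

Lemma theta2 orth i j : theta F orth i j * theta F orth i j = 1.
Proof. by rewrite /theta; case: orth; case: (i == j); rewrite ?mulr1 // mulrN1 opprK. Qed.

Lemma ttrK orth T : ttr orth (ttr orth T) = T.
Proof.
apply: funext => u; apply: funext => i; apply: funext => j.
rewrite /ttr opprK !negbK scalerA.
suff -> : theta F orth (~~ j) (~~ i) = theta F orth i j by rewrite theta2 scale1r.
by rewrite /theta (inj_eq negb_inj) eq_sym.
Qed.

Lemma thetaM orth i j k l :
  theta F orth i j * theta F orth k l = theta F orth k j * theta F orth i l.
Proof.
by rewrite /theta; case: orth; case: i; case: j; case: k; case: l; rewrite /= ?mulr1 ?mul1r ?mulrN1 ?opprK ?mulN1r.
Qed.

(** Transposition and the change of sign of [u] both reverse products in the Yangian, so their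
    composite is an automorphism. *)
Lemma RTTs_ttr orth T : RTTs T -> RTTs (ttr orth T).
Proof.
move=> h u v i j k l u0 v0.
have nu : - u != 0 by rewrite oppr_eq0. have nv : - v != 0 by rewrite oppr_eq0.
rewrite /ttr; have sM (a b : F) (x y : A) : (a *: x) * (b *: y) = (a * b) *: (x * y).
  by rewrite -scalerAl -scalerAr scalerA.
have -> : lie (theta F orth i j *: T (- u) (~~ j) (~~ i)) (theta F orth k l *: T (- v) (~~ l) (~~ k)) =
  (theta F orth i j * theta F orth k l) *: lie (T (- u) (~~ j) (~~ i)) (T (- v) (~~ l) (~~ k)).
  by rewrite /lie !sM [theta F orth k l * _]mulrC scalerBr.
rewrite !sM -scalerBr -thetaM scalerA mulrC -scalerA; congr (_ *: _).
have -> : u - v = - (- u - - v) by rewrite opprK opprD opprK addrC.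
rewrite scaleNr h //.
have := RTTs_sym (~~ l) (~~ i) (~~ j) (~~ k) h nv nu; rewrite /lie => e.
by rewrite opprB; apply: subr_swap.
Qed.

Lemma RTT_mx T u v : RTTs T -> u != 0 -> v != 0 ->
  scm (Rmx (u - v)) ** (leg1 (T u) ** leg2 (T v)) = leg2 (T v) ** leg1 (T u) ** scm (Rmx (u - v)).
Proof.
move=> h u0 v0; apply: funext => -[i k]; apply: funext => -[j l].
have L (f : I -> I -> A) x y : (scm (Rmx (u - v)) ** f) x y = (u - v) *: f x y - f (x.2, x.1) y.
  rewrite /fmul /scm /Rmx !sum_bb; case: x => [[] []] /=;
  by rewrite ?subr0 ?sub0r ?scale0r ?mul0r ?addr0 ?add0r ?scalerBl ?scaleNr ?scale1r ?mulNr ?mulrBl -?scalerAl ?mul1r //= ?[- _ + _]addrC.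
have R (f : I -> I -> A) x y : (f ** scm (Rmx (u - v))) x y = (u - v) *: f x y - f x (y.2, y.1).
  rewrite /fmul /scm /Rmx !sum_bb; case: y => [[] []] /=;
  by rewrite ?subr0 ?sub0r ?scale0r ?mulr0 ?addr0 ?add0r ?scalerBl ?scaleNr ?scale1r ?mulrN ?mulrBr -?scalerAr ?mulr1 //= ?[- _ + _]addrC.
rewrite L R !leg12 !leg21 /=; apply: subr_swap; rewrite -scalerBr; exact: h.
Qed.

(** The RTT relation at [-u] and [v], transposed in the first tensor factor only. *)
Lemma RTT_mx_t orth T u v : RTTs T -> u != 0 -> v != 0 ->
  leg1 (ttr orth T u) ** scm (Rtmx orth (- u - v)) ** leg2 (T v)
  = leg2 (T v) ** scm (Rtmx orth (- u - v)) ** leg1 (ttr orth T u).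
Proof.
move=> h u0 v0; apply: funext => -[i k]; apply: funext => -[j l].
rewrite -fmulA.
have nu : - u != 0 by rewrite oppr_eq0.
have hw := fun i j k l => h (- u) v i j k l nu v0.
move: (- u - v) hw => w hw.
have L f : (scm (Rtmx orth w) ** leg2 f) = fun x y =>
   (if x.1 == y.1 then w *: f x.2 y.2 else 0)
   - (if x.2 == ~~ x.1 then theta F orth x.1 y.1 *: f (~~ y.1) y.2 else 0).
  apply: funext => x; apply: funext => y.
  rewrite /fmul /scm /Rtmx /leg2 !sum_bb; case: x => [[] []]; case: y => [[] y2] /=;
  by rewrite ?subr0 ?sub0r ?scale0r ?mulr0 ?mul0r ?addr0 ?add0r ?scalerBl ?scaleNr ?scale1r ?mulNr ?mulrBl -?scalerAl ?mul1r //= ?[- _ + _]addrC.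
have R f : (scm (Rtmx orth w) ** leg1 f) = fun x y =>
   (if x.2 == y.2 then w *: f x.1 y.1 else 0)
   - (if x.2 == ~~ x.1 then theta F orth x.1 (~~ y.2) *: f (~~ y.2) y.1 else 0).
  apply: funext => x; apply: funext => y.
  rewrite /fmul /scm /Rtmx /leg1 !sum_bb; case: x => [[] []]; case: y => [y1 []] /=;
  by rewrite ?subr0 ?sub0r ?scale0r ?mulr0 ?mul0r ?addr0 ?add0r ?scalerBl ?scaleNr ?scale1r ?mulNr ?mulrBl -?scalerAl ?mul1r //= ?[- _ + _]addrC.
rewrite -fmulA L R.
have -> : (leg1 (ttr orth T u) ** (fun x y => (if x.1 == y.1 then w *: T v x.2 y.2 else 0)
   - (if x.2 == ~~ x.1 then theta F orth x.1 y.1 *: T v (~~ y.1) y.2 else 0))) (i, k) (j, l)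
  = (w * theta F orth i j) *: (T (- u) (~~ j) (~~ i) * T v k l)
    - theta F orth i j *: (T (- u) k (~~ i) * T v (~~ j) l).
  rewrite /fmul /leg1 /ttr sum_bb /= /theta.
  case: {h hw L R} orth; case: i; case: j; case: k => /=;
  by rewrite ?mul0r ?addr0 ?add0r ?subr0 ?sub0r ?mulrBr ?mulrN -?scalerAl -?scalerAr ?scalerA ?scaleNr ?mulrN ?mulNr ?mulr1 ?scale1r ?opprK ?scaleN1r //= ?scaleNr ?opprK ?[- _ + _]addrC ?[_ + - _]addrC ?mulr0 ?oppr0 ?add0r ?mul1r ?mulN1r ?scaleNr // ?mulNr ?scaleNr ?opprK ?scale1r ?addr0.
have -> : (leg2 (T v) ** (fun x y => (if x.2 == y.2 then w *: ttr orth T u x.1 y.1 else 0)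
   - (if x.2 == ~~ x.1 then theta F orth x.1 (~~ y.2) *: ttr orth T u (~~ y.2) y.1 else 0))) (i, k) (j, l)
  = (w * theta F orth i j) *: (T v k l * T (- u) (~~ j) (~~ i))
    - theta F orth i j *: (T v k (~~ i) * T (- u) (~~ j) l).
  rewrite /fmul /leg2 /ttr sum_bb /= /theta.
  case: {h hw L R} orth; case: i; case: j; case: l => /=;
  by rewrite ?mul0r ?addr0 ?add0r ?subr0 ?sub0r ?mulrBr ?mulrN -?scalerAl -?scalerAr ?scalerA ?scaleNr ?mulrN ?mulNr ?mulr1 ?scale1r ?opprK ?scaleN1r //= ?scaleNr ?opprK ?[- _ + _]addrC ?[_ + - _]addrC ?mulr0 ?oppr0 ?add0r ?mul1r ?mulN1r ?scaleNr // ?mulNr ?scaleNr ?opprK ?scale1r ?addr0.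
apply: subr_swap; rewrite -!scalerBr mulrC -scalerA; congr (_ *: _).
exact: hw.
Qed.


End Reflection.
Arguments scm {F A J} c x y.

Section Reflection2.
Variables (F : fieldType) (A : algType F).
Local Notation I := (bool * bool)%type.
Local Notation "f ** g" := (fmul f g) (at level 40, left associativity).
Implicit Types (f g : bool -> bool -> A) (T : F -> bool -> bool -> A).

(* [u + 1/2] times the matrix of the [s_ab(u)] on W(d). *)
Definition kd (d u : F) (a b : bool) : F := if a == b then u + (if a then d else 1 - d) else 0.

(** A diagonal solution of the reflection equation with scalar entries. The condition [d + d == 1]
    of the symplectic case makes it a multiple of the identity, which stands for the trivial
    module. *)
Lemma reflection_kd orth d u v : (orth || (d + d == 1)) ->
  Rmx (u - v) ** sleg1 (kd d u) ** Rtmx orth (- u - v) ** sleg2 (kd d v)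
  = sleg2 (kd d v) ** Rtmx orth (- u - v) ** sleg1 (kd d u) ** Rmx (u - v).
Proof.
move=> hd; rewrite -!fmulA.
have K1 w (f : I -> I -> F) : sleg1 (kd d w) ** f = fun x y => (w + (if x.1 then d else 1 - d)) * f x y.
  apply: funext => x; apply: funext => y; rewrite /fmul /sleg1 /kd !sum_bb.
  by case: x => [[] []] /=; rewrite !mul0r ?addr0 ?add0r.
have K2 w (f : I -> I -> F) : sleg2 (kd d w) ** f = fun x y => (w + (if x.2 then d else 1 - d)) * f x y.
  apply: funext => x; apply: funext => y; rewrite /fmul /sleg2 /kd !sum_bb.
  by case: x => [[] []] /=; rewrite !mul0r ?addr0 ?add0r.
have L (f : I -> I -> F) : Rmx (u - v) ** f = fun x y => (u - v) * f x y - f (x.2, x.1) y.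
  apply: funext => x; apply: funext => y; rewrite /fmul /Rmx !sum_bb.
  by case: x => [[] []] /=; ring.
rewrite K1 L !K2.
apply: funext => -[i k]; apply: funext => -[j l].
rewrite /fmul !sum_bb /sleg1 /sleg2 /kd /Rmx /Rtmx /theta.
have hd' : orth = false -> d = 1 - d.
  by move=> e; move: hd; rewrite e /= => /eqP {1}<-; rewrite addrK.
case: orth hd' {hd} => [_|/(_ erefl) hd]; case: i; case: k; case: j; case: l => /=; try by ring.
all: rewrite -?hd; ring.
Qed.

(** Up to the factor [u + 1/2], the matrix [T(u) K(u) T^t(-u)] of the series s(u) on a Y(2)-module
    tensored with W(d). *)
Definition Smx orth d T u : bool -> bool -> A :=
  fmul (T u) (fmul (scm (kd d u)) (ttr orth T u)).

(** Dressing: a scalar solution [K] stays a solution when it is replaced by [T K T^t], because the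
    outer factors can be moved past each other by the RTT relation, its partial transposes and the
    commutation of entries in different legs with scalars. *)
Lemma reflection orth d T u v : RTTs T -> (orth || (d + d == 1)) -> u != 0 -> v != 0 ->
  let S := Smx orth d T in
  scm (Rmx (u - v)) ** leg1 (S u) ** scm (Rtmx orth (- u - v)) ** leg2 (S v)
  = leg2 (S v) ** scm (Rtmx orth (- u - v)) ** leg1 (S u) ** scm (Rmx (u - v)).
Proof.
move=> h hd u0 v0 S; rewrite /S /Smx -!leg1M -!leg2M.
have ht := RTTs_ttr orth h.
set R := scm (Rmx _); set R' := scm (Rtmx _ _).
set a1 := leg1 (T u); set a2 := leg2 (T v); set b1 := leg1 (ttr orth T u); set b2 := leg2 (ttr orth T v).
set k1 := leg1 (scm _); set k2 := leg2 (scm _).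
have e1 : R ** (a1 ** a2) = a2 ** a1 ** R by apply: RTT_mx.
have e2 : b1 ** R' ** a2 = a2 ** R' ** b1 by apply: RTT_mx_t.
have e3 : R ** (b1 ** b2) = b2 ** b1 ** R by apply: RTT_mx.
have e4 : a1 ** R' ** b2 = b2 ** R' ** a1.
  have := RTT_mx_t orth ht u0 v0; rewrite ttrK; exact.
have e5 : R ** k1 ** R' ** k2 = k2 ** R' ** k1 ** R.
  rewrite /k1 /k2 leg1_scm leg2_scm /R /R' !scmM; congr scm; exact: reflection_kd.
have c1 : k1 ** a2 = a2 ** k1 by apply: leg1_scmC.
have c2 : b1 ** k2 = k2 ** b1 by apply: leg2_scmC.
have c3 : a1 ** k2 = k2 ** a1 by apply: leg2_scmC.
have c4 : k1 ** b2 = b2 ** k1 by apply: leg1_scmC.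
rewrite !fmulA.
(* All scalar matrices are collected in the middle, where the equation for [K] applies. *)
have -> : R ** a1 ** k1 ** b1 ** R' ** a2 ** k2 ** b2 = a2 ** a1 ** (R ** k1 ** R' ** k2) ** (b1 ** b2).
  rewrite -(fmulA _ b1) -(fmulA _ _ a2) e2 !fmulA -(fmulA _ k1 a2) c1 !fmulA -(fmulA R a1) e1.
  by rewrite -!fmulA; congr (_ ** (_ ** (_ ** (_ ** (_ ** _))))); rewrite !fmulA c2.
rewrite e5 -!fmulA; rewrite e3; rewrite !fmulA.
rewrite -(fmulA a2 a1 k2) c3 !fmulA -(fmulA _ k1 b2) c4 !fmulA.
by rewrite -(fmulA (a2 ** k2) a1) -(fmulA (a2 ** k2) (a1 ** R')) e4 !fmulA.
Qed.

End Reflection2.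

Lemma subrACA (V : zmodType) (x y z w : V) : x - y - (z - w) = x - z - (y - w).
Proof. by rewrite !opprB [w - z]addrC addrACA [w - y]addrC. Qed.

Lemma lieBl (A : pzRingType) (a b c : A) : lie (a - b) c = lie a c - lie b c.
Proof. by rewrite /lie mulrBl mulrBr subrACA. Qed.

Lemma lieBr (A : pzRingType) (a b c : A) : lie a (b - c) = lie a b - lie a c.
Proof. by rewrite /lie mulrBl mulrBr subrACA. Qed.

(** * Commutation of the odd parts of s_11 at two points *)

Section OddCommute.
Variables (F : numFieldType) (A : algType F).
Local Notation I := (bool * bool)%type.
Local Notation "f ** g" := (fmul f g) (at level 40, left associativity).
Variables (orth : bool) (d : F) (T : F -> bool -> bool -> A).
Hypotheses (hT : RTTs T) (hd : orth || (d + d == 1)).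
Let S := Smx orth d T.

Lemma SmxE u i j : S u i j =
  (u + (if i then d else 1 - d)) *: (theta F orth i j *: (T u i i * T (- u) (~~ j) (~~ i)))
  + (u + (if ~~ i then d else 1 - d)) *: (theta F orth (~~ i) j *: (T u i (~~ i) * T (- u) (~~ j) i)).
Proof.
have E a : (\sum_z scm (kd d u) a z * ttr orth T u z j) =
    (u + (if a then d else 1 - d)) *: (theta F orth a j *: T (- u) (~~ j) (~~ a)).
  rewrite big_bool /scm /kd /ttr.
  by case: a; rewrite /= ?scale0r ?mul0r ?addr0 ?add0r -scalerAl mul1r.
rewrite /S /Smx /fmul big_bool /= !E.
by case: i => /=; rewrite -!scalerAr // addrC.
Qed.

(** This is one diagonal entry of the reflection equation. There [Rmx w] acts from either side by
    the scalar [w - 1], which has to be cancelled; hence [u - v != 1]. *)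
Lemma refl11 u v : u != 0 -> v != 0 -> u - v != 1 ->
  - (u + v) *: lie (S u true true) (S v true true) =
  theta F orth false true *:
    (S u true false * S v false true - S v true false * S u false true).
Proof.
move=> u0 v0 uv1; have := reflection hT hd u0 v0.
rewrite -/S => /(congr1 (fun f => f (true, true) (true, true))).
rewrite -[in LHS]fmulA -[in LHS]fmulA.
have w1 : u - v - 1 != 0 by rewrite subr_eq0.
move: (u - v) (- u - v) (opprD u v) w1 => w w' ew w1.
have L (f : I -> I -> A) : (scm (Rmx w) ** f) (true, true) (true, true) = (w - 1) *: f (true, true) (true, true).
  by rewrite /fmul /scm /Rmx sum_bb /= subr0 scale0r !mul0r !addr0 -scalerAl mul1r.
have R (f : I -> I -> A) : (f ** scm (Rmx w)) (true, true) (true, true) = (w - 1) *: f (true, true) (true, true).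
  by rewrite /fmul /scm /Rmx sum_bb /= subr0 scale0r !mulr0 !addr0 -scalerAr mulr1.
have M f g : (leg1 f ** (scm (Rtmx orth w') ** leg2 g)) (true, true) (true, true)
    = w' *: (f true true * g true true) - theta F orth false true *: (f true false * g false true).
  rewrite /fmul /scm /Rtmx /leg1 /leg2 !sum_bb /=.
  rewrite !(mulr0, mul0r, addr0, add0r, subr0, sub0r, scale0r, oppr0).
  by rewrite -!scalerAl !mul1r -!scalerAr scaleNr.
have M' f g : (leg2 f ** (scm (Rtmx orth w') ** leg1 g)) (true, true) (true, true)
    = w' *: (f true true * g true true) - theta F orth false true *: (f true false * g false true).
  have -> : theta F orth false true = theta F orth true false by [].
  rewrite /fmul /scm /Rtmx /leg1 /leg2 !sum_bb /=.
  rewrite !(mulr0, mul0r, addr0, add0r, subr0, sub0r, scale0r, oppr0).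
  by rewrite -!scalerAl !mul1r -!scalerAr scaleNr.
rewrite L R M -fmulA M' => /(scalerI w1) /subr_swap.
by rewrite ew /lie scalerBr => ->; rewrite scalerBr.
Qed.

Let rho (u : F) := if orth then 1 else (1 - 2 * u) / (1 + 2 * u).
Let s u i j := (u + 1 / 2)^-1 *: S u i j.

(** The symmetry relation of the twisted Yangian links [s_{-j,-i}(-u)] to [s_ij]. An off-diagonal
    pair [(i, -i)] is fixed by this exchange of indices, so the relation compares the same entry at
    [u] and [-u]. *)
Lemma parity u i : u != 0 -> 1 - 2 * u != 0 -> 1 + 2 * u != 0 ->
  s (- u) i (~~ i) = rho u *: s u i (~~ i).
Proof.
move=> u0 um up; rewrite /s !SmxE !opprK !negbK.
(* The RTT relation at the points [u], [-u] expresses the two products in the opposite order through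
   these two. *)
pose p := T u i i * T (- u) i (~~ i); pose q := T (- u) i i * T u i (~~ i).
have nu : - u != 0 by rewrite oppr_eq0.
have t0 : 2 * u != 0 by rewrite mulf_neq0 ?pnatr_eq0.
have t1 : 2 * u - 1 != 0 by rewrite -oppr_eq0 opprB.
have c2 : u - - u = 2 * u by ring.
have comb (a b a' b' : F) : a = a' -> b = b' -> a *: p + b *: q = a' *: p + b' *: q by move=> -> ->.
have sc (a b c : F) : c *: (a *: p + b *: q) = (c * a) *: p + (c * b) *: q by rewrite scalerDr !scalerA.
have ad (a b a' b' : F) : a *: p + b *: q + (a' *: p + b' *: q) = (a + a') *: p + (b + b') *: q.
  by rewrite !scalerDl addrACA.
have P a : a *: p = a *: p + 0 *: q by rewrite scale0r addr0.
have Q a : a *: q = 0 *: p + a *: q by rewrite scale0r add0r.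
have e1 : T (- u) i (~~ i) * T u i i = (1 - (2 * u)^-1) *: p + (2 * u)^-1 *: q.
  have := hT i i i (~~ i) u0 nu; rewrite /lie c2 -/p -/q => h.
  apply: (scalerI t0); rewrite sc; move: h; rewrite scalerBr.
  move=> /(canRL (subrK _)) /esym /(canRL (addKr _)) ->.
  by rewrite mulrBr mulr1 !mulfV // scalerBl !scale1r opprB addrC [q - p]addrC addrA.
have e2 : T u i (~~ i) * T (- u) i i = (- (2 * u)^-1) *: p + (1 + (2 * u)^-1) *: q.
  have := hT i (~~ i) i i u0 nu; rewrite /lie c2 -/p -/q e1 => h.
  apply: (scalerI t1); rewrite sc; move: h; rewrite scalerBr => /subr_swap h'.
  rewrite [LHS]scalerBl scale1r h' Q -scaleN1r sc ad.
  by apply: comb; field.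
rewrite -/p -/q e1 e2 (P (theta _ _ _ _)) (Q (theta _ _ _ _)) !(sc, ad); have dh : orth = false -> d = 1 / 2.
  move=> e; move: hd; rewrite e /= => /eqP e3.
  by apply: (mulIf (x := 2)); rewrite ?pnatr_eq0 // divfK ?pnatr_eq0 // mulr_natr.
have um' : - u + 1 / 2 != 0.
  have -> : - u + 1 / 2 = (1 - 2 * u) / 2 by field.
  by rewrite mulf_neq0 // invr_eq0 pnatr_eq0.
have up' : u + 1 / 2 != 0.
  have -> : u + 1 / 2 = (1 + 2 * u) / 2 by field.
  by rewrite mulf_neq0 // invr_eq0 pnatr_eq0.
apply: comb; rewrite /rho /theta; move: dh;
  case: (orth) => [_|/(_ erefl) ->]; case: (i) => /=; field.
all: rewrite u0 ?[u * 2]mulrC ?mulNr ?[u * 2]mulrC [_ + 1]addrC up [_ + 1]addrC um.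
all: done.
Qed.

(** By [refl11] each of the four commutators at [u], [-u] and [v], [-v] is a multiple of the
    off-diagonal expression [B] at these points, and by [parity] all four are multiples of [B u v].
    Their coefficients add up to zero. *)
Lemma s11_odd_comm u v : u != 0 -> v != 0 -> u ^+ 2 != v ^+ 2 ->
  1 - 2 * u != 0 -> 1 + 2 * u != 0 -> 1 - 2 * v != 0 -> 1 + 2 * v != 0 ->
  u - v != 1 -> u + v != 1 -> - u + v != 1 -> - u - v != 1 ->
  lie (s u true true - s (- u) true true) (s v true true - s (- v) true true) = 0.
Proof.
move=> u0 v0; rewrite -subr_eq0 subr_sqr mulf_eq0 negb_or => /andP [uv uv'] u1 u2 v1 v2 h1 h2 h3 h4.
pose B u v := s u true false * s v false true - s v true false * s u false true.
have sp1 x := parity true x. have sp0 x := parity false x.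
have C x y : x != 0 -> y != 0 -> x - y != 1 -> x + y != 0 ->
    lie (s x true true) (s y true true) = (- theta F orth false true / (x + y)) *: B x y.
  move=> x0 y0 xy xy0; have := refl11 x0 y0 xy.
  have e (a b : A) (k k' : F) : k *: a * (k' *: b) = (k * k') *: (a * b).
    by rewrite -scalerAl -scalerAr scalerA.
  rewrite /lie /B /s !e [(y + 1 / 2)^-1 * (x + 1 / 2)^-1]mulrC -!scalerBr => h.
  apply: (scalerI (a := - (x + y))); first by rewrite oppr_eq0.
  rewrite [LHS]scalerA [_ * (_ / _)]mulrC -[LHS]scalerA h !scalerA; congr (_ *: _).
  by move: (x + 1 / 2)^-1 (y + 1 / 2)^-1 => a b; field.
have nu : - u != 0 by rewrite oppr_eq0. have nv : - v != 0 by rewrite oppr_eq0.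
have rB (a b c e : A) (k k' : F) : [/\ (k *: a) * e - c * (k *: b) = k *: (a * e - c * b),
    a * (k' *: e) - (k' *: c) * b = k' *: (a * e - c * b) &
    (k *: a) * (k' *: e) - (k' *: c) * (k *: b) = (k * k') *: (a * e - c * b)].
  by split; rewrite -?scalerAl -?scalerAr ?scalerA ?[k' * k]mulrC -scalerBr.
have [] : [/\ B (- u) v = rho u *: B u v, B u (- v) = rho v *: B u v & B (- u) (- v) = (rho u * rho v) *: B u v].
  by rewrite /B (parity true u0) // (parity false u0) // (parity true v0) // (parity false v0).
move=> B1 B2 B3.
have nuv : - u + v != 0 by rewrite -oppr_eq0 opprD opprK.
rewrite lieBl !lieBr (C u v) // (C u (- v)) ?opprK // (C (- u) v) // (C (- u) (- v)) ?opprK //; last first.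
  by rewrite -opprD oppr_eq0.
rewrite B1 B2 B3 !scalerA -!scalerBl (_ : _ - _ = 0) ?scale0r // /rho.
have nuv' : - u - v != 0 by rewrite -opprD oppr_eq0.
case: (orth); field.
all: by rewrite ?nuv ?nuv' ?uv ?uv' ?u2 ?v2.
Qed.
End OddCommute.

(** * Generating series *)

Lemma poly_eq0_cofinite (F : numFieldType) (p : {poly F}) (bad : seq F) :
  (forall x, x \notin bad -> p.[x] = 0) -> p = 0.
Proof.
move=> h; have q0 : \prod_(b <- bad) ('X - b%:P) != 0 :> {poly F}.
  exact/monic_neq0/monic_prod_XsubC.
apply/eqP; rewrite -[_ == _](mulIr_eq0 p (mulIf q0)); apply/eqP.
apply: (@poly_eq0_inj _ _ (fun k => k%:R)) => [k l /eqP|k]; first by rewrite eqr_nat => /eqP.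
rewrite hornerM; case: (boolP ((k%:R : F) \in bad)) => [kb|/h ->]; last by rewrite mul0r.
by rewrite [X in _ * X](_ : _ = 0) ?mulr0 //; apply/rootP; rewrite root_prod_XsubC.
Qed.

Lemma mxpoly_eq0_cofinite (F : numFieldType) m n (c : nat -> 'M[F]_(m, n)) L (bad : seq F) :
  (forall x, x \notin bad -> \sum_(M < L) x ^+ M *: c M = 0) -> forall M, (M < L)%N -> c M = 0.
Proof.
move=> h M ML; apply/matrixP => i j; rewrite mxE.
have /polyP /(_ M) : \poly_(M < L) (c M i j) = 0.
  apply: (@poly_eq0_cofinite _ _ bad) => x /h /matrixP /(_ i j).
  rewrite mxE summxE horner_poly => {2}<-.
  by apply: eq_bigr => k _; rewrite mxE mulrC.
by rewrite coef_poly ML coef0.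
Qed.

(* Coefficients of [u^-k] times the series with coefficients [c]. *)
Definition dly (V : nmodType) (c : nat -> V) k M : V := if (k <= M)%N then c (M - k)%N else 0.

Section Series.
Variables (F : numFieldType) (A : algType F).
Variables (t : bool -> bool -> nat -> A) (K : nat).
Hypotheses (ht : RTT t) (hK : forall i j r, (K <= r)%N -> t i j r = 0).

Lemma lie_suml (J : finType) (f : J -> A) y : lie (\sum_i f i) y = \sum_i lie (f i) y.
Proof. by rewrite /lie mulr_suml mulr_sumr -sumrB. Qed.
Lemma lie_sumr (J : finType) (f : J -> A) y : lie y (\sum_i f i) = \sum_i lie y (f i).
Proof. by rewrite /lie mulr_suml mulr_sumr -sumrB. Qed.
Lemma lieZl (c : F) (x y : A) : lie (c *: x) y = c *: lie x y.
Proof. by rewrite /lie -scalerAl -scalerAr scalerBr. Qed.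
Lemma lieZr (c : F) (x y : A) : lie x (c *: y) = c *: lie x y.
Proof. by rewrite /lie -scalerAl -scalerAr scalerBr. Qed.
Lemma lie0r (x : A) : lie x 0 = 0. Proof. by rewrite /lie mulr0 mul0r subrr. Qed.
Lemma lie0l (x : A) : lie 0 x = 0. Proof. by rewrite /lie mulr0 mul0r subrr. Qed.
Lemma lie_boolr (x : A) (b : bool) : lie x b%:R = 0.
Proof. by case: b; rewrite /lie ?mulr1 ?mul1r ?mulr0 ?mul0r subrr. Qed.
Lemma lie_booll (x : A) (b : bool) : lie b%:R x = 0.
Proof. by case: b; rewrite /lie ?mulr1 ?mul1r ?mulr0 ?mul0r subrr. Qed.

(** Here [x] stands for [u^-1]. Since the coefficients vanish from [K] on, the series is a
    polynomial and can be evaluated at points. *)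
Definition Tser (x : F) i j : A := \sum_(r < K) x ^+ r *: t i j r.

Lemma Tser_shift x i j : x != 0 ->
  \sum_(r < K) x ^+ r *: t i j r.+1 = x^-1 *: (Tser x i j - t i j 0).
Proof.
move=> x0.
have -> : Tser x i j = \sum_(r < K.+1) x ^+ r *: t i j r.
  by rewrite big_ord_recr /= hK // scaler0 addr0.
rewrite big_ord_recl /= expr0 scale1r addrC addKr scaler_sumr.
by apply: eq_bigr => r _; rewrite /bump leq0n add1n exprS scalerA mulrA mulVf // mul1r.
Qed.

Lemma RTTs_Tser : RTTs (fun u => Tser u^-1).
Proof.
move=> u v i j k l u0 v0.
have ui : u^-1 != 0 by rewrite invr_eq0. have vi : v^-1 != 0 by rewrite invr_eq0.
have bil (f g : nat -> A) : \sum_(r < K) \sum_(s < K) (u^-1 ^+ r * v^-1 ^+ s) *: lie (f r) (g s)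
   = lie (\sum_(r < K) u^-1 ^+ r *: f r) (\sum_(s < K) v^-1 ^+ s *: g s).
  rewrite lie_suml; apply: eq_bigr => r _; rewrite lie_sumr; apply: eq_bigr => s _.
  by rewrite lieZl lieZr scalerA.
have bilM x y (f g : nat -> A) : \sum_(r < K) \sum_(s < K) (x ^+ r * y ^+ s) *: (f r * g s)
   = (\sum_(r < K) x ^+ r *: f r) * (\sum_(s < K) y ^+ s *: g s).
  rewrite mulr_suml; apply: eq_bigr => r _; rewrite mulr_sumr; apply: eq_bigr => s _.
  by rewrite -scalerAl -scalerAr scalerA.
have := bil (fun r => t i j r.+1) (t k l); rewrite Tser_shift // lieZl lieBl (RTT0 ht) lie_booll subr0 invrK.
have := bil (t i j) (fun s => t k l s.+1); rewrite (Tser_shift _ _ vi) lieZr lieBr (RTT0 ht) lie_boolr subr0 invrK.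
have e1 := bilM u^-1 v^-1 (t k j) (t i l).
have e2 := bilM v^-1 u^-1 (t k j) (t i l).
rewrite scalerBl /Tser => <- <-; rewrite -e1 -e2 [X in _ = _ - X]exchange_big /= -!sumrB.
apply: eq_bigr => r _; rewrite -!sumrB; apply: eq_bigr => s _.
by rewrite -scalerBr (RTTS ht) scalerBr [v^-1 ^+ s * _]mulrC.
Qed.

Definition cvs i j a n : A :=
  \sum_(p < n.+1) (-1 : F) ^+ (n - p) *: (t i a p * t (~~ j) (~~ a) (n - p)%N).

Lemma cvs0 i j a n : (K.*2 <= n)%N -> cvs i j a n = 0.
Proof.
move=> h; apply: big1 => p _; case: (leqP K p) => hp; first by rewrite hK // mul0r scaler0.
rewrite (@hK _ _ (n - p)) ?mulr0 ?scaler0 //.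
by lia.
Qed.

Lemma Tser_cvs x i j a :
  Tser x i a * Tser (- x) (~~ j) (~~ a) = \sum_(n < K.*2.+1) x ^+ n *: cvs i j a n.
Proof.
pose f p q := (x ^+ p * (- x) ^+ q) *: (t i a p * t (~~ j) (~~ a) q).
transitivity (\sum_(p < K) \sum_(q < K) f p q).
  rewrite /Tser mulr_suml; apply: eq_bigr => p _; rewrite mulr_sumr; apply: eq_bigr => q _.
  by rewrite /f -scalerAl -scalerAr scalerA.
transitivity (\sum_(n < K.*2.+1) \sum_(p < n.+1) f p (n - p)%N); last first.
  apply: eq_bigr => n _; rewrite /cvs scaler_sumr; apply: eq_bigr => p _.
  rewrite /f scalerA; congr (_ *: _); rewrite [(- x) ^+ _]exprNn mulrCA.
  by rewrite -exprD subnKC ?(leq_ord p) // mulrC.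
rewrite (triangle_shift (fun n p => f p (n - p)%N)).
have f0 p q : (K <= p)%N || (K <= q)%N -> f p q = 0.
  by rewrite /f => /orP [h|h]; rewrite (hK _ _ h) ?mul0r ?mulr0 scaler0.
rewrite (big_ord_widen K.*2.+1 (fun p => \sum_(q < K) f p q)); last by lia.
rewrite big_mkcond /=; apply: eq_bigr => p _; case: ltnP => hp; last first.
  by rewrite big1 // => q _; rewrite f0 // addKn hp.
rewrite (big_ord_widen (K.*2 - p).+1 (fun q => f p q)); last first.
  by lia.
rewrite big_mkcond /=; apply: eq_bigr => q _; rewrite addKn; case: ltnP => // hq.
by rewrite f0 // hq orbT.
Qed.

Variables (orth : bool) (d : F).
Let dl (a : bool) : F := if a then d else 1 - d.
Let w (a : bool) k : F := Wcoef (Some d) a a k.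

Definition sser i j M : A :=
  \sum_(a : bool) \sum_(b : bool) \sum_(p < M.+1) \sum_(q < (M - p).+1)
    (theta F orth b j * (-1) ^+ q * Wcoef (Some d) a b (M - p - q)) *:
      (t i a p * t (~~ j) (~~ b) q).

Lemma sserE i j M : sser i j M =
  \sum_(a : bool) theta F orth a j *: \sum_(n < M.+1) w a (M - n) *: cvs i j a n.
Proof.
apply: eq_bigr => a _; rewrite (bigD1 a) //= [X in _ + X]big1 ?addr0 => [|b ba]; last first.
  apply: big1 => p _; apply: big1 => q _.
  by rewrite /Wcoef eq_sym ba mulr0 scale0r.
pose f p q := (theta F orth a j * (-1) ^+ q * w a (M - p - q)) *: (t i a p * t (~~ j) (~~ a) q).
transitivity (\sum_(n < M.+1) \sum_(p < n.+1) f p (n - p)%N).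
  rewrite (triangle_shift (fun n p => f p (n - p)%N)).
  by apply: eq_bigr => p _; apply: eq_bigr => q _; rewrite addKn.
rewrite scaler_sumr; apply: eq_bigr => n _; rewrite /cvs !scaler_sumr; apply: eq_bigr => p _.
rewrite /f !scalerA; congr (_ *: _); rewrite -subnDA subnKC ?[_ * w _ _]mulrC -?mulrA; last by rewrite -ltnS.
by rewrite mulrCA.
Qed.

(* Coefficients of [(1 - u^-2 / 4) s_ij(u)]: this factor cancels the denominator of the
   [s_ab(u)] on W(d), so that the series becomes a polynomial in [u^-1]. *)
Definition shat i j M : A := \sum_(a : bool) theta F orth a j *:
  (cvs i j a M + (dl a - 1 / 2) *: dly (cvs i j a) 1 M - (dl a / 2) *: dly (cvs i j a) 2 M).

(** With [x = u^-1] the factor W(d) contributes [(1 + dl a x) / (1 + x / 2)], and [1 - x^2 / 4]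
    times this is [(1 + dl a x) (1 - x / 2)]. Its three coefficients are those in [shat]; in higher
    degree one has [w a k.+3 = w a k.+1 / 4]. *)
Lemma sser_shat i j M : sser i j M = shat i j M + (1 / 4) *: dly (sser i j) 2 M.
Proof.
have w0 a : w a 0 = 1 by rewrite /w /Wcoef eqxx.
have w1 a : w a 1 = dl a - 1 / 2.
  by rewrite /w /Wcoef eqxx /= expr0 /dl; case: a; field.
have wS a k : w a k.+3 = 1 / 4 * w a k.+1.
  by rewrite /w /Wcoef eqxx /= !exprS; case: a; field.
have w2 a : w a 2 = 1 / 4 - dl a / 2.
  by rewrite /w /Wcoef eqxx /= expr1 /dl; case: a; field.
case: M => [|[|M]]; rewrite /dly /= ?scaler0 ?addr0 !sserE /shat.
- by apply: eq_bigr => a _; rewrite big_ord1 /dly /= w0 scale1r !scaler0 addr0 subr0.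
- apply: eq_bigr => a _; rewrite big_ord_recl big_ord1 /dly /= subn0 ?subnn w0 w1 scale1r scaler0 subr0.
  by rewrite addrC.
rewrite !subSS subn0 scaler_sumr -big_split; apply: eq_bigr => a _ /=.
rewrite [X in _ = _ + X]scalerA [1 / 4 * _]mulrC -[X in _ = _ + X]scalerA -scalerDr; congr (_ *: _).
rewrite big_ord_recr big_ord_recr big_ord_recr /= [in RHS]big_ord_recr /= /dly /= !subSS subn0 !subnn.
rewrite !subSn // subnn w0 w1 w2 scale1r.
have -> : \sum_(n < M) w a (M.+2 - n) *: cvs i j a n = (1 / 4) *: \sum_(n < M) w a (M - n) *: cvs i j a n.
  rewrite scaler_sumr; apply: eq_bigr => n _; rewrite scalerA; congr (_ *: _).
  have -> : (M.+2 - n = (M - n.+1).+3)%N by have := ltn_ord n; lia.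
  have -> : (M - n = (M - n.+1).+1)%N by have := ltn_ord n; lia.
  exact: wS.
rewrite subn0 scale1r scalerDr [_ *: cvs i j a M in LHS]scalerBl.
rewrite [LHS]addrC [_ + _ *: cvs i j a M.+1]addrC addrA -[RHS]addrA; congr (_ + _).
by rewrite addrA addrC.
Qed.

Definition Shat x i j : A := \sum_(M < K.*2.+3) x ^+ M *: shat i j M.

Lemma shat0 i j M : (K.*2.+2 < M)%N -> shat i j M = 0.
Proof.
move=> h; apply: big1 => a _; rewrite /dly cvs0; last by lia.
by rewrite !ifT ?cvs0 ?scaler0 ?subr0 ?add0r ?scaler0 //; lia.
Qed.

Lemma ShatE x i j : Shat x i j = \sum_(a : bool)
  (theta F orth a j * (1 - x / 2) * (1 + x * dl a)) *: (Tser x i a * Tser (- x) (~~ j) (~~ a)).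
Proof.
have dlyE (c : nat -> A) k : (k <= 2)%N -> (forall n, (K.*2 <= n)%N -> c n = 0) ->
    \sum_(M < K.*2.+3) x ^+ M *: dly c k M = x ^+ k *: \sum_(n < K.*2.+1) x ^+ n *: c n.
  move=> k2 hc; rewrite scaler_sumr.
  rewrite -(big_mkord xpredT (fun M => x ^+ M *: dly c k M)) (@big_cat_nat _ _ _ k) //=; last by lia.
  rewrite big_nat_cond big1 ?add0r; last first.
    by move=> n /andP [/andP [_ h] _]; rewrite /dly leqNgt h scaler0.
  rewrite -{1}[k]add0n big_addn.
  rewrite (@big_cat_nat _ _ _ K.*2.+1) //=; last by lia.
  rewrite [X in _ + X]big_nat_cond [X in _ + X]big1 ?addr0; last first.
    by move=> n /andP [/andP [h _] _]; rewrite /dly leq_addl addnK hc ?scaler0 //; lia.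
  rewrite big_mkord; apply: eq_bigr => n _.
  by rewrite /dly leq_addl addnK scalerA addnC exprD.
rewrite /Shat /shat; under eq_bigr do rewrite scaler_sumr.
rewrite exchange_big; apply: eq_bigr => a _ /=.
rewrite Tser_cvs; set X := (X in _ = _ *: X).
have hc := @cvs0 i j a.
have e0 := dlyE (cvs i j a) 0%N isT hc; rewrite /dly /= expr0 scale1r in e0.
have e1 := dlyE (cvs i j a) 1%N isT hc.
have e2 := dlyE (cvs i j a) 2%N isT hc.
transitivity (theta F orth a j *: (X + (dl a - 1 / 2) *: (x ^+ 1 *: X) - (dl a / 2) *: (x ^+ 2 *: X))).
  rewrite /X -e1 -e2 -e0 !scaler_sumr -sumrN -!big_split /= scaler_sumr.
  apply: eq_bigr => M _; have sw (a' b' : F) (z : A) : a' *: (b' *: z) = b' *: (a' *: z) by rewrite !scalerA mulrC.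
  rewrite subn0 sw; congr (_ *: _).
  by rewrite !scalerDr scalerN; congr (_ + _ - _); apply: sw.
rewrite !scalerA -{1}[X]scale1r -scalerDl -scalerBl scalerA; congr (_ *: _).
by rewrite expr1; field.
Qed.

End Series.

Section SeriesComm.
Variables (F : numFieldType) (A : algType F).
Variables (t : bool -> bool -> nat -> A) (K : nat).
Hypotheses (ht : RTT t) (hK : forall i j r, (K <= r)%N -> t i j r = 0).
Variables (orth : bool) (d : F).
Hypothesis hd : orth || (d + d == 1).
Local Notation Shat := (Shat t K orth d).
Let T u := Tser t K u^-1.

Lemma Shat_Smx u i j : u != 0 -> 1 + 2 * u != 0 ->
  Shat u^-1 i j = ((u ^+ 2 - 1 / 4) / u ^+ 2) *: ((u + 1 / 2)^-1 *: Smx orth d T u i j).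
Proof.
move=> u0 up; have hu2 : u * 2 + 1 != 0 by rewrite mulrC addrC.
rewrite ShatE // SmxE [in LHS]big_bool /= /T invrN.
case: i => /=; [|rewrite [LHS]addrC];
  rewrite !scalerDr !scalerA; congr (_ *: _ + _ *: _); field; by rewrite u0 hu2.
Qed.

Definition Sodd x : A := Shat x true true - Shat (- x) true true.

(** The values of [y = v^-1] excluded by the hypotheses of [s11_odd_comm] for [u = x^-1]; the last
    four are [v = u - 1], [1 - u], [u + 1] and [-1 - u]. *)
Definition excluded (x : F) : seq F :=
  [:: 0; x; - x; 2; -2; (x^-1 - 1)^-1; (1 - x^-1)^-1; (x^-1 + 1)^-1; (-1 - x^-1)^-1].

Lemma Sodd_comm x y : x \notin [:: 0; 2; -2] -> y \notin excluded x ->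
  lie (Sodd x) (Sodd y) = 0.
Proof.
rewrite !inE !negb_or => /and3P [x0 x1 x2].
case/and5P=> y0 y1 y2 y3 /and5P [y4 y5 y6 y7 y8].
have u0 : x^-1 != 0 by rewrite invr_eq0. have v0 : y^-1 != 0 by rewrite invr_eq0.
have half (z : F) : z != 0 -> z != 2 -> 1 - 2 * z^-1 != 0.
  by move=> z0; apply: contraNneq => e; apply/eqP; apply: (mulIf (x := z^-1)); rewrite ?invr_eq0 // mulfV //; apply/eqP; rewrite -subr_eq0 e eqxx.
have half' (z : F) : z != 0 -> z != - 2 -> 1 + 2 * z^-1 != 0.
  move=> z0 z2; have -> : 1 + 2 * z^-1 = 1 - 2 * (- z)^-1 by rewrite invrN mulrN opprK.
  by apply: half; rewrite ?oppr_eq0 // eqr_oppLR.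
have E z : z != 0 -> z != 2 -> z != - 2 -> Sodd z = ((z^-1 ^+ 2 - 1 / 4) / z^-1 ^+ 2) *:
    ((z^-1 + 1 / 2)^-1 *: Smx orth d T z^-1 true true
     - (- z^-1 + 1 / 2)^-1 *: Smx orth d T (- z^-1) true true).
  move=> z0 z2 z2'; have zi : z^-1 != 0 by rewrite invr_eq0.
  have := Shat_Smx true true zi (half' z z0 z2'); rewrite invrK => e1.
  have nzi : - z^-1 != 0 by rewrite oppr_eq0.
  have := Shat_Smx true true nzi; rewrite mulrN invrN invrK => /(_ (half z z0 z2)) e2.
  by rewrite /Sodd e1 e2 sqrrN scalerBr.
have ne (a b : F) : y != a^-1 -> a = b -> y^-1 != b.
  by move=> h <-; apply: contraNneq h => <-; rewrite invrK.
rewrite !E // lieZl lieZr (s11_odd_comm (d := d)) ?scaler0 //; try exact: half; try exact: half'.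
- exact: RTTs_Tser.
- rewrite -subr_eq0 subr_sqr mulf_neq0 //.
    by rewrite subr_eq0 (inj_eq invr_inj) eq_sym.
  by rewrite addr_eq0 -invrN (inj_eq invr_inj) eq_sym eqr_oppLR.
- by apply: contraNneq (ne _ _ y5 erefl) => e; rewrite -e; apply/eqP; ring.
- by apply: contraNneq (ne _ _ y6 erefl) => e; rewrite -e; apply/eqP; ring.
- by apply: contraNneq (ne _ _ y7 erefl) => e; rewrite -e; apply/eqP; ring.
- by apply: contraNneq (ne _ _ y8 erefl) => e; rewrite -e; apply/eqP; ring.
Qed.

End SeriesComm.

Section MatrixOdd.
Variables (F : numFieldType) (n : nat).
Variables (t : bool -> bool -> nat -> 'M[F]_n.+1) (K : nat).
Hypotheses (ht : RTT t) (hK : forall i j r, (K <= r)%N -> t i j r = 0).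
Variables (orth : bool) (d : F).
Hypothesis hd : orth || (d + d == 1).
Local Notation A := 'M[F]_n.+1.
Local Notation c M := (shat t orth d true true M : A).

Lemma SoddE x : Sodd t K orth d x = \sum_(M < K.*2.+3) x ^+ M *: ((1 - (-1) ^+ M) *: c M).
Proof.
rewrite /Sodd /Shat -sumrB; apply: eq_bigr => M _.
by rewrite [(- x) ^+ _]exprNn scalerA mulrBr mulr1 scalerBl [x ^+ M * _]mulrC.
Qed.

(** The odd parts are polynomials commuting at all but finitely many points, so coefficients can be
    compared, first in [y] for a fixed good [x] and then in [x]. *)
Lemma shat_odd_comm M M' : odd M -> odd M' -> lie (c M) (c M') = 0.
Proof.
move=> oM oM'; case: (ltnP M K.*2.+3) => hM; last by rewrite (@shat0 _ _ t K hK orth d _ _ M) ?lie0l.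
case: (ltnP M' K.*2.+3) => hM'; last by rewrite (@shat0 _ _ t K hK orth d _ _ M') ?lie0r.
have e2 (k : nat) : odd k -> (1 - (-1) ^+ k : F) = 2 by move=> ok; rewrite -signr_odd ok expr1 opprK.
pose C k : A := (1 - (-1) ^+ k) *: c k.
suff : lie (C M) (C M') = 0.
  rewrite /C lieZl lieZr !e2 // => /eqP; rewrite !scaler_eq0 pnatr_eq0 /=; exact: eqP.
have h1 x k : x \notin [:: 0; 2; -2] -> (k < K.*2.+3)%N -> lie (Sodd t K orth d x) (C k) = 0.
  move=> hx; apply: (mxpoly_eq0_cofinite (c := fun k => lie (Sodd t K orth d x) (C k)) (L := K.*2.+3) (bad := excluded x)) => y hy.
  transitivity (lie (Sodd t K orth d x) (Sodd t K orth d y)); last exact: Sodd_comm.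
  by rewrite (SoddE y) lie_sumr; apply: eq_bigr => k' _; rewrite [RHS]lieZr.
apply: (mxpoly_eq0_cofinite (c := fun k => lie (C k) (C M')) (L := K.*2.+3) (bad := [:: 0; 2; -2])) hM => x hx.
transitivity (lie (Sodd t K orth d x) (C M')); last exact: h1.
by rewrite SoddE lie_suml; apply: eq_bigr => k' _; rewrite [RHS]lieZl.
Qed.

(** The recursion [sser_shat] lowers the index by 2 and so stays among the odd ones; an induction on
    each index reduces the claim to [shat_odd_comm]. *)
Lemma sser_odd_comm M M' : odd M -> odd M' ->
  lie (sser t orth d true true M) (sser t orth d true true M' : A) = 0.
Proof.
have dlyodd (f : nat -> A) k : odd k -> (forall l, (l < k)%N -> odd l -> f l = 0) -> dly f 2 k = 0.
  case: k => [|[|k]] //= ok h; rewrite /dly //= !subSS subn0; apply: h => //.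
  by move: ok; rewrite !negbK.
have h1 k : odd k -> forall k', odd k' -> lie (c k) (sser t orth d true true k' : A) = 0.
  move=> ok; elim/ltn_ind => k' IH ok'; rewrite sser_shat /lie mulrDl mulrDr opprD addrACA.
  rewrite -[X in X + _]/(lie _ _) shat_odd_comm // add0r -scalerAl -scalerAr -scalerBr.
  have -> : c k * dly (sser t orth d true true) 2 k' - dly (sser t orth d true true) 2 k' * c k
     = dly (fun l => lie (c k) (sser t orth d true true l)) 2 k'.
    by rewrite /dly; case: ifP => // _; rewrite mulr0 mul0r subrr.
  by rewrite dlyodd ?scaler0.
move=> + oM'; elim/ltn_ind: M => k IH ok; rewrite sser_shat /lie mulrDl mulrDr opprD addrACA.
rewrite -[X in X + _]/(lie _ _) h1 // add0r -scalerAl -scalerAr -scalerBr.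
have -> : dly (sser t orth d true true) 2 k * sser t orth d true true M' - sser t orth d true true M' * dly (sser t orth d true true) 2 k
     = dly (fun l => lie (sser t orth d true true l) (sser t orth d true true M')) 2 k.
  by rewrite /dly; case: ifP => // _; rewrite mulr0 mul0r subrr.
by rewrite dlyodd ?scaler0 // => l lk ol; apply: IH.
Qed.

End MatrixOdd.

(** * Commutation with the odd s_11 on tensor modules and their direct sums *)

Section Blocks.
Variable F : numFieldType.

(** The preceding results concern matrices of positive size. [Tm] and [sserm] allow every size, so
    that [dimL ms] need not be written as a successor; size 0 is trivial. *)
Definition Tm n (t : bool -> bool -> nat -> 'M[F]_n) K (x : F) i j : 'M[F]_n :=
  \sum_(r < K) x ^+ r *: t i j r.

Definition sserm n (t : bool -> bool -> nat -> 'M[F]_n) orth d i j M : 'M[F]_n :=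
  \sum_(a : bool) \sum_(b : bool) \sum_(p < M.+1) \sum_(q < (M - p).+1)
    (theta F orth b j * (-1) ^+ q * Wcoef (Some d) a b (M - p - q)) *:
      (t i a p *m t (~~ j) (~~ b) q).

Lemma sserm_gen n (t : bool -> bool -> nat -> 'M[F]_n) K orth d x i j :
  (forall i j r, (K <= r)%N -> t i j r = 0) ->
  \sum_(M < K.*2.+3) x ^+ M *: (sserm t orth d i j M - (1 / 4) *: dly (sserm t orth d i j) 2 M)
  = \sum_(a : bool) (theta F orth a j * (1 - x / 2) * (1 + x * (if a then d else 1 - d))) *:
      (Tm t K x i a *m Tm t K (- x) (~~ j) (~~ a)).
Proof.
case: n t => [|n] t hK; first by rewrite [LHS]flatmx0 [RHS]flatmx0.
rewrite -[RHS](ShatE hK orth d x i j) /Shat; apply: eq_bigr => M _.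
by rewrite (_ : sserm t orth d i j M = sser t orth d i j M) // sser_shat addrK.
Qed.

Lemma sserm_odd_comm n (t : bool -> bool -> nat -> 'M[F]_n) K orth d M M' :
  RTT t -> (forall i j r, (K <= r)%N -> t i j r = 0) -> orth || (d + d == 1) ->
  odd M -> odd M' ->
  let s := sserm t orth d true true in s M *m s M' = s M' *m s M.
Proof.
case: n t => [|n] t ht hK hd oM oM' s; first by rewrite [LHS]flatmx0 [RHS]flatmx0.
by apply/eqP; rewrite -subr_eq0; apply/eqP; apply: (sser_odd_comm ht hK hd).
Qed.

Lemma tcoef_eq0 ms (ab : nat -> F * F) i j r : (size ms < r)%N -> tcoef ms ab i j r = 0.
Proof.
elim: ms ab i j r => [|m ms IH] ab i j r /=; first by case: r => // r _; rewrite andbF.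
move=> h; apply: big1 => c _; apply: big1 => p _; case: p => [[|[|p]] hp] /=.
- by rewrite subn0 IH ?tensmx0 // ltnW.
- by rewrite IH ?tensmx0 //; lia.
- by rewrite tens0mx.
Qed.

(* The trivial module is W(1/2). *)
Definition wpar (w : option F) : F := if w is Some d then d else 1 / 2.

Lemma scoefE orth ms (ab : nat -> F * F) w i j M :
  scoef orth ms ab w i j M = sserm (tcoef ms ab) orth (wpar w) i j M.
Proof.
case: w => [d|] //=; rewrite /scoef /sserm.
apply: eq_bigr => a _; apply: eq_bigr => b _; apply: eq_bigr => p _; apply: eq_bigr => q _.
congr ((_ * _) *: _); rewrite /Wcoef; case: (a != b) => //; case: (_ - q)%N => // n.
by rewrite subrr mul0r if_same.
Qed.

Definition admissible orth ms (ab : nat -> F * F) (w : option F) :=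
  dominant ms ab /\ (if orth then w != None else w == None).

Lemma scoef_odd_comm orth ms ab w M M' : admissible orth ms ab w -> odd M -> odd M' ->
  let s := scoef orth ms ab w true true in s M *m s M' = s M' *m s M.
Proof.
move=> [hd hw] oM oM'; rewrite /= !scoefE.
apply: (@sserm_odd_comm _ _ (size ms).+1) => //; first exact: RTT_tcoef.
  by move=> i j r; apply: tcoef_eq0.
by case: orth hw => //= /eqP ->; rewrite /= -splitr.
Qed.

Lemma central_comm1 orth ms ab w x y : admissible orth ms ab w -> central orth x ->
  interp1 orth ms ab w x *m interp1 orth ms ab w y = interp1 orth ms ab w y *m interp1 orth ms ab w x.
Proof.
move=> [hd]; case: orth => [|/eqP ->] hx; last exact: central_comm_None.
by case: w hx => // d _; apply: central_comm_W.
Qed.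

Fixpoint admissibleS orth (Ss : seq (seq nat)) (P : nat -> (nat -> F * F) * option F) : Prop :=
  if Ss is ms :: Ss' then admissible orth ms (P 0%N).1 (P 0%N).2 /\ admissibleS orth Ss' (fun n => P n.+1)
  else True.

Lemma block_comm m n (a b : 'M[F]_m) (a' b' : 'M[F]_n) :
  a *m b = b *m a -> a' *m b' = b' *m a' ->
  block_mx a 0 0 a' *m block_mx b 0 0 b' = block_mx b 0 0 b' *m block_mx a 0 0 a'.
Proof. by move=> h h'; rewrite !mulmx_block !mulmx0 !mul0mx !addr0 !add0r h h'. Qed.

Lemma interp_block orth ms Ss P (x : sterm F) :
  interp orth (ms :: Ss) P x =
  block_mx (interp1 orth ms (P 0%N).1 (P 0%N).2 x) 0 0 (interp orth Ss (fun n => P n.+1) x).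
Proof.
elim: x => [i j M|c|x IHx y IHy|x IHx y IHy] //=.
- by rewrite scalar_mx_block.
- by rewrite IHx IHy add_block_mx !addr0.
- by rewrite IHx IHy mulmx_block !mulmx0 !mul0mx !addr0 add0r.
Qed.

Lemma central_commS orth Ss P x y : admissibleS orth Ss P -> central orth x ->
  interp orth Ss P x *m interp orth Ss P y = interp orth Ss P y *m interp orth Ss P x.
Proof.
elim: Ss P => [|ms Ss IH] P; first by move=> _ _; rewrite [LHS]flatmx0 [RHS]flatmx0.
move=> [h hS] hx; rewrite !interp_block; apply: block_comm; first exact: central_comm1.
exact: IH.
Qed.

Lemma smx_odd_comm orth Ss P M M' : admissibleS orth Ss P -> odd M -> odd M' ->
  let s := smx orth Ss P true true in s M *m s M' = s M' *m s M.
Proof.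
elim: Ss P => [|ms Ss IH] P; first by move=> _ _ _; rewrite /= [LHS]flatmx0 [RHS]flatmx0.
move=> [h hS] oM oM'; apply: block_comm; first exact: scoef_odd_comm.
exact: IH.
Qed.

(** The commutant of a matrix is an algebra, so it suffices to treat the generators: central
    elements, and odd coefficients of [s_11]. *)
Lemma imB_comm orth Ss P A M : admissibleS orth Ss P -> odd M -> @imB F orth Ss P A ->
  A *m smx orth Ss P true true M = smx orth Ss P true true M *m A.
Proof.
move=> hS oM [x [hx ->]]; elim: hx => {x} /=.
- by move=> x hx; apply: (central_commS (SG F true true M) hS hx).
- by move=> m; apply: smx_odd_comm => //; rewrite mul2n addn1 /= odd_double.
- by move=> c; rewrite scalar_mxC.
- by move=> x y _ IHx _ IHy; rewrite mulmxDl mulmxDr IHx IHy.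
- by move=> x y _ IHx _ IHy; rewrite -mulmxA IHy !mulmxA IHx.
Qed.

End Blocks.

(** * Expansion along a ray at infinity *)

Section Jets.
Variable F : numFieldType.

(** The parameters [c / e] blow up at [e = 0] while the rescaled matrices extend there polynomially.
    First order is enough, because order 0 drops out of the odd part. *)
Definition jet m n (f : F -> 'M[F]_(m, n)) (A0 A1 : 'M[F]_(m, n)) :=
  exists P : 'M[{poly F}]_(m, n),
    [/\ forall e, e != 0 -> f e = map_mx (horner_eval e) P,
        forall i j, (P i j)`_0 = A0 i j & forall i j, (P i j)`_1 = A1 i j].

Lemma jet_ext m n (f g : F -> 'M[F]_(m, n)) A0 A1 :
  (forall e, e != 0 -> g e = f e) -> jet f A0 A1 -> jet g A0 A1.
Proof. by move=> h [P [hP h0 h1]]; exists P; split=> // e e0; rewrite h // hP. Qed.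

Lemma jet_eq m n (f g : F -> 'M[F]_(m, n)) A0 A1 B0 B1 : jet f A0 A1 ->
  (forall e, e != 0 -> g e = f e) -> B0 = A0 -> B1 = A1 -> jet g B0 B1.
Proof. by move=> h hg -> ->; apply: jet_ext hg h. Qed.

Lemma jetD m n (f g : F -> 'M[F]_(m, n)) A0 A1 B0 B1 : jet f A0 A1 -> jet g B0 B1 ->
  jet (fun e => f e + g e) (A0 + B0) (A1 + B1).
Proof.
move=> [P [hP P0 P1]] [Q [hQ Q0 Q1]]; exists (P + Q); split=> [e e0|i j|i j].
- by rewrite hP // hQ // raddfD.
- by rewrite !mxE coefD P0 Q0.
- by rewrite !mxE coefD P1 Q1.
Qed.

Lemma coef1M (p q : {poly F}) : (p * q)`_1 = p`_0 * q`_1 + p`_1 * q`_0.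
Proof. by rewrite coefM !big_ord_recl big_ord0 addr0. Qed.

Lemma jetM m n p (f : F -> 'M[F]_(m, n)) (g : F -> 'M[F]_(n, p)) A0 A1 B0 B1 :
  jet f A0 A1 -> jet g B0 B1 ->
  jet (fun e => f e *m g e) (A0 *m B0) (A0 *m B1 + A1 *m B0).
Proof.
move=> [P [hP P0 P1]] [Q [hQ Q0 Q1]]; exists (P *m Q); split=> [e e0|i j|i j].
- by rewrite hP // hQ // map_mxM.
- by rewrite !mxE coef_sum; apply: eq_bigr => k _; rewrite coef0M P0 Q0.
- rewrite !mxE coef_sum -big_split; apply: eq_bigr => k _.
  by rewrite coef1M P0 Q0 P1 Q1.
Qed.

Lemma jet_tens m n p q (f : F -> 'M[F]_(m, n)) (g : F -> 'M[F]_(p, q)) A0 A1 B0 B1 :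
  jet f A0 A1 -> jet g B0 B1 ->
  jet (fun e => tensmx (f e) (g e)) (tensmx A0 B0) (tensmx A0 B1 + tensmx A1 B0).
Proof.
move=> [P [hP P0 P1]] [Q [hQ Q0 Q1]]; exists (tensmx P Q); split=> [e e0|i j|i j].
- by rewrite hP // hQ // map_mxT.
- by rewrite !mxE coef0M P0 Q0.
- by rewrite !mxE coef1M P0 Q0 P1 Q1.
Qed.

Lemma jetZ m n (p : {poly F}) (f : F -> 'M[F]_(m, n)) A0 A1 :
  jet f A0 A1 -> jet (fun e => p.[e] *: f e) (p`_0 *: A0) (p`_0 *: A1 + p`_1 *: A0).
Proof.
move=> [P [hP P0 P1]]; exists (p *: P); split=> [e e0|i j|i j].
- by rewrite hP // map_mxZ.
- by rewrite !mxE coef0M P0.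
- by rewrite !mxE coef1M P0 P1.
Qed.

Lemma jet_bool m n (f : bool -> F -> 'M[F]_(m, n)) A0 A1 : (forall c, jet (f c) (A0 c) (A1 c)) ->
  jet (fun e => \sum_(c : bool) f c e) (\sum_(c : bool) A0 c) (\sum_(c : bool) A1 c).
Proof.
move=> h; rewrite !big_bool; apply: jet_ext (jetD (h true) (h false)) => e _.
by rewrite big_bool.
Qed.

Lemma jet_block m n (f : F -> 'M[F]_m) (g : F -> 'M[F]_n) A0 A1 B0 B1 :
  jet f A0 A1 -> jet g B0 B1 ->
  jet (fun e => block_mx (f e) 0 0 (g e)) (block_mx A0 0 0 B0) (block_mx A1 0 0 B1).
Proof.
move=> [P [hP P0 P1]] [Q [hQ Q0 Q1]]; exists (block_mx P 0 0 Q); split=> [e e0|i j|i j].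
- by rewrite map_block_mx !raddf0 hP // hQ.
- by rewrite !mxE; case: fintype.split => k; rewrite !mxE; case: fintype.split => k'; rewrite ?mxE ?coef0 ?P0 ?Q0.
- by rewrite !mxE; case: fintype.split => k; rewrite !mxE; case: fintype.split => k'; rewrite ?mxE ?coef0 ?P1 ?Q1.
Qed.

Lemma jet_div n (f : F -> 'M[F]_n) A1 : jet f 0 A1 -> exists P : 'M[{poly F}]_n,
  (forall e, e != 0 -> e^-1 *: f e = map_mx (horner_eval e) P) /\ map_mx (horner_eval 0) P = A1.
Proof.
move=> [P [hP P0 P1]]; exists (map_mx (fun p => p %/ 'X) P).
have e1 i j : P i j = P i j %/ 'X * 'X.
  by rewrite divpK // -['X]subr0 -polyC0 dvdp_XsubCl /root horner_coef0 P0 mxE.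
split=> [e e0|].
  apply/matrixP => i j; rewrite hP // !mxE /= /horner_eval {1}e1 hornerM hornerX mulrCA mulVf //.
  by rewrite mulr1.
by apply/matrixP => i j; rewrite !mxE /= /horner_eval horner_coef0 -P1 [in RHS]e1 coefMX.
Qed.

Lemma Tm_widen n (t : bool -> bool -> nat -> 'M[F]_n) K K' x i j :
  (K <= K')%N -> (forall i j r, (K <= r)%N -> t i j r = 0) -> Tm t K' x i j = Tm t K x i j.
Proof.
move=> KK hK; rewrite [RHS](big_ord_widen K' (fun r => x ^+ r *: t i j r)) // big_mkcond.
by apply: eq_bigr => r _; case: ltnP => // h; rewrite hK ?scaler0.
Qed.

Lemma Tm_cons m ms (ab : nat -> F * F) x i j :
  Tm (tcoef (m :: ms) ab) (size ms).+2 x i j =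
  \sum_(c : bool) tensmx ((if i == c then 1%:M else 0) + x *: Emx m (ab 0%N).1 (ab 0%N).2 i c)
                         (Tm (tcoef ms (fun n => ab n.+1)) (size ms).+1 x c j).
Proof.
rewrite /Tm; under eq_bigr do rewrite /= scaler_sumr; rewrite exchange_big; apply: eq_bigr => c _ /=.
set t := tcoef ms _; set t1 := tcoef1 m _ _.
pose f p k := x ^+ (p + k) *: tensmx (t1 i c p) (t c j k).
transitivity (\sum_(r < (size ms).+2) \sum_(p < r.+1) f p (r - p)%N).
  apply: eq_bigr => r _; rewrite scaler_sumr; apply: eq_bigr => p _.
  by rewrite /f subnKC // -ltnS.
have E p N : \sum_(k < N) f p (p + k - p)%N = \sum_(k < N) f p k.
  by apply: eq_bigr => k _; rewrite addKn.
rewrite (triangle_shift (fun r p => f p (r - p)%N)) big_ord_recl [X in _ + X = _]big_ord_recl.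
rewrite [X in _ + (_ + X)]big1 ?addr0; last first.
  by move=> p _; apply: big1 => k _; rewrite /f /t1 /= tens0mx scaler0.
rewrite !E [X in (X + _)%R]big_ord_recr /= [X in _ + X + _]/f /t tcoef_eq0; last by rewrite subn0.
rewrite tensmx0 scaler0 addr0 subn0 subSS subn0 /f.
have -> (u v : 'M_m.+1) (w : 'M_(dimL ms)) : tensmx (u + v) w = tensmx u w + tensmx v w.
  by apply/matrixP => k l; rewrite !mxE mulrDl.
rewrite tensmxZl !tensmx_sumr scaler_sumr; congr (_ + _); apply: eq_bigr => k _.
  by rewrite tensmxZr.
by rewrite tensmxZr scalerA -exprS.
Qed.

Definition shiftL (ab : nat -> F * F) (z : nat -> F) (n : nat) : F * F :=
  ((ab n).1 + z n, (ab n).2 + z n).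

(** For [s = 1] or [-1] and [u = s / e], a factor shifted by [c / e] has [t(u) = (1 + s c) + s e E].
    [lead0] and [lead1] are the orders 0 and 1 in [e] of the product over the factors. *)
Fixpoint lead0 (ms : seq nat) (s : F) (c : nat -> F) : F :=
  if ms is _ :: ms' then (1 + s * c 0%N) * lead0 ms' s (fun n => c n.+1) else 1.

Fixpoint lead1 (ms : seq nat) (s : F) (ab : nat -> F * F) (c : nat -> F) (i j : bool) : 'M[F]_(dimL ms) :=
  match ms return (nat -> F * F) -> (nat -> F) -> 'M[F]_(dimL ms) with
  | [::] => fun _ _ => 0
  | m :: ms' => fun ab c =>
      (1 + s * c 0%N) *: tensmx 1%:M (lead1 ms' s (fun n => ab n.+1) (fun n => c n.+1) i j)
      + (s * lead0 ms' s (fun n => c n.+1)) *: tensmx (Emx m (ab 0%N).1 (ab 0%N).2 i j) 1%:M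
  end ab c.

Lemma jet_cst m n (A : 'M[F]_(m, n)) : jet (fun _ => A) A 0.
Proof.
exists (map_mx polyC A); split=> [e _|i j|i j]; last 2 first.
- by rewrite mxE coefC.
- by rewrite !mxE coefC.
by apply/matrixP => i j; rewrite !mxE /= /horner_eval hornerC.
Qed.

Lemma jet_Tm ms (s : F) ab c i j :
  jet (fun e => Tm (tcoef ms (shiftL ab (fun n => c n / e))) (size ms).+1 (s * e) i j)
      (if i == j then (lead0 ms s c)%:M else 0) (lead1 ms s ab c i j).
Proof.
elim: ms ab c i j => [|m ms IH] ab c i j.
  apply: jet_ext (jet_cst (if i == j then 1%:M else 0)) => e _.
  by rewrite /Tm big_ord1 expr0 scale1r /= andbT.
set ab' := fun n => ab n.+1; set c' := fun n => c n.+1.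
have jL k : jet (fun e => (if i == k then 1%:M else 0)
     + (s * e) *: Emx m ((ab 0%N).1 + c 0%N / e) ((ab 0%N).2 + c 0%N / e) i k)
   (if i == k then (1 + s * c 0%N)%:M else 0) (s *: Emx m (ab 0%N).1 (ab 0%N).2 i k).
  apply: (jet_eq (jetD (jet_cst (if i == k then (1 + s * c 0%N)%:M else 0))
     (jetZ (s *: 'X) (jet_cst (Emx m (ab 0%N).1 (ab 0%N).2 i k))))) => [e e0||].
  - rewrite hornerZ hornerX; apply/matrixP => p q.
    rewrite !mxE; case: i; case: k {IH} => /=; rewrite ?mxE ?addr0 //; case: (p == q);
    rewrite ?mulr1n ?mulr0n ?mulr0 ?addr0 //; by field.
  - by rewrite coefZ coefX mulr0 scale0r addr0.
  - by rewrite !coefZ !coefX /= mulr0 mulr1 scale0r !add0r.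
apply: (jet_eq (jet_bool (fun k => jet_tens (jL k) (IH ab' c' k j)))) => [e e0||].
- by rewrite Tm_cons.
- have tsc (x y : F) : tensmx (x%:M : 'M[F]_m.+1) (y%:M : 'M[F]_(dimL ms)) = (x * y)%:M.
    by rewrite -[x%:M]scalemx1 -[y%:M]scalemx1 tensmxZl tensmxZr scalerA tensmx11 scalemx1.
  clear jL IH; rewrite big_bool.
  by case: i; case: j; rewrite /= ?tens0mx ?tensmx0 ?addr0 ?add0r ?tsc.
- clear jL IH; rewrite big_bool.
  have tl (x : F) (w : 'M[F]_(dimL ms)) : tensmx (x%:M : 'M[F]_m.+1) w = x *: tensmx 1%:M w.
    by rewrite -[x%:M]scalemx1 tensmxZl.
  have tr (x y : F) (w : 'M[F]_m.+1) : tensmx (x *: w) (y%:M : 'M[F]_(dimL ms)) = (x * y) *: tensmx w 1%:M.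
    by rewrite -[y%:M]scalemx1 tensmxZl tensmxZr scalerA.
  by case: i; case: j; rewrite /= ?tens0mx ?tensmx0 ?addr0 ?add0r ?(tl (1 + s * c 0%N)) ?tr // addrC.
Qed.

End Jets.

Section LeadingTerm.
Variable F : numFieldType.

(** The operator [sum_j q_j h_j]; [wtval] lists its eigenvalues on the weight basis. *)
Fixpoint wtmx (ms : seq nat) (ab : nat -> F * F) (q : nat -> F) : 'M[F]_(dimL ms) :=
  match ms return 'M[F]_(dimL ms) with
  | [::] => 0
  | m :: ms' =>
      q 0%N *: tensmx (Emx m (ab 0%N).1 (ab 0%N).2 true true - Emx m (ab 0%N).1 (ab 0%N).2 false false) 1%:M
      + tensmx 1%:M (wtmx ms' (fun n => ab n.+1) (fun n => q n.+1))
  end.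

Fixpoint wtval (ms : seq nat) (q : nat -> F) : 'I_(dimL ms) -> F :=
  match ms return 'I_(dimL ms) -> F with
  | [::] => fun _ => 0
  | m :: ms' => fun p => q 0%N * (m%:R - ((mxtens_unindex p).1 : nat)%:R *+ 2)
       + wtval (fun n => q n.+1) (mxtens_unindex p).2
  end.

Lemma wtval_cons m ms q (p1 : 'I_m.+1) (p2 : 'I_(dimL ms)) :
  @wtval (m :: ms) q (mxtens_index (p1, p2))
  = q 0%N * (m%:R - (p1 : nat)%:R *+ 2) + @wtval ms (fun n => q n.+1) p2.
Proof.
rewrite -[LHS]/(q 0%N * (m%:R - ((mxtens_unindex (mxtens_index (p1, p2))).1 : nat)%:R *+ 2)
  + wtval (fun n => q n.+1) (mxtens_unindex (mxtens_index (p1, p2))).2).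
by rewrite mxtens_indexK.
Qed.

Lemma wtmxE ms ab q p p' : dominant ms ab ->
  wtmx ms ab q p p' = if p == p' then wtval q p else 0.
Proof.
elim: ms ab q p p' => [|m ms IH] ab q p p' hd; first by rewrite mxE if_same.
case: (mxtens_indexP p) => p1 p2; case: (mxtens_indexP p') => p1' p2'.
rewrite wtval_cons [wtmx _ _ _]/= mxE mxE !tensmxE IH; last first.
  by move=> n hn; apply: (hd n.+1).
rewrite (inj_eq (can_inj (@mxtens_indexK _ _))) xpair_eqE !mxE.
have := hd 0%N isT; rewrite /= => /(canRL (subrK _)) ->.
case: (eqVneq p1 p1') => [->|h1] /=; last by rewrite subrr !mul0r mulr0 addr0.
rewrite mul1r; case: (eqVneq p2 p2') => _; last by rewrite !mulr0 add0r.
by rewrite mulr1; congr (_ * _ + _); ring.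
Qed.

(** Divided by [lead0 ms 1 c * lead0 ms (-1) c], the left-hand side is the sum over the factors of
    [h_j (1 / (1 + c_j) + 1 / (1 - c_j)) = 2 q_j h_j]. *)
Lemma lead1_wtmx ms ab q c : (forall n, (n < size ms)%N -> (1 - c n ^+ 2) * q n = 1) ->
  let X s := lead1 ms s ab c true true - lead1 ms s ab c false false in
  lead0 ms (-1) c *: X 1 - lead0 ms 1 c *: X (-1) = (2 * lead0 ms 1 c * lead0 ms (-1) c) *: wtmx ms ab q.
Proof.
elim: ms ab q c => [|m ms IH] ab q c hq X; first by rewrite /X /= !subr0 !scaler0 subr0.
have := IH (fun n => ab n.+1) (fun n => q n.+1) (fun n => c n.+1) (fun n hn => hq n.+1 hn).
have := hq 0%N isT.
rewrite /X /=; set q0 := q 0%N; set c0 := c 0%N.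
set l1 := lead0 ms 1 _; set l2 := lead0 ms (-1) _.
set a1 := lead1 ms 1 _ _ true true; set a2 := lead1 ms 1 _ _ false false.
set b1 := lead1 ms (-1) _ _ true true; set b2 := lead1 ms (-1) _ _ false false.
set E1 := Emx _ _ _ true true; set E2 := Emx _ _ _ false false; set W := wtmx _ _ _.
move=> hq0 h.
have tD (x y : 'M[F]_(dimL ms)) (k k' : F) : tensmx (1%:M : 'M_m.+1) (k *: x - k' *: y) = k *: tensmx 1%:M x - k' *: tensmx 1%:M y.
  by rewrite tensmxBr !tensmxZr.
have e1 (k k' : F) (x y : 'M[F]_(dimL ms)) :
   k *: tensmx (1%:M : 'M_m.+1) x + k' *: tensmx E1 1%:M - (k *: tensmx 1%:M y + k' *: tensmx E2 1%:M)
   = k *: tensmx 1%:M (x - y) + k' *: tensmx (E1 - E2) 1%:M.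
  by rewrite tensmxBr tensmxBl !scalerBr opprD addrACA.
rewrite !e1 !scalerDr !scalerA opprD addrACA -scalerBl.
rewrite [(1 + -1 * c0) * l2 * _]mulrAC [(1 + 1 * c0) * l1 * _]mulrAC [(1 + 1 * c0) * (1 + -1 * c0)]mulrC.
set AB := (1 + -1 * c0) * (1 + 1 * c0).
have -> : (AB * l2) *: tensmx (1%:M : 'M_m.+1) (a1 - a2) - (AB * l1) *: tensmx 1%:M (b1 - b2)
   = AB *: tensmx 1%:M ((2 * l1 * l2) *: W) by rewrite -h tD scalerBr !scalerA.
rewrite tensmxZr !scalerA addrC /AB; congr (_ *: _ + _ *: _).
- by transitivity (2 * l1 * l2 * ((1 - c0 ^+ 2) * q0)); [rewrite hq0|]; ring.
- by ring.
Qed.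

(** Twice the odd part in [e] of [(1 - e^2 / 4) s_11(1 / e)]. *)
Definition Ohat orth ms (ab : nat -> F * F) w K (e : F) : 'M[F]_(dimL ms) :=
  \sum_(M < K.*2.+3) e ^+ M *: ((1 - (-1) ^+ M) *:
     (scoef orth ms ab w true true M - (1 / 4) *: dly (scoef orth ms ab w true true) 2 M)).

Lemma jet_Ohat orth ms ab w q c K : (size ms < K)%N -> dominant ms ab ->
  (forall n, (n < size ms)%N -> (1 - c n ^+ 2) * q n = 1) ->
  jet (fun e => Ohat orth ms (shiftL ab (fun n => c n / e)) w K e) 0
      ((2 * lead0 ms 1 c * lead0 ms (-1) c) *: (wtmx ms ab q + (wpar w - 1 / 2)%:M)).
Proof.
move=> hK hd hq.
pose G s e (a : bool) : 'M[F]_(dimL ms) :=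
  (theta F orth a true *: (1 - (s / 2) *: 'X) * (1 + (s * (if a then wpar w else 1 - wpar w)) *: 'X)).[e] *:
   (Tm (tcoef ms (shiftL ab (fun n => c n / e))) (size ms).+1 (s * e) true a *m
    Tm (tcoef ms (shiftL ab (fun n => c n / e))) (size ms).+1 (- s * e) false (~~ a)).
have OE e : e != 0 -> Ohat orth ms (shiftL ab (fun n => c n / e)) w K e
   = \sum_(a : bool) (G 1 e a + (-1) *: G (-1) e a).
  move=> e0; set t := tcoef ms (shiftL ab (fun n => c n / e)).
  have t0 i j r : (K <= r)%N -> t i j r = 0 by move=> h; apply: tcoef_eq0; apply: leq_trans h.
  have TE x i j : Tm t (size ms).+1 x i j = Tm t K x i j.
    by apply/esym/Tm_widen => // i' j' r h; apply: tcoef_eq0.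
  have GE s : \sum_(a : bool) G s e a = \sum_(M < K.*2.+3) (s * e) ^+ M *:
     (scoef orth ms (shiftL ab (fun n => c n / e)) w true true M
      - (1 / 4) *: dly (scoef orth ms (shiftL ab (fun n => c n / e)) w true true) 2 M).
    transitivity (\sum_(M < K.*2.+3) (s * e) ^+ M *:
     (sserm t orth (wpar w) true true M - (1 / 4) *: dly (sserm t orth (wpar w) true true) 2 M)).
      rewrite (sserm_gen _ _ _ _ _ t0); apply: eq_bigr => a _.
      rewrite /G !TE mulNr; congr (_ *: _).
      by rewrite !hornerE; move: (theta _ _ _ _) (if a then _ else _) => x y; field.
    by apply: eq_bigr => M _; rewrite scoefE /dly; case: ifP => // _; rewrite scoefE.
  rewrite big_split -scaler_sumr /= !GE scaler_sumr -big_split; apply: eq_bigr => M _ /=.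
  rewrite mul1r !scalerA -scalerDl; congr (_ *: _).
  by rewrite !exprMn expr1n; move: (e ^+ M) ((-1) ^+ M) => x y; ring.
set l1 := lead0 ms 1 c; set l2 := lead0 ms (-1) c.
pose b1 := lead1 ms 1 ab c; pose b2 := lead1 ms (-1) ab c.
pose k (s : F) (a : bool) := s * (wpar w - 1 / 2).
have th1 : theta F orth true true = 1 by rewrite /theta eqxx if_same.
have cf0 (x y : F) : (1 *: (1 - x *: 'X) * (1 + y *: 'X))`_0 = 1.
  by rewrite scale1r coef0M coefB coefD !coefZ !coefX coefC /= !mulr0 subr0 addr0 mulr1.
have cf1 (x y : F) : (1 *: (1 - x *: 'X) * (1 + y *: 'X))`_1 = y - x.
  by rewrite scale1r coef1M !coefB !coefD !coefZ !coefX !coefC /= !mulr0 !mulr1 subr0 !addr0 mul1r add0r sub0r mulr1.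
(* For [a = false] both factors are off-diagonal and of order [e], so their product only enters in
   order [e^2]. *)
have jG s a : jet (fun e => G s e a)
    (if a then (lead0 ms s c * lead0 ms (- s) c)%:M else 0)
    (if a then lead0 ms s c *: lead1 ms (- s) ab c false false + lead0 ms (- s) c *: lead1 ms s ab c true true
       + (s * (wpar w - 1 / 2) * lead0 ms s c * lead0 ms (- s) c)%:M else 0).
  have jM := jetM (jet_Tm ms s ab c true a) (jet_Tm ms (- s) ab c false (~~ a)).
  apply: (jet_eq (jetZ (theta F orth a true *: (1 - (s / 2) *: 'X) *
        (1 + (s * (if a then wpar w else 1 - wpar w)) *: 'X)) jM)) => //.
  - case: a {jM}; rewrite /= ?mulmx0 ?mul0mx ?scaler0 //.
    by rewrite th1 cf0 scale1r -scalar_mxM.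
  - case: a {jM}; rewrite /= ?mulmx0 ?mul0mx ?addr0 ?scaler0 ?addr0 //.
    rewrite th1 cf0 cf1 scale1r -scalar_mxM !mul_scalar_mx mul_mx_scalar; congr (_ + _).
    by rewrite -scalemx1 -[X in _ = _ *: X]scalemx1 scalerA; congr (_ *: _); field.
have jj := jet_bool (fun a => jetD (jG 1 a) (jetZ (-1)%:P (jG (-1) a))).
apply: (jet_eq jj) => [e e0||].
- rewrite OE //; apply: eq_bigr => a _; by rewrite hornerC.
- rewrite big_bool /= !scaler0 !addr0 coefC /= scaleN1r opprK mulrC subrr //.
- rewrite big_bool /= !scaler0 !addr0 !coefC /= scale0r addr0 opprK.
  have := lead1_wtmx ab hq; rewrite /= => h.
  rewrite [LHS]scalerDr -h /l1 /l2 scale_scalar_mx.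
  move: (lead1 ms 1 ab c true true) (lead1 ms 1 ab c false false) (lead1 ms (-1) ab c true true) (lead1 ms (-1) ab c false false).
  move=> A B C D; apply/matrixP => i j; rewrite !mxE; case: (i == j); rewrite ?mulr1n ?mulr0n; ring.
Qed.

End LeadingTerm.

(** * The family X(e) on the whole multiplicity space *)

Section Assembly.
Variables (F : numFieldType) (orth : bool).
Local Notation pars := (nat -> (nat -> F * F) * option F).
Implicit Types (Ss : seq (seq nat)) (P : pars).

Definition shiftP P (z : nat -> F) : pars := fun s => (shiftL (P s).1 z, (P s).2).

Definition OhatS Ss P K (e : F) : 'M[F]_(sumdim Ss) :=
  \sum_(M < K.*2.+3) e ^+ M *: ((1 - (-1) ^+ M) *:
     (smx orth Ss P true true M - (1 / 4) *: dly (smx orth Ss P true true) 2 M)).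

Fixpoint valS Ss P (q : nat -> F) : 'I_(sumdim Ss) -> F :=
  match Ss return 'I_(sumdim Ss) -> F with
  | [::] => fun _ => 0
  | ms :: Ss' => fun i => match fintype.split i with
     | inl p => wtval q p + (wpar (P 0%N).2 - 1 / 2)
     | inr p => valS (fun n => P n.+1) q p
     end
  end.

Lemma valS_l ms Ss P q p : @valS (ms :: Ss) P q (lshift _ p) = @wtval F ms q p + (wpar (P 0%N).2 - 1 / 2).
Proof. by rewrite /= (unsplitK (inl p)). Qed.

Lemma valS_r ms Ss P q p : @valS (ms :: Ss) P q (rshift _ p) = @valS Ss (fun n => P n.+1) q p.
Proof. by rewrite /= (unsplitK (inr p)). Qed.

Lemma OhatS_cons ms Ss P K e :
  OhatS (ms :: Ss) P K e = block_mx (Ohat orth ms (P 0%N).1 (P 0%N).2 K e) 0 0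
                                    (OhatS Ss (fun n => P n.+1) K e).
Proof.
have bsum m n (I : finType) (f : I -> 'M[F]_m) (g : I -> 'M[F]_n) :
    \sum_i block_mx (f i) 0 0 (g i) = block_mx (\sum_i f i) 0 0 (\sum_i g i).
  apply: (big_rec3 (fun x y z => x = block_mx y 0 0 z)); first by rewrite -block_mx0.
  by move=> i x y z _ ->; rewrite add_block_mx !addr0.
rewrite /OhatS /Ohat -bsum; apply: eq_bigr => M _.
rewrite /dly; case: ifP => _ /=.
  by rewrite scale_block_mx opp_block_mx add_block_mx !scale_block_mx !(scaler0, oppr0, addr0).
by rewrite !scaler0 !subr0 !scale_block_mx !scaler0.
Qed.

Lemma lead0E ms (s : F) c : lead0 ms s c = \prod_(i < size ms) (1 + s * c i).
Proof.
elim: ms c => [|m ms IH] c /=; first by rewrite big_ord0.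
by rewrite big_ord_recl IH.
Qed.

Lemma admissibleS_shift Ss P z : admissibleS orth Ss P -> admissibleS orth Ss (shiftP P z).
Proof.
elim: Ss P => [|ms Ss IH] P //= [[hd hw] hS]; split; last exact: (IH _ hS).
split=> // n hn; rewrite /shiftP /= opprD addrACA subrr addr0; exact: hd.
Qed.

Definition leadn k (c : nat -> F) : F := (\prod_(i < k) (1 + 1 * c i)) * (\prod_(i < k) (1 + -1 * c i)).

Lemma jet_OhatS Ss P k q c : all (fun ms => size ms == k) Ss -> admissibleS orth Ss P ->
  (forall n, (n < k)%N -> (1 - c n ^+ 2) * q n = 1) ->
  jet (fun e => OhatS Ss (shiftP P (fun n => c n / e)) k.+1 e) 0
      ((2 * leadn k c) *: diag_mx (\row_i valS P q i)).
Proof.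
move=> + + hq; elim: Ss P => [|ms Ss IH] P.
  by move=> _ _; exists 0; split=> [e _||]; try case; rewrite // [LHS]flatmx0 [RHS]flatmx0.
move=> /= /andP [/eqP hk hall] [[hd _] hS].
have hK : (size ms < k.+1)%N by rewrite hk.
have hq' n : (n < size ms)%N -> (1 - c n ^+ 2) * q n = 1 by rewrite hk; apply: hq.
have j1 := jet_Ohat orth (P 0%N).2 hK hd hq'.
have j2 := IH (fun n => P n.+1) hall hS.
apply: (jet_eq (jet_block j1 j2)) => [e e0||].
- by rewrite OhatS_cons.
- by rewrite -block_mx0.
rewrite !lead0E hk -mulrA -/(leadn k c).
transitivity ((2 * leadn k c) *: block_mx (wtmx ms (P 0%N).1 q + (wpar (P 0%N).2 - 1 / 2)%:M) 0 0
    (diag_mx (\row_i @valS Ss (fun n => P n.+1) q i))); last by rewrite scale_block_mx !scaler0.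
congr (_ *: _); apply/matrixP => i j.
rewrite [LHS]mxE [X in X *+ _]mxE.
case: (split_ordP i) => p ->; case: (split_ordP j) => p' ->.
- rewrite block_mxEul (inj_eq (@lshift_inj _ _)) [RHS]mxE wtmxE // [X in _ = _ + X]mxE.
  by case: eqP => _; rewrite ?mulr1n // mulr0n addr0.
- by rewrite block_mxEur mxE eq_lrshift mulr0n.
- by rewrite block_mxEdl mxE eq_rlshift mulr0n.
- rewrite block_mxEdr (inj_eq (@rshift_inj _ _)) [RHS]mxE [X in _ = X *+ _]mxE.
  by [].
Qed.

Section ImB.
Variables (Ss : seq (seq nat)) (P : pars).
Local Notation B := (@imB F orth Ss P).

Lemma imB_D X Y : B X -> B Y -> B (X + Y).
Proof. by move=> [x [hx ->]] [y [hy ->]]; exists (SAdd x y); split=> //; apply: inB_add. Qed.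

Lemma imB_Z c X : B X -> B (c *: X).
Proof.
move=> [x [hx ->]]; exists (SMul (SC c) x); split; last by rewrite /= mul_scalar_mx.
by apply: inB_mul => //; apply: inB_C.
Qed.

Lemma imB_smx M : odd M -> B (smx orth Ss P true true M).
Proof.
move=> oM; exists (SG F true true M); split=> //.
by rewrite -(odd_double_half M) oM -mul2n addnC; apply: inB_gen.
Qed.

(** The factor [1 - (-1) ^+ M] removes the even coefficients, and the delay by 2 keeps the index
    odd. *)
Lemma imB_OhatS K e : B (OhatS Ss P K e).
Proof.
have B0 : B 0 by exists (SC 0); split; [apply: inB_C|rewrite /= raddf0].
apply: big_ind => [|X Y|M _] //; first exact: imB_D.
apply: imB_Z; case: (boolP (odd M)) => oM; last by rewrite -signr_odd (negbTE oM) subrr scale0r.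
apply: imB_Z; apply: imB_D; first exact: imB_smx.
rewrite -scaleNr; apply: imB_Z; rewrite /dly; case: ifP => // h.
by apply: imB_smx; rewrite oddB // oM.
Qed.
End ImB.

(** The modules escape to infinity as [e] tends to 0, but [OhatS] divided by [e] and by its scalar
    factor stays polynomial and becomes diagonal in the limit. *)
Theorem spectral_family Ss P k q c : all (fun ms => size ms == k) Ss -> admissibleS orth Ss P ->
  (forall n, (n < k)%N -> (1 - c n ^+ 2) * q n = 1) ->
  exists X : 'M[{poly F}]_(sumdim Ss),
    map_mx (horner_eval 0) X = diag_mx (\row_i valS P q i) /\
    forall e, e != 0 -> let B := @imB F orth Ss (shiftP P (fun n => c n / e)) in
      let Xe := map_mx (horner_eval e) X in
      B Xe /\ forall Y, B Y -> Y *m Xe = Xe *m Y.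
Proof.
move=> hk hP hq; have [X0 [h1 h0]] := jet_div (jet_OhatS hk hP hq).
(* The relation between [c] and [q] excludes [c i = 1] and [c i = -1]. *)
have l0 : 2 * leadn k c != 0.
  rewrite mulf_neq0 ?pnatr_eq0 // mulf_neq0 //; apply/prodf_neq0 => i _;
    have := hq i (ltn_ord i); apply: contra_eq_neq => /eqP e.
  - have -> : 1 - c i ^+ 2 = (1 + 1 * c i) * (1 + -1 * c i) by ring.
    by rewrite (eqP e) !mul0r eq_sym oner_neq0.
  - have -> : 1 - c i ^+ 2 = (1 + 1 * c i) * (1 + -1 * c i) by ring.
    by rewrite (eqP e) mulr0 mul0r eq_sym oner_neq0.
pose a := (2 * leadn k c)^-1.
exists (a%:P *: X0); split.
  rewrite map_mxZ h0 /= /horner_eval hornerC scalerA mulVf // scale1r //.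
move=> e e0 B Xe.
have XE : Xe = (a / e) *: OhatS Ss (shiftP P (fun n => c n / e)) k.+1 e.
  by rewrite /Xe map_mxZ -h1 // /= /horner_eval hornerC scalerA.
have hB : B Xe by rewrite XE; apply: imB_Z; apply: imB_OhatS.
split=> // Y hY; rewrite XE -scalemxAr -scalemxAl; congr (_ *: _).
rewrite /OhatS mulmx_suml mulmx_sumr; apply: eq_bigr => M _.
rewrite -scalemxAr -scalemxAl; congr (_ *: _).
rewrite -scalemxAr -scalemxAl; case: (boolP (odd M)) => oM; last first.
  by rewrite -signr_odd (negbTE oM) subrr !scale0r.
have hS := admissibleS_shift (fun n => c n / e) hP.
congr (_ *: _); rewrite mulmxBr mulmxBl -scalemxAr -scalemxAl (imB_comm hS oM hY).
rewrite /dly; case: ifP => [h|_]; last by rewrite mulmx0 mul0mx.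
by rewrite (imB_comm hS _ hY) // oddB // oM.
Qed.

End Assembly.

(** * Generic slopes *)

Section Genericity.
Variable F : numFieldType.

Lemma exists_notin (s : seq F) : exists x, x \notin s.
Proof.
exists (1 + \sum_(y <- s) `|y|); apply/negP => hx.
have le y : y \in s -> `|y| <= \sum_(y <- s) `|y|.
  elim: s {hx} => //= a s IH; rewrite inE big_cons => /predU1P [->|/IH h].
    by rewrite lerDl sumr_ge0.
  by rewrite (le_trans h) // lerDr.
have s0 : 0 <= \sum_(y <- s) `|y| by rewrite sumr_ge0.
have := le _ hx; rewrite ger0_norm ?addr_ge0 //.
by rewrite gerDr ler10.
Qed.

Lemma generic_slope (J I O : finType) (h : J -> F) (d : I -> F) (c : O -> F) :
  exists2 x, x != 0 & forall j j' i i' o, h j != h j' -> x * (h j - h j') + (d i - d i') != c o.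
Proof.
pose f (a : J * J * (I * I) * O) := (c a.2 - (d a.1.2.1 - d a.1.2.2)) / (h a.1.1.1 - h a.1.1.2).
have [x] := exists_notin (0 :: codom f); rewrite inE negb_or => /andP [x0 hx].
exists x => // j j' i i' o hj; apply: contra hx => /eqP e; apply/codomP.
exists (j, j', (i, i'), o); rewrite /f /= -e addrK mulfK // subr_eq0 //.
Qed.

(* The differences 1 and -1 are excluded because the one-dimensional factors W(0) and
   W(1) shift the eigenvalues by 0 and 1. *)
Definition separating ms (q : nat -> F) := (forall n, q n != 0) /\
  forall p p' : 'I_(dimL ms), wtval q p - wtval q p' \in [:: 0; 1; -1] -> p = p'.

(** The slope of the first factor is chosen last, outside the finitely many ratios that would create
    a forbidden difference. *)
Lemma ex_separating ms : exists q, separating ms q.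
Proof.
elim: ms => [|m ms [q [q0 hq]]].
  by exists (fun=> 1); split=> [_|p p' _]; [apply: oner_neq0|rewrite !ord1].
have [x x0 hx] := generic_slope (fun p : 'I_m.+1 => m%:R - (p : nat)%:R *+ 2 : F) (wtval (ms := ms) q)
  (fun o : option bool => if o is Some b then (if b then 1 else -1) else 0 : F).
exists (fun n => if n is n'.+1 then q n' else x); split=> [[|n]|p p'] //.
case: (mxtens_indexP p) => p1 p2; case: (mxtens_indexP p') => p1' p2'.
have E (a b a' b' : F) : x * a + b - (x * a' + b') = x * (a - a') + (b - b') by ring.
rewrite !wtval_cons E.
case: (eqVneq p1 p1') => [->|h1].
  by rewrite subrr mulr0 add0r => /hq ->.
have hh : m%:R - (p1 : nat)%:R *+ 2 != m%:R - (p1' : nat)%:R *+ 2 :> F.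
  by rewrite (inj_eq (addrI _)) eqr_opp -!mulrnA eqr_nat eqn_pmul2r.
rewrite !inE => /or3P [] /eqP e.
- by have := hx _ _ p2 p2' None hh; rewrite e eqxx.
- by have := hx _ _ p2 p2' (Some true) hh; rewrite e eqxx.
- by have := hx _ _ p2 p2' (Some false) hh; rewrite e eqxx.
Qed.

Local Notation pars := (nat -> (nat -> F * F) * option F).

Lemma separating_inj ms q : separating ms q -> injective (@wtval F ms q).
Proof. by move=> [_ hq] p p' e; apply: hq; rewrite e subrr !inE eqxx. Qed.

Lemma valS1_inj ms (P : pars) q : separating ms q -> injective (@valS F [:: ms] P q).
Proof.
move=> /separating_inj hq i j.
case: (split_ordP i) => [p ->|[]//]; case: (split_ordP j) => [p' ->|[]//].
by rewrite !valS_l => /addIr /hq ->.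
Qed.

Lemma valS2_inj ms ms' (P : pars) q :
  injective (@wtval F ms q) -> injective (@wtval F ms' q) ->
  (forall p p', @wtval F ms q p + wpar (P 0%N).2 != @wtval F ms' q p' + wpar (P 1%N).2) ->
  injective (@valS F [:: ms; ms'] P q).
Proof.
move=> h h' hd i j.
case: (split_ordP i) => [p ->|p1 ->]; case: (split_ordP j) => [p' ->|p1' ->].
- by rewrite !valS_l => /addIr /h ->.
- case: (split_ordP p1') => [p' ->|[]//]; rewrite valS_r !valS_l !addrA => /addIr e.
  by have := hd p p'; rewrite e eqxx.
- case: (split_ordP p1) => [p ->|[]//]; rewrite valS_r !valS_l !addrA => /addIr e.
  by have := hd p' p; rewrite e eqxx.
- case: (split_ordP p1) => [p ->|[]//]; case: (split_ordP p1') => [p' ->|[]//].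
  by rewrite !valS_r !valS_l => /addIr /h' ->.
Qed.

Lemma ex_generic1 ms (P : pars) : exists q, (forall n, q n != 0) /\ injective (@valS F [:: ms] P q).
Proof. have [q hq] := ex_separating ms; exists q; split; [by case: hq|exact: valS1_inj]. Qed.

Lemma ex_generic_shift ms (P : pars) : wpar (P 1%N).2 = wpar (P 0%N).2 + 1 ->
  exists q, (forall n, q n != 0) /\ injective (@valS F [:: ms; ms] P q).
Proof.
move=> hw; have [q hq] := ex_separating ms; exists q; split; first by case: hq.
have hi := separating_inj hq; apply: valS2_inj => // p p'.
rewrite hw [_ + 1]addrC addrA (inj_eq (addIr _)); apply/eqP => e.
have e1 : wtval q p - wtval q p' = 1 by rewrite e; ring.
have /hq.2 pp : wtval q p - wtval q p' \in [:: 0; 1; -1] by rewrite e1 !inE eqxx orbT.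
by move: e1; rewrite pp subrr => /eqP; rewrite eq_sym oner_eq0.
Qed.

(* The weights [m+1-2p] and [m-2p'] are distinguished by parity: both are half
   of a weight of [V_(2m+2)], with index [2p], resp. [2p'+1]. *)
Lemma ex_generic_parity m ms (P : pars) : wpar (P 1%N).2 = wpar (P 0%N).2 ->
  exists q, (forall n, q n != 0) /\ injective (@valS F [:: m.+1 :: ms; m :: ms] P q).
Proof.
move=> hw; have [q hq] := ex_separating (m.+1.*2 :: ms).
(* The doubled slope compensates for the halved weights. *)
pose q2 n := if n is n'.+1 then q n else 2 * q 0%N.
exists q2; split; first by case=> [|n] /=; rewrite ?mulf_neq0 ?pnatr_eq0 //; case: hq.
have hi := separating_inj hq.
have b1 (p : 'I_m.+2) : (p.*2 < m.+1.*2.+1)%N by have := ltn_ord p; lia.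
have b2 (p : 'I_m.+1) : (p.*2.+1 < m.+1.*2.+1)%N by have := ltn_ord p; lia.
pose g1 p r := mxtens_index (Ordinal (b1 p), r) : 'I_(dimL (_ :: ms)).
pose g2 p r := mxtens_index (Ordinal (b2 p), r) : 'I_(dimL (_ :: ms)).
have e1 p r : @wtval F (m.+1 :: ms) q2 (mxtens_index (p, r)) = wtval q (g1 p r).
  by rewrite !wtval_cons /= -!muln2 !natrM; ring.
have e2 p r : @wtval F (m :: ms) q2 (mxtens_index (p, r)) = wtval q (g2 p r).
  by rewrite !wtval_cons /= -!muln2 -addn1 natrD !natrM; ring.
have ij := can_inj (@mxtens_indexK _ _).
apply: valS2_inj => p p'; case: (mxtens_indexP p) => p1 p2; case: (mxtens_indexP p') => p1' p2'.
- by rewrite !e1 => /hi /(ij _ _) [] /double_inj /val_inj -> ->.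
- by rewrite !e2 => /hi /(ij _ _) [] /double_inj /val_inj -> ->.
- rewrite hw (inj_eq (addIr _)) e1 e2 (inj_eq hi) (inj_eq (ij _ _)) xpair_eqE.
  by rewrite -val_eqE /=; apply/negP => /andP [/eqP /(congr1 odd)]; rewrite /= !odd_double.
Qed.

End Genericity.

(** * The modules attached to a pair of highest weights *)

Section Weights.
Variables (F : numFieldType) (orth h : bool) (k : nat) (l mu : nat -> int).
Hypotheses (k0 : (0 < k)%N) (orth_h : ~~ orth -> h = false) (l1 : l 1%N <= 0)
  (l_dec : forall j, (1 <= j)%N -> (j < k)%N -> l j.+1 <= l j)
  (mu1 : (1 < k)%N -> mu 1%N <= 0)
  (mu_dec : forall j, (1 <= j)%N -> (j.+1 < k)%N -> mu j.+1 <= mu j)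
  (branching : forall j, (1 <= j)%N -> (j < k)%N ->
     l j.+1 <= mu j /\ mu j <= (if j == 1%N then 0 else l j.-1)).
Local Notation P0 := (params orth h k l mu (fun=> 0 : F)).

Lemma params_shift z : params orth h k l mu z = shiftP P0 z.
Proof.
apply/funext => s; rewrite /params /shiftP /shiftL; case: (~~ orth) => /=; congr (_, _).
  by apply/funext => n; rewrite !addr0.
by apply/funext => -[|n] /=; rewrite !addr0.
Qed.

Lemma mxw1_le0 : mxw k l mu 1 <= 0.
Proof.
rewrite /mxw; case: eqP => [<-//|k1]; rewrite ge_max l1 mu1 //.
by case: k k0 k1 => [|[]].
Qed.

Lemma mdim1 : (mdim k l mu 1)%:R = - (mxw k l mu 1)%:~R :> F.
Proof. by rewrite /mdim eqxx pmulrn abszE ler0_norm ?mxw1_le0 // rmorphN. Qed.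

(** Interlacing places [mnw] above [mxw], so the absolute value in [mdim] is the difference
    itself. *)
Lemma mdimS j : (j.+2 <= k)%N ->
  (mdim k l mu j.+2)%:R = (mnw l mu j.+2)%:~R - (mxw k l mu j.+2)%:~R :> F.
Proof.
move=> jk; rewrite /mdim /= pmulrn abszE ger0_norm ?rmorphB //=.
have [b _] := branching (ltn0Sn j) jk; have d := l_dec (ltn0Sn j) jk.
rewrite subr_ge0 /mnw /mxw le_min /=; case: eqP => [<-|jk']; first by rewrite d b.
have jk2 : (j.+2 < k)%N by lia.
have [_ c] := branching (ltn0Sn j.+1) jk2.
by rewrite !ge_max d b /= c mu_dec.
Qed.

Lemma alphaB_beta j : (j.+2 <= k)%N ->
  alpha F orth h l mu j.+2 - beta F orth h k l mu j.+2 = (mdim k l mu j.+2)%:R.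
Proof. by move=> jk; rewrite mdimS // /alpha /beta /wt; case: orth => /=; ring. Qed.

Let rest := [seq mdim k l mu j | j <- iota 2 k.-1].

Lemma size_rest m : size (m :: rest) = k.
Proof. by rewrite /= size_map size_iota prednK. Qed.

Lemma nth_rest n : (n.+1 < k)%N -> nth 0%N rest n = mdim k l mu n.+2.
Proof. by move=> nk; rewrite (nth_map 0%N) ?size_iota ?nth_iota //; lia. Qed.

Lemma shapesE : shapes orth h k l mu =
  if orth && (h || (mxw k l mu 1 < 0)) then
    [:: mdim k l mu 1 :: rest; (if h then mdim k l mu 1 else (mdim k l mu 1).-1) :: rest]
  else [:: mdim k l mu 1 :: rest].
Proof.
rewrite /shapes; case: orth => //=.
by rewrite -[in iota 1 k](prednK k0).
Qed.

Lemma dominant_rest m (ab : nat -> F * F) : (ab 0%N).1 - (ab 0%N).2 = m%:R ->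
  (forall n, ab n.+1 = (alpha F orth h l mu n.+2 + 0, beta F orth h k l mu n.+2 + 0)) ->
  dominant (m :: rest) ab.
Proof.
move=> h0 hS [|n] //; rewrite size_rest => nk.
by rewrite hS !addr0 alphaB_beta // [RHS]/= nth_rest.
Qed.

Lemma admissible_shapes : admissibleS orth (shapes orth h k l mu) P0.
Proof.
rewrite shapesE.
have d0 : dominant (mdim k l mu 1 :: rest) (P0 0%N).1.
  apply: dominant_rest; last by rewrite /params; case: orth.
  rewrite mdim1 /params /beta /alpha /wt.
  case: orth orth_h => [_|->] //=; last by field.
  by case: h => /=; field.
have a0 : admissible orth (mdim k l mu 1 :: rest) (P0 0%N).1 (P0 0%N).2.
  by split=> //; rewrite /params; case: orth.
case: ifP => [/andP [o hh]|_]; split=> //; split=> //; split; last by rewrite /params o.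
apply: dominant_rest; last by rewrite /params o.
rewrite /params o /beta /wt /=; case: h hh => /= [_|m0]; first by rewrite mdim1; field.
have : (mdim k l mu 1)%:R = - (mxw k l mu 1)%:~R :> F by exact: mdim1.
(* For integral weights U' is present only if [beta_1 < 0]; the dimension index is then positive and
   its predecessor is a true difference. *)
case E : (mdim k l mu 1) => [|m] /=.
  by move: E; rewrite /mdim eqxx => /eqP; rewrite absz_eq0 => /eqP e; rewrite e ltxx in m0.
by rewrite -addn1 natrD => /(canRL (addrK _)) ->; ring.
Qed.

Lemma size_shapes : all (fun ms => size ms == k) (shapes orth h k l mu).
Proof.
have e m : size (m :: rest) == k by rewrite size_rest.
by rewrite shapesE; case: ifP => _; do 2?[apply/andP; split].
Qed.

(** Two summands can collide. For half-integers they have the same shape and the constants of W(0)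
    and W(1) differ by 1; for integers the constants agree and the weights of the first factors have
    opposite parity. *)
Lemma ex_generic : exists q : nat -> F, (forall n, q n != 0) /\
  injective (@valS F (shapes orth h k l mu) P0 q).
Proof.
rewrite shapesE; case: ifP => [/andP [o hh]|_]; last exact: ex_generic1.
case: h hh => [_|/= m0].
  by apply: ex_generic_shift; rewrite /params o /= add0r.
case E : (mdim k l mu 1) => [|m] /=.
  by move: E; rewrite /mdim eqxx => /eqP; rewrite absz_eq0 => /eqP e; rewrite e ltxx in m0.
by apply: ex_generic_parity; rewrite /params o.
Qed.

End Weights.

(** * Eigenbases of matrices with cyclic vector (1, ..., 1) *)

Section Cyclic.
Variable n : nat.
Local Notation N := n.+1.

Definition krylov (F : comNzRingType) (A : 'M[F]_N) : 'M[F]_N :=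
  \matrix_(p, k) (A ^+ k *m (const_mx 1 : 'cV_N)) p 0.

(* Over a field, nonzero iff [A] has no multiple eigenvalue and the vector with all
   coordinates 1 is cyclic for [A]. *)
Definition badness (F : comNzRingType) (A : 'M[F]_N) : F :=
  \det (horner_mx A (char_poly A)^`()) * \det (krylov A).

(** Applied to evaluation, this turns [badness] of the polynomial family into a polynomial in [e]
    whose roots are the parameters to avoid. *)
Lemma badness_map (F E : comNzRingType) (f : {rmorphism F -> E}) (A : 'M[F]_N) :
  badness (map_mx f A) = f (badness A).
Proof.
rewrite /badness rmorphM /= -!det_map_mx; congr (_ * _); congr determinant.
  by rewrite map_horner_mx -deriv_map map_char_poly.
apply/matrixP => p k; rewrite !mxE rmorph_sum; apply: eq_bigr => j _.
by rewrite !mxE !mulr1 -rmorphXn mxE.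
Qed.

Lemma prodXsubC_split (F : fieldType) (r : 'I_N -> F) i :
  \prod_j ('X - (r j)%:P) = ('X - (r i)%:P) * \prod_(j | j != i) ('X - (r j)%:P).
Proof. by rewrite (bigD1 i). Qed.

Lemma deriv_root (F : fieldType) (p q : {poly F}) a : p = ('X - a%:P) * q -> p^`().[a] = q.[a].
Proof.
by move=> ->; rewrite derivM derivXsubC mul1r hornerD hornerM hornerXsubC subrr mul0r addr0.
Qed.

(** The first factor is a product of differences of entries, and the Krylov matrix is a transposed
    Vandermonde matrix. *)
Lemma badness_diag (F : fieldType) (d : 'I_N -> F) : injective d ->
  badness (diag_mx (\row_i d i)) != 0.
Proof.
move=> dI; have cp : char_poly (diag_mx (\row_i d i)) = \prod_j ('X - (d j)%:P).
  rewrite char_poly_trig ?diag_mx_is_trig //; apply: eq_bigr => i _.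
  by rewrite !mxE eqxx mulr1n.
have nz i (P : pred 'I_N) : (forall j, P j -> j != i) -> \prod_(j | P j) (d j - d i) != 0.
  move=> h; apply/prodf_neq0 => j /h; rewrite subr_eq0; apply: contra => /eqP /dI ->.
  exact: eqxx.
rewrite /badness mulf_neq0 //.
  rewrite horner_mx_diag det_diag; apply/prodf_neq0 => i _; rewrite !mxE cp.
  rewrite (deriv_root (prodXsubC_split d i)) horner_prod.
  apply/prodf_neq0 => j ji; rewrite hornerXsubC subr_eq0 eq_sym.
  by apply: contra ji => /eqP /dI ->.
have -> : krylov (diag_mx (\row_i d i)) = (Vandermonde N (\row_i d i))^T.
  apply/matrixP => p k; rewrite !mxE.
  rewrite (_ : diag_mx _ ^+ k = diag_mx (\row_i (d i ^+ k))); last first.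
    elim: {p} (k : nat) => [|m IH].
      rewrite expr0; apply/matrixP => p q; rewrite !mxE expr0; by case: eqP.
    by rewrite exprS IH -mulmxE; apply/matrixP => p q; rewrite mul_diag_mx !mxE exprS; case: eqP; rewrite ?mulr0n ?mulr0 ?mulr1n.
  rewrite (bigD1 p) //= big1 ?addr0 => [|q qp]; rewrite !mxE.
    by rewrite eqxx mulr1.
  by rewrite eq_sym (negbTE qp) mul0r.
rewrite det_tr det_Vandermonde; apply/prodf_neq0 => i _.
under eq_bigr do rewrite !mxE; apply: nz => j; by apply: contraTneq => ->; rewrite ltnn.
Qed.

Section Eigenbasis.
Variables (F : fieldType) (A : 'M[F]_N) (r : 'I_N -> F).
Hypotheses (hr : char_poly A = \prod_i ('X - (r i)%:P)) (rI : injective r).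
Hypothesis hK : \det (krylov A) != 0.

(** An unnormalised spectral projection of the all-ones vector. Being polynomial in [A] and the
    eigenvalues, it inherits their continuity. *)
Definition eigvec i : 'cV[F]_N := horner_mx A (\prod_(j | j != i) ('X - (r j)%:P)) *m const_mx 1.

Lemma eigvecE i : A *m eigvec i = r i *: eigvec i.
Proof.
apply/eqP; rewrite -subr_eq0 /eigvec mulmxA -mul_scalar_mx mulmxA -mulmxBl; apply/eqP.
have -> : A *m horner_mx A (\prod_(j | j != i) ('X - (r j)%:P)) -
    (r i)%:M *m horner_mx A (\prod_(j | j != i) ('X - (r j)%:P)) = horner_mx A (char_poly A).
  by rewrite hr (prodXsubC_split r i) rmorphM rmorphB /= horner_mx_X horner_mx_C -mulmxE mulmxBl.
by rewrite Cayley_Hamilton mul0mx.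
Qed.

Lemma krylov_horner (p : {poly F}) : (size p <= N)%N ->
  horner_mx A p *m const_mx 1 = krylov A *m (\col_k p`_k).
Proof.
move=> hp; have -> : horner_mx A p = \sum_(k < N) p`_k *: A ^+ k.
  rewrite -{1}(coefK p) poly_def (big_ord_widen N (fun k => p`_k *: 'X^k)) // big_mkcond.
  rewrite rmorph_sum /=; apply: eq_bigr => k _; case: ltnP => h.
    by rewrite horner_mxZ rmorphXn /= horner_mx_X.
  by rewrite rmorph0 nth_default // scale0r.
rewrite mulmx_suml; apply/matrixP => i j; rewrite summxE [RHS]mxE; apply: eq_bigr => k _.
by rewrite -scalemxAl [LHS]mxE [krylov _ _ _]mxE [(\col__ _) _ _]mxE (ord1 j) mulrC.
Qed.

(** An invertible Krylov matrix means that no nonzero polynomial of size at most [N] in [A] kills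
    the all-ones vector. *)
Lemma eigvec_neq0 i : eigvec i != 0.
Proof.
set q := \prod_(j | j != i) ('X - (r j)%:P).
have mq : q \is monic by apply: monic_prod_XsubC.
have sq : (size q <= N)%N.
  have := size_char_poly A; rewrite hr (prodXsubC_split r i) size_Mmonic ?polyXsubC_eq0 //.
  by rewrite size_XsubC -/q => -[]; rewrite add0n => ->.
apply: contraTneq mq; rewrite /eigvec krylov_horner // => h.
have : \col_(k < N) q`_k = 0.
  by rewrite -[LHS]mul1mx -(@mulVmx _ _ (krylov A)) ?unitmxE ?unitfE // -mulmxA h mulmx0.
move=> /matrixP hc; have -> : q = 0.
  apply/polyP => k; rewrite coef0; case: (ltnP k N) => hk.
    by have := hc (Ordinal hk) 0; rewrite !mxE.
  by rewrite nth_default // (leq_trans sq).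
by rewrite monicE lead_coef0 eq_sym oner_neq0.
Qed.

Lemma eigvec_free (c : 'I_N -> F) : \sum_i c i *: eigvec i = 0 -> forall i, c i = 0.
Proof.
move=> h i; set q := \prod_(j | j != i) ('X - (r j)%:P).
have hq p j : horner_mx A p *m eigvec j = p.[r j] *: eigvec j.
  elim/poly_ind: p => [|p a IH]; first by rewrite rmorph0 mul0mx horner0 scale0r.
  rewrite rmorphD rmorphM /= horner_mx_X horner_mx_C mulmxDl -mulmxE -mulmxA eigvecE.
  by rewrite -scalemxAr IH mul_scalar_mx scalerA !hornerE scalerDl [r j * _]mulrC.
have := congr1 (mulmx (horner_mx A q)) h; rewrite mulmx0 mulmx_sumr (bigD1 i) //= big1 ?addr0.
  rewrite -scalemxAr hq scalerA => /eqP; rewrite scaler_eq0 (negbTE (eigvec_neq0 i)) orbF mulf_eq0.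
  case/orP => /eqP // /eqP; rewrite horner_prod => /prodf_eq0 [j ji].
  by rewrite hornerXsubC subr_eq0 => /eqP /rI e; rewrite e eqxx in ji.
move=> j ji; rewrite -scalemxAr hq /q (bigD1 j) //= hornerM hornerXsubC subrr mul0r.
by rewrite scale0r scaler0.
Qed.

Lemma eigvec_unit : (\matrix_(p, i) eigvec i p 0) \in unitmx.
Proof.
rewrite unitmxE unitfE -det_tr; apply/det0P => -[v v0 h].
case/eqP: v0; apply/matrixP => a b; rewrite (ord1 a) mxE.
apply: eigvec_free; apply/matrixP => p q; rewrite summxE [RHS]mxE.
have /matrixP /(_ 0 p) := h; rewrite !mxE => e; rewrite -[RHS]e; apply: eq_bigr => j _.
by rewrite !mxE (ord1 q).
Qed.

Lemma eigvec_comm (Y : 'M[F]_N) i : Y *m A = A *m Y -> exists c, Y *m eigvec i = c *: eigvec i.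
Proof.
move=> hY; pose W := \matrix_(p, i) eigvec i p 0.
pose c : 'cV[F]_N := invmx W *m (Y *m eigvec i).
have WE (x : 'cV_N) : W *m x = \sum_j x j 0 *: eigvec j.
  apply/matrixP => p q; rewrite mxE summxE; apply: eq_bigr => j _.
  by rewrite !mxE (ord1 q) mulrC.
have hc : Y *m eigvec i = \sum_j c j 0 *: eigvec j.
  by rewrite -WE /c [RHS]mulmxA mulmxV ?mul1mx //; apply: eigvec_unit.
have : \sum_j (c j 0 * (r j - r i)) *: eigvec j = 0.
  transitivity (A *m (Y *m eigvec i) - r i *: (Y *m eigvec i)).
    rewrite hc mulmx_sumr scaler_sumr -sumrB; apply: eq_bigr => j _.
    by rewrite -scalemxAr eigvecE !scalerA -scalerBl mulrBr [r i * _]mulrC.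
  by rewrite mulmxA -hY -mulmxA eigvecE -scalemxAr subrr.
move=> /eigvec_free hz; exists (c i 0); rewrite hc (bigD1 i) //= big1 ?addr0 // => j ji.
have /eqP := hz j; rewrite mulf_eq0 => /orP [/eqP -> |]; first by rewrite scale0r.
by rewrite subr_eq0 => /eqP /rI e; rewrite e eqxx in ji.
Qed.

End Eigenbasis.

(** At a multiple root the derivative of the characteristic polynomial vanishes, so its value at [A]
    kills an eigenvector and has determinant 0. *)
Lemma badness_roots (F : closedFieldType) (A : 'M[F]_N) : badness A != 0 ->
  exists2 r : 'I_N -> F, injective r & char_poly A = \prod_i ('X - (r i)%:P).
Proof.
rewrite mulf_eq0 negb_or => /andP [hd _].
have [rs hrs] := closed_field_poly_normal (char_poly A).
rewrite (monicP (char_poly_monic A)) scale1r in hrs.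
have srs : size rs = N by apply/eqP; rewrite -eqSS -(size_prod_XsubC rs id) -hrs size_char_poly.
pose r (i : 'I_N) := rs`_i.
have hr : char_poly A = \prod_i ('X - (r i)%:P).
  by rewrite hrs (big_nth 0) srs big_mkord.
exists r => // i j rij; apply/eqP; apply: contraNT hd => ij.
have rt : root (char_poly A) (r i) by rewrite /root hr (bigD1 i) //= hornerM hornerXsubC subrr mul0r.
have dz : (char_poly A)^`().[r i] = 0.
  rewrite (deriv_root (etrans hr (prodXsubC_split r i))) (bigD1 j) 1?eq_sym //=.
  by rewrite hornerM hornerXsubC rij subrr mul0r.
have /eigenvalueP [v hv v0] : eigenvalue A (r i) by rewrite eigenvalue_root_char.
apply/det0P; exists v => //.
have hq p : v *m horner_mx A p = p.[r i] *: v.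
  elim/poly_ind: p => [|p a IH]; first by rewrite rmorph0 mulmx0 horner0 scale0r.
  rewrite rmorphD rmorphM /= horner_mx_X horner_mx_C mulmxDr -mulmxE mulmxA IH.
  by rewrite -scalemxAl hv mul_mx_scalar scalerA !hornerE scalerDl.
by rewrite hq dz scale0r.
Qed.

End Cyclic.

(** * Continuous eigenvalues and eigenvectors along a path *)

Local Open Scope classical_set_scope.

(** The order of [C] is only partial; the inverse of 1 plus the sum of the inverses replaces the
    minimum. *)
Lemma pos_lower_bound (C : numFieldType) (I : finType) (a : I -> C) : (forall i, 0 < a i) ->
  exists2 c, 0 < c & forall i, c <= a i.
Proof.
move=> ha; pose s := 1 + \sum_i (a i)^-1.
have hs : 0 <= \sum_i (a i)^-1 by apply: sumr_ge0 => i _; rewrite invr_ge0 ltW.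
have s0 : 0 < s by rewrite ltr_pwDl.
exists s^-1 => [|i]; first by rewrite invr_gt0.
rewrite invf_ple ?posrE // /s (bigD1 i) //= addrCA lerDl.
by rewrite addr_ge0 ?ler01 // sumr_ge0 // => j _; rewrite invr_ge0 ltW.
Qed.

Section Lifting.
Variables (R : realType) (C : numFieldType) (n : nat).
Local Notation N := n.+1.
Local Notation prodX r := (\prod_(i < N) ('X - (r i)%:P)).

Lemma root_close (x : 'I_N -> C) (a e : C) : 0 < e -> `|(prodX x).[a]| < e ^+ N ->
  exists i, `|x i - a| < e.
Proof.
move=> e0; apply: contraPP => /forallNP h.
rewrite horner_prod normr_prod; apply/negP.
have re (z : C) : `|z| \is Num.real by apply: normr_real.
have er : e \is Num.real by rewrite gtr0_real.
have ge i : e <= `|a - x i|.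
  by rewrite real_leNgt // distrC; apply/negP; apply: h.
have : e ^+ N <= \prod_(i < N) `|a - x i|.
  rewrite -[X in e ^+ X](card_ord N) -prodr_const; apply: ler_prod => i _.
  by rewrite ltW //= ge.
rewrite real_leNgt ?rpredX //; last by apply: rpred_prod => i _; apply: re.
by under [in X in _ -> X]eq_bigr do rewrite hornerXsubC.
Qed.

Lemma prodX_root (x : 'I_N -> C) a : root (prodX x) a -> exists i, a = x i.
Proof.
rewrite /root horner_prod => /prodf_eq0 [i _].
by rewrite hornerXsubC subr_eq0 => /eqP ->; exists i.
Qed.

Lemma rootX (x : 'I_N -> C) i : root (prodX x) (x i).
Proof. by rewrite /root (bigD1 i) //= hornerM hornerXsubC subrr mul0r. Qed.

Lemma prodX_match (x y : 'I_N -> C) : prodX x = prodX y -> injective y ->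
  exists2 pi : 'I_N -> 'I_N, injective pi & forall i, y i = x (pi i).
Proof.
move=> e yI; have h i : exists j, y i = x j by apply: prodX_root; rewrite e rootX.
have [pi hpi] := choice h; exists pi => // i j ij.
by apply: yI; rewrite !hpi ij.
Qed.

Lemma prodX_inj (x y : 'I_N -> C) : prodX x = prodX y -> injective y -> injective x.
Proof.
move=> e yI; have [pi piI hpi] := prodX_match e yI.
have [g gK gK'] := injF_bij piI.
by move=> i j; rewrite -(gK' i) -(gK' j) -!hpi => /yI ->.
Qed.

Lemma prodX_perm (x : 'I_N -> C) pi : injective pi -> prodX (fun i => x (pi i)) = prodX x.
Proof. by move=> piI; rewrite [RHS](reindex_inj piI). Qed.

Lemma prodX_of_roots (p : {poly C}) (x : 'I_N -> C) : p \is monic -> size p = N.+1 ->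
  injective x -> (forall i, root p (x i)) -> p = prodX x.
Proof.
move=> pm sp xI hx; have := @all_roots_prod_XsubC _ p (map x (enum 'I_N)).
rewrite size_map size_enum_ord sp (monicP pm) scale1r big_map big_enum; apply=> //.
  by apply/allP => _ /mapP [i _ ->].
by rewrite uniq_rootsE map_inj_uniq // enum_uniq.
Qed.

Variable P : R -> {poly C}.
Hypothesis Psplit : forall s, exists2 r : 'I_N -> C, injective r & P s = prodX r.
Hypothesis Pcont : forall a s, (P x).[a] @[x --> s] --> (P s).[a].

Lemma P_near (s : R) (a e : C) : 0 < e -> root (P s) a ->
  \forall x \near s, exists2 b, root (P x) b & `|b - a| < e.
Proof.
move=> e0 ra; have eN : 0 < e ^+ N by rewrite exprn_gt0.
have /cvgrPdist_lt /(_ _ eN) := @Pcont a s.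
apply: filterS => x; rewrite (rootP ra) sub0r normrN.
have [r rI ->] := Psplit x => /(root_close e0) [i hi].
by exists (r i) => //; apply: rootX.
Qed.

(** The discs of radius [d] around the [N] roots at [s0] are disjoint, and for [s] near [s0] each
    contains a root. There are only [N] roots, so each disc contains exactly one and labels it. *)
Lemma local_branches (s0 : R) : exists2 eta : R, 0 < eta & exists r : 'I_N -> R -> C,
  forall s, `|s - s0| < eta -> P s = prodX (r^~ s) /\ forall i, r i x @[x --> s] --> r i s.
Proof.
have [rho rhoI hrho] := Psplit s0.
have [d d0 hd] : exists2 d : C, 0 < d & forall i j, i != j -> d + d <= `|rho i - rho j|.
  pose f (ij : 'I_N * 'I_N) : C := if ij.1 == ij.2 then 1 else `|rho ij.1 - rho ij.2|.
  have f0 ij : 0 < f ij.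
    rewrite /f; case: eqVneq => ij12; first exact: ltr01.
    by rewrite normr_gt0 subr_eq0; apply: contra ij12 => /eqP /rhoI ->.
  have [c c0 hc] := pos_lower_bound f0.
  exists (c / 2); first by rewrite divr_gt0 ?ltr0n.
  by move=> i j ij; rewrite -splitr; have := hc (i, j); rewrite /f /= (negbTE ij).
have uniqb i j (x : C) : `|x - rho i| < d -> `|x - rho j| < d -> i = j.
  move=> hi hj; apply/eqP; apply: contraT => ij.
  have lt : `|rho i - rho j| < d + d.
    apply: le_lt_trans (ler_distD x _ _) _; rewrite distrC; exact: ltrD.
  by have := le_lt_trans (hd _ _ ij) lt; rewrite ltxx.
have H i : \forall x \near s0, exists2 b, root (P x) b & `|b - rho i| < d.
  by apply: P_near => //; rewrite hrho rootX.
have Hall : \forall x \near s0, forall i, exists2 b, root (P x) b & `|b - rho i| < d.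
  exact: filter_forall H.
have [eta /= eta0 Hb] := (nbhs_ballP s0 _).1 Hall.
exists eta => //.
have : forall s, exists f : 'I_N -> C, `|s - s0| < eta ->
    forall i, root (P s) (f i) /\ `|f i - rho i| < d.
  move=> s; have [hs|hs] := pselect (`|s - s0| < eta); last by exists rho.
  have hb : ball s0 eta s by rewrite /ball /= distrC.
  have h i : exists b, root (P s) b /\ `|b - rho i| < d.
    by have [b] := Hb s hb i; exists b.
  by have [f hf] := choice h; exists f.
move=> /choice [r hr]; exists (fun i s => r s i) => s hs.
have split s' : `|s' - s0| < eta -> P s' = prodX (r s').
  move=> hs'; have [x xI e] := Psplit s'.
  apply: prodX_of_roots => [|||i].
  - by rewrite e monic_prod_XsubC.
  - by rewrite e -big_enum size_prod_XsubC size_enum_ord.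
  - move=> i j ij; have [_ h1] := hr _ hs' i; have [_ h2] := hr _ hs' j.
    by apply: uniqb h1 _; rewrite ij.
  - by have [] := hr _ hs' i.
split; first exact: split.
move=> i; have [ri di] := hr _ hs i.
apply/cvgrPdist_lt => e e0.
(* The second bound keeps a nearby root in the disc around [rho i], hence on branch [i]. *)
have [e' e'0 he'] : exists2 e' : C, 0 < e' & e' <= e /\ e' <= d - `|r s i - rho i|.
  pose f (b : bool) := if b then e else d - `|r s i - rho i|.
  have f0 b : 0 < f b by case: b => //=; rewrite subr_gt0.
  have [c c0 hc] := pos_lower_bound f0.
  by exists c => //; split; [have := hc true|have := hc false].
have near1 := P_near e'0 ri.
have near2 : \forall x \near s, `|x - s0| < eta.
  apply/nbhs_ballP; exists (eta - `|s - s0|) => /=; first by rewrite subr_gt0.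
  move=> x; rewrite /ball /= => hx; apply: le_lt_trans (ler_distD s _ _) _.
  by rewrite -ltrBrDr distrC.
apply: filterS2 near1 near2 => x [b rb hb] hx.
have [j bj] : exists j, b = r x j by apply: prodX_root; rewrite -split.
have [_ hj] := hr _ hx j.
have bi : `|b - rho i| < d.
  apply: le_lt_trans (ler_distD (r s i) _ _) _; rewrite -ltrBrDr.
  exact: lt_le_trans hb he'.2.
have ij : i = j by apply: uniqb bi _; rewrite bj.
by rewrite distrC ij -bj -ij; apply: lt_le_trans hb he'.1.
Qed.

Definition branches (T : R) (r : 'I_N -> R -> C) := forall s, 0 <= s <= T ->
  P s = prodX (r^~ s) /\ forall i, r i x @[x --> s] --> r i s.

(** At [b] both families list the same distinct roots, so relabelling the second by a permutation
    makes them agree there. *)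
Lemma branches_glue (b c : R) (r r' : 'I_N -> R -> C) :
  0 <= b -> branches b r ->
  (forall s, b <= s <= c -> P s = prodX (r'^~ s) /\ forall i, r' i x @[x --> s] --> r' i s) ->
  exists2 r'', branches c r'' & forall i s, s <= b -> r'' i s = r i s.
Proof.
move=> b0 hr hr'; have [bc|cb] := leP b c; last first.
  by exists r => // s /andP [s0 sc]; apply: hr; rewrite s0 (le_trans sc) // ltW.
have bb : b <= b <= c by rewrite lexx.
have [e1 c1] : P b = prodX (r^~ b) /\ forall i, r i x @[x --> b] --> r i b.
  by apply: hr; rewrite b0 lexx.
have [e2 c2] := hr' _ bb.
have [y yI ey] := Psplit b.
have r'I : injective (r'^~ b) by apply: (prodX_inj (y := y)) => //; rewrite -e2.
have rI : injective (r^~ b) by apply: (prodX_inj (y := y)) => //; rewrite -e1.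
have [pi piI hpi] := prodX_match (etrans (esym e2) e1) rI.
exists (fun i s => if s <= b then r i s else r' (pi i) s); last by move=> i s ->.
move=> s /andP [s0 sc]; case: (ltgtP s b) => sb.
- have [e cs] : P s = prodX (r^~ s) /\ forall i, r i x @[x --> s] --> r i s.
    by apply: hr; rewrite s0 ltW.
  split=> // i; apply: cvg_trans (cs i); apply: near_eq_cvg.
  have : \forall x \near s, x < b by exact: lt_nbhsl.
  by apply: filterS => x /ltW ->.
- have [e cs] : P s = prodX (r'^~ s) /\ forall i, r' i x @[x --> s] --> r' i s.
    by apply: hr'; rewrite sc ltW.
  split=> [|i]; first by rewrite e -(prodX_perm _ piI).
  apply: cvg_trans (cs (pi i)); apply: near_eq_cvg.
  have : \forall x \near s, b < x by exact: lt_nbhsr.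
  by apply: filterS => x bx; rewrite leNgt bx.
- rewrite sb; split=> // i; apply/cvgrPdist_lt => e he.
  have /cvgrPdist_lt /(_ _ he) n1 := c1 i.
  have /cvgrPdist_lt /(_ _ he) n2 := c2 (pi i).
  apply: filterS2 n1 n2 => x h1 h2; case: ifP => _ //.
  by rewrite hpi.
Qed.

(** Local branches around the supremum of the reachable endpoints lead beyond it, unless [b] is
    reached first. *)
Lemma branches_extend (a b : R) r : 0 <= a -> a <= b -> branches a r ->
  exists2 r', branches b r' & forall i s, s <= a -> r' i s = r i s.
Proof.
move=> a0 ab hr.
pose S := [set c | a <= c <= b /\ exists2 r', branches c r' & forall i s, s <= a -> r' i s = r i s].
have Sa : S a by split; [rewrite lexx|exists r].
have hS : has_sup S by split; [exists a|exists b => c [/andP []]].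
have [eta eta0 [rl hl]] := local_branches (sup S).
have [c [/andP [ac cb] [r1 h1 e1]] hc] := sup_adherent eta0 hS.
have cs : c <= sup S.
  by apply: ub_le_sup; [exact: hS.2|split; [rewrite ac|exists r1]].
pose c' := Num.min b (sup S + eta / 2).
have c0 : 0 <= c by apply: le_trans ac.
have [|r2 h2 e2] := branches_glue (c := c') (r' := rl) c0 h1.
  move=> s /andP [s1 s2]; apply: hl.
  have s3 : s <= sup S + eta / 2 by apply: le_trans s2 _; rewrite /c' ge_min lexx orbT.
  rewrite ltr_norml; apply/andP; split.
    by rewrite ltrBrDr addrC (lt_le_trans hc).
  rewrite ltrBlDl (le_lt_trans s3) // ltrD2l.
  by rewrite ltr_pdivrMr // ltr_pMr // ltr1n.
have Sc : b <= sup S + eta / 2 \/ S c'.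
  have [|lt] := leP b (sup S + eta / 2); [by left|right].
  have ec : c' = sup S + eta / 2 by rewrite /c'; apply/min_idPr/ltW.
  split; last by exists r2 => // i s sa; rewrite e2 ?e1 // (le_trans sa).
  rewrite ec (ltW lt) andbT (le_trans ac) // (le_trans cs) // lerDl divr_ge0 // ltW //.
case: Sc => [h|h].
  exists r2; last by move=> i s sa; rewrite e2 ?e1 // (le_trans sa).
  by have <- : c' = b by rewrite /c'; apply/min_idPl.
exists r2; last by move=> i s sa; rewrite e2 ?e1 // (le_trans sa).
have : c' <= sup S by apply: ub_le_sup => //; exact: hS.2.
rewrite /c' ge_min => /orP [h'|].
  by have <- : c' = b by rewrite /c'; apply/min_idPl/(le_trans h'); rewrite lerDl divr_ge0 // ltW.
by rewrite gerDl leNgt divr_gt0.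
Qed.

(** The branches are extended from one integer to the next without changing earlier values, and the
    stages are then patched together. *)
Lemma branches_global (d : 'I_N -> C) : P 0 = prodX d -> exists r : 'I_N -> R -> C,
  (forall i, r i 0 = d i) /\ forall s, 0 <= s -> P s = prodX (r^~ s) /\ forall i, r i x @[x --> s] --> r i s.
Proof.
move=> hd; have [y yI ey] := Psplit 0.
have dI : injective d by apply: (prodX_inj (y := y)) => //; rewrite -hd.
have [eta eta0 [rl hl]] := local_branches 0.
have [e0 _] : P 0 = prodX (rl^~ 0) /\ forall i, rl i x @[x --> 0] --> rl i 0.
  by apply: hl; rewrite subrr normr0.
have [pi piI hpi] := prodX_match (etrans (esym e0) hd) dI.
have B0 : branches 0 (fun i => rl (pi i)).
  move=> s; rewrite -eq_le => /eqP <-.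
  by split=> [|i]; [rewrite e0 -(prodX_perm _ piI)|apply: (hl 0 _).2; rewrite subrr normr0].
have step (k : nat) (r : 'I_N -> R -> C) : exists r', branches k%:R r ->
    branches k.+1%:R r' /\ forall i s, s <= k%:R -> r' i s = r i s.
  have [h|h] := pselect (branches k%:R r); last by exists r.
  have kk : k%:R <= k.+1%:R :> R by rewrite ler_nat.
  by have [r' h1 h2] := branches_extend (ler0n _ k) kk h; exists r'.
have [F hF] := choice (fun kr : nat * ('I_N -> R -> C) => step kr.1 kr.2).
pose fix RR k := if k is k'.+1 then F (k', RR k') else (fun i => rl (pi i)).
have BR k : branches k%:R (RR k).
  by elim: k => [|k IH]; [exact: B0|exact: (hF (k, RR k) IH).1].
have agree k m : (k <= m)%N -> forall i s, s <= k%:R -> RR m i s = RR k i s.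
  move=> km; rewrite -(subnKC km); elim: (m - k)%N => [|j IH] i s sk; first by rewrite addn0.
  rewrite addnS [LHS](hF (_, RR _) (BR _)).2.
    exact: IH.
  by apply: (le_trans sk); rewrite ler_nat leq_addr.
(* The stage ends strictly beyond [s], so that it also gives the values of [r] at all points near
   [s]. *)
pose r i s := RR (Num.truncn s).+1 i s.
exists r; split=> [i|s s0].
  by rewrite /r (agree 0%N) //= hpi.
have sM := truncnS_gt s.
have [e cs] : P s = prodX ((RR (Num.truncn s).+1)^~ s) /\
    forall i, RR (Num.truncn s).+1 i x @[x --> s] --> RR (Num.truncn s).+1 i s.
  by apply: BR; rewrite s0 ltW.
split=> // i; apply: cvg_trans (cs i); apply: near_eq_cvg.
have := lt_nbhsl sM; apply: filterS => x xM.
by rewrite /r (agree (Num.truncn x).+1) ?ltnS ?truncn_le_nat // ltW // truncnS_gt.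
Qed.

End Lifting.

Lemma horner_cvg (C : numFieldType) (T : Type) (F : set_system T) (FF : Filter F)
    (p : {poly C}) (f : T -> C) (a : C) : f x @[x --> F] --> a -> p.[f x] @[x --> F] --> p.[a].
Proof.
move=> h; elim/poly_ind: p => [|p c IH].
  under eq_fun do rewrite horner0; rewrite horner0; exact: cvg_cst.
under eq_fun do rewrite hornerMXaddC; rewrite hornerMXaddC.
by apply: cvgD; [apply: cvgM|apply: cvg_cst].
Qed.

(** * A line avoiding the roots, and eigenbases along it *)

Section Path.
Local Open Scope complex_scope.
Variable R : realType.
Local Notation C := (CC R).

Definition cplx (x : R) : C := x%:C.

Lemma cplx_cvg (s : R) : cplx x @[x --> s] --> cplx s.
Proof.
rewrite /cplx.
apply/cvgrPdist_lt => e e0.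
have er : e \is Num.real by rewrite gtr0_real.
have e1 : 0 < complex.Re e by rewrite -ltcR (RRe_real er).
apply/nbhs_ballP; exists (complex.Re e) => //= x; rewrite /ball /= => h.
by rewrite -[in X in _ < X](RRe_real er) -rmorphB /= normc_def /= expr0n addr0 sqrtr_sqr ltcR.
Qed.

(** Every nonzero real multiple of [1 +i* x] has slope [x]; taking [x] larger than the slopes of all
    roots keeps them off the line. *)
Lemma avoiding_line (b : {poly C}) : b.[0] != 0 ->
  exists2 w : C, w != 0 & forall s : R, b.[cplx s * w] != 0.
Proof.
move=> b0; have [rs hrs] := closed_field_poly_normal (b : {poly R[i]}).
pose sl (z : R[i]) := complex.Im z / complex.Re z.
pose x : R := 1 + \sum_(z <- rs) `|sl z|.
have hx z : z \in rs -> sl z != x.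
  move=> zrs; rewrite lt_eqF // (le_lt_trans (ler_norm _)) // /x.
  rewrite (big_rem z) //= addrCA ltrDl; apply: ltr_pwDl => //.
  by apply: sumr_ge0.
exists (1 +i* x) => [|s].
  by rewrite eq_complex /= oner_eq0.
apply/negP => h; have lb : lead_coef b != 0.
  by rewrite lead_coef_eq0; apply: contraNneq b0 => ->; rewrite horner0.
have : root (\prod_(z <- rs) ('X - z%:P)) (s%:C * (1 +i* x)).
  by move: h; rewrite {1}hrs hornerZ mulf_eq0 (negbTE lb).
rewrite root_prod_XsubC => zrs.
have [s0|s0] := eqVneq s 0.
  by move: h; rewrite s0 mul0r (negbTE b0).
have /eqP := hx _ zrs; apply.
by rewrite /sl /= !mul0r addr0 subr0 mulr1 mulrAC divff // mul1r.
Qed.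

End Path.

Section Family.
Variables (R : realType) (C : numFieldType) (n : nat).
Local Notation N := n.+1.
Variables (X : 'M[{poly C}]_N) (gamma : R -> C) (d : 'I_N -> C).
Hypothesis gamma0 : gamma 0 = 0.
Hypothesis gamma_cvg : forall s, gamma x @[x --> s] --> gamma s.
Let A (s : R) : 'M[C]_N := map_mx (horner_eval (gamma s)) X.
Hypothesis splits : forall s, exists2 r : 'I_N -> C, injective r &
  char_poly (A s) = \prod_i ('X - (r i)%:P).
Hypothesis X0 : map_mx (horner_eval 0) X = diag_mx (\row_i d i).

Let charA_cvg a s : (char_poly (A x)).[a] @[x --> s] --> (char_poly (A s)).[a].
Proof.
have E x : (char_poly (A x)).[a] = ((char_poly X).[a%:P]).[gamma x].
  rewrite /A -map_char_poly -[a in LHS](hornerC a (gamma x)).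
  by rewrite -[(a%:P).[gamma x]]/(horner_eval (gamma x) a%:P) horner_map.
under eq_fun do rewrite E; rewrite E; exact: horner_cvg (@gamma_cvg s).
Qed.

Lemma cvg_sumr (T : Type) (F : set_system T) (FF : Filter F) (I : Type) (l : seq I)
    (f : I -> T -> C) (a : I -> C) : (forall i, f i x @[x --> F] --> a i) ->
  \sum_(i <- l) f i x @[x --> F] --> \sum_(i <- l) a i.
Proof.
move=> h; elim: l => [|i l IH].
  by under eq_fun do rewrite big_nil; rewrite big_nil; apply: cvg_cst.
by under eq_fun do rewrite big_cons; rewrite big_cons; apply: cvgD.
Qed.

Lemma mulmx_cvg (T : Type) (F : set_system T) (FF : Filter F) m k l
    (f : T -> 'M[C]_(m, k)) (g : T -> 'M[C]_(k, l)) (a : 'M[C]_(m, k)) (b : 'M[C]_(k, l)) :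
  (forall p q, f x p q @[x --> F] --> a p q) -> (forall p q, g x p q @[x --> F] --> b p q) ->
  forall p q, (f x *m g x) p q @[x --> F] --> (a *m b) p q.
Proof.
move=> hf hg p q; under eq_fun do rewrite mxE; rewrite mxE.
by apply: cvg_sumr => j; apply: cvgM.
Qed.

(** At [s = 0] the matrix is diagonal with eigenvalues [d], so [eigvec] is a basis vector times the
    product of the [d i - d j] over [j != i]. *)
Lemma eigenbasis_path : exists (r : 'I_N -> R -> C) (v : 'I_N -> R -> 'cV[C]_N),
  [/\ forall s : R, 0 <= s -> char_poly (A s) = \prod_i ('X - (r i s)%:P),
      forall (s : R) i, 0 <= s -> v i s = eigvec (A s) (r^~ s) i,
      forall (s : R) i p, 0 <= s -> v i x p 0 @[x --> s] --> v i s p 0 &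
      forall i, exists2 c, c != 0 & forall p, v i 0 p 0 = if p == i then c else 0].
Proof.
have c0 : char_poly (A 0) = \prod_i ('X - (d i)%:P).
  rewrite /A gamma0 X0 char_poly_trig ?diag_mx_is_trig //; apply: eq_bigr => i _.
  by rewrite !mxE eqxx mulr1n.
have [r [r0 hr]] := branches_global splits charA_cvg c0.
exists r, (fun i s => eigvec (A s) (r^~ s) i); split=> //.
- by move=> s s0; have [] := hr s s0.
- move=> s i p s0; have [_ cr] := hr s s0.
  suff L (l : seq 'I_N) q : (horner_mx (A x) (\prod_(j <- l) ('X - (r j x)%:P)) *m (const_mx 1 : 'cV_N)) q 0
      @[x --> s] --> (horner_mx (A s) (\prod_(j <- l) ('X - (r j s)%:P)) *m (const_mx 1 : 'cV_N)) q 0.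
    rewrite /eigvec; under eq_fun do rewrite -big_filter; rewrite -big_filter; exact: L.
  elim: l q => [|j l IH] q.
    under eq_fun do rewrite big_nil rmorph1 mul1mx mxE.
    rewrite big_nil rmorph1 mul1mx mxE; exact: cvg_cst.
  have E2 x : horner_mx (A x) (\prod_(k <- j :: l) ('X - (r k x)%:P)) *m const_mx 1
    = (A x - (r j x)%:M) *m (horner_mx (A x) (\prod_(k <- l) ('X - (r k x)%:P)) *m const_mx 1 : 'cV_N).
    by rewrite big_cons rmorphM rmorphB /= horner_mx_X horner_mx_C mulmxA.
  under eq_fun do rewrite E2; rewrite E2.
  apply: mulmx_cvg => [a b|a b]; last by rewrite (ord1 b); exact: IH.
  under eq_fun do rewrite !mxE; rewrite !mxE.
  apply: cvgB; first exact: (horner_cvg _ (@gamma_cvg s)).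
  case: (a == b); last exact: cvg_cst.
  by under eq_fun do rewrite mulr1n; rewrite mulr1n; exact: cr.
- move=> i; have dI : injective d.
    have [y yI ey] := splits 0; apply: (prodX_inj (y := y)) => //; by rewrite -c0.
  exists (\prod_(j | j != i) (d i - d j)).
    apply/prodf_neq0 => j ji; rewrite subr_eq0; apply: contra ji => /eqP /dI ->; exact: eqxx.
  move=> p; rewrite /eigvec /A gamma0 X0 horner_mx_diag mul_diag_mx !mxE mulr1 horner_prod.
  under eq_bigr do rewrite hornerXsubC r0.
  case: eqP => [-> //|/eqP pi]; by rewrite (bigD1 p) //= subrr mul0r.
Qed.

End Family.

Section Abstract.
Variable R : realType.
Local Notation C := (CC R).

Lemma spectral_path n (X : 'M[{poly C}]_n) (d : 'I_n -> C) (B : C -> 'M[C]_n -> Prop) :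
  injective d -> map_mx (horner_eval 0) X = diag_mx (\row_i d i) ->
  (forall e, e != 0 -> let Xe := map_mx (horner_eval e) X in
     B e Xe /\ forall Y, B e Y -> Y *m Xe = Xe *m Y) ->
  exists2 w : C, w != 0 & exists v : 'I_n -> R -> 'cV[C]_n,
    (forall t : R, 0 < t -> simple_spectrum_basis (B (cplx t^-1 * w)) (fun i => v i t)) /\
    (forall i p, {within `]0, +oo[, continuous (fun t => v i t p 0)}) /\
    exists (s : 'S_n) (c : 'I_n -> C), (forall i, c i != 0) /\
      (forall i p, (v i t p 0) @[t --> +oo] --> (if p == s i then c i else 0)).
Proof.
case: n X d B => [|n] X d B dI X0 hB.
  exists 1; first exact: oner_neq0.
  exists (fun i t => 0); split; last first.
    by split=> [[]|] //; exists (perm_one _), (fun=> 1); split=> [i|[]] //; apply: oner_neq0.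
  move=> t t0; split; [|by case|by case].
  by rewrite unitmxE det_mx00 unitr1.
have b0 : (badness X).[0] != 0.
  rewrite -[_.[0]]/(horner_eval 0 (badness X)) -badness_map X0; exact: badness_diag.
have [w w0 hw] := avoiding_line b0.
pose gamma (s : R) : C := cplx s * w.
have g0 : gamma 0 = 0 by rewrite /gamma /cplx rmorph0 mul0r.
have gc s : gamma x @[x --> s] --> gamma s by exact: (cvgM (@cplx_cvg R s) (cvg_cst w)).
have good s : badness (map_mx (horner_eval (gamma s)) X) != 0 by rewrite badness_map; apply: hw.
have spl s : exists2 r : 'I_n.+1 -> C, injective r &
  char_poly (map_mx (horner_eval (gamma s)) X) = \prod_i ('X - (r i)%:P).
  exact: (@badness_roots n (R[i] : closedFieldType) _ (good s)).
have [r [v [h1 h2 h3 h4]]] := eigenbasis_path g0 gc spl X0.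
(* With [s = 1 / t] the value at [s = 0] becomes the limit at infinity. *)
exists w => //; exists (fun i t => v i t^-1); split; [|split].
- move=> t t0; have s0 : 0 <= t^-1 by rewrite invr_ge0 ltW.
  have e0 : cplx t^-1 * w != 0.
    by rewrite mulf_neq0 // /cplx fmorph_eq0 invr_eq0 gt_eqF.
  have [BX cX] := hB _ e0; have [y yI ey] := spl t^-1.
  have rI : injective (r^~ t^-1) by apply: (prodX_inj (y := y)) => //; rewrite -h1.
  have kr : \det (krylov (map_mx (horner_eval (gamma t^-1)) X)) != 0.
    by have := good t^-1; rewrite mulf_eq0 negb_or => /andP [].
  have hr := h1 _ s0; split.
  + rewrite (_ : (\matrix_(_, _) _) = \matrix_(p, i) eigvec (map_mx (horner_eval (gamma t^-1)) X) (r^~ t^-1) i p 0).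
      exact: eigvec_unit.
    by apply/matrixP => p i; rewrite !mxE h2 // mxE.
  + by move=> i Y hY; rewrite h2 //; apply: eigvec_comm => //; apply: cX.
  + move=> i j ij; exists (map_mx (horner_eval (gamma t^-1)) X); split=> //.
    exists (r i t^-1), (r j t^-1); split; last 2 first.
    * by rewrite h2 //; apply: eigvecE.
    * by rewrite h2 //; apply: eigvecE.
    by apply: contra ij => /eqP /rI ->.
- move=> i p; apply: continuous_in_subspaceT => t; rewrite inE /= in_itv /= andbT => t0.
  have s0 : 0 <= t^-1 by rewrite invr_ge0 ltW.
  have := h3 _ i p s0; apply: cvg_comp.
  by apply: cvgV; [rewrite gt_eqF|apply: cvg_id].
- have [c hc] := choice (fun i => let: ex_intro2 c c0 h := h4 i in ex_intro (fun c => c != 0 /\ forall p, v i 0 p 0 = if p == i then c else 0) c (conj c0 h)).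
  (* The branches were labelled by the diagonal entries of [X] at 0, so the permutation is the
     identity. *)
  exists (perm_one _), c; split=> [i|i p]; first by have [] := hc i.
  rewrite perm1 -(hc i).2; have := h3 _ i p (lexx 0); apply: cvg_comp.
  by apply/gtr0_cvgV0; [exact: nbhs_pinfty_gt|exact: cvg_id].
Qed.

End Abstract.

Unset Implicit Arguments. Set Strict Implicit. Set Printing Implicit Defensive.

Theorem theoremB (R : realType) (orth : bool) (k : nat) (h : bool) (l mu : nat -> int) :
  (0 < k)%N ->
  (~~ orth -> h = false) ->
  (* 0 >= lambda_1 >= ... >= lambda_k *)
  l 1%N <= 0 -> (forall j, (1 <= j)%N -> (j < k)%N -> l j.+1 <= l j) ->
  (* 0 >= mu_1 >= ... >= mu_{k-1} *)
  ((1 < k)%N -> mu 1%N <= 0) -> (forall j, (1 <= j)%N -> (j.+1 < k)%N -> mu j.+1 <= mu j) ->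
  (* V_mu occurs in the restriction of V_lambda (branching rule) *)
  (forall j, (1 <= j)%N -> (j < k)%N ->
     l j.+1 <= mu j /\ mu j <= (if j == 1%N then 0 else l j.-1)) ->
  let Ss := shapes orth h k l mu in
  let N := sumdim Ss in
  exists z : R -> 'I_k -> CC R,
    (forall j, z 0 j = 0) /\
    (forall j, {within `[0, +oo[, continuous (fun t => z t j)}) /\
    exists v : 'I_N -> R -> 'cV[CC R]_N,
      (forall t : R, 0 < t ->
         simple_spectrum_basis (@imB (CC R) orth Ss (params orth h k l mu (zext (z t))))
                               (fun i => v i t)) /\
      (forall i p, {within `]0, +oo[, continuous (fun t => v i t p 0)}) /\
      exists (s : 'S_N) (c : 'I_N -> CC R),
        (forall i, c i != 0) /\
        (forall i p, (v i t p 0) @[t --> +oo] --> (if p == s i then c i else 0)).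
Proof.
move=> k0 orth_h l1 l_dec mu1 mu_dec branching Ss N.
pose P0 := params orth h k l mu (fun=> 0 : CC R).
have [q [q0 valI]] := @ex_generic (CC R) orth h k l mu k0.
have hP : admissibleS orth Ss P0 by exact: admissible_shapes.
have hk : all (fun ms => size ms == k) Ss by exact: size_shapes.
(* This solves [(1 - c^2) q = 1]; the default 0 matches that of [zext]. *)
pose c n : CC R := if (n < k)%N then sqrtc (1 - (q n)^-1) else 0.
have hc n : (n < k)%N -> (1 - c n ^+ 2) * q n = 1.
  move=> nk; have -> : c n ^+ 2 = 1 - (q n)^-1 by rewrite /c nk; exact: sqr_sqrtc.
  by rewrite opprB addrCA subrr addr0 mulVf.
have [X [X0 hX]] := spectral_family hk hP hc.
have [w w0 [v [hv hlim]]] := spectral_path valI X0 hX.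
(* This is [c j / e] at [e = w / t], written so that it makes sense and vanishes at [t = 0]. *)
exists (fun t j => cplx t * (c j / w)); split; [|split].
- by move=> j; rewrite /cplx rmorph0 mul0r.
- move=> j; apply: continuous_subspaceT => t.
  exact: (cvgM (@cplx_cvg R t) (cvg_cst _)).
exists v; split=> // t t0.
rewrite params_shift.
have -> : zext (fun j : 'I_k => cplx t * (c j / w)) = (fun n => c n / (cplx t^-1 * w)).
  apply/funext => n; rewrite /zext; case: insubP => [i _ <-|nk].
    by rewrite invfM /cplx fmorphV invrK mulrCA.
  by rewrite /c (negbTE nk) mul0r.
exact: hv.
Qed.
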